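(* Let $f:\mathbb{R}\to\mathbb{R}$ be a $\mathcal{C}^\infty$-function all of whose derivatives grow at most polynomially at infinity, satisfying Condition (S$_{\beta_+,\beta_-,R}$) with $\beta_-\geqslant\beta_+>1$ and $R\geqslant1$, and let $u_0$ be a tempered distribution satisfying Condition (C3$_{\mu,\alpha,r}$), where $\mu\in(0,1]$, $\alpha-\mu>\beta_-$ and $0\leqslant r\leqslant R$ (both conditions are in the context, which also introduces $c_-,\tilde u,M,M'$). Let $u_f$ be the solution of $[i\partial_t-f(D)]u_f(t)=0$ $(t\geqslant0)$, $u_f(0)=u_0$. Let $a:=\lim_{p\to-\infty}f'(p)$, $b:=\lim_{p\to+\infty}f'(p)$ (which are finite) and $$\mathfrak{C}_f(-\infty,+\infty):=\Big\{(t,x)\in(0,+\infty)\times\mathbb{R} : a<\frac{x}{t}<b\Big\},$$ and let $\mathfrak{C}_f(-\infty,+\infty)^c$ be its complement in $(0,+\infty)\times\mathbb{R}$. Then $$\forall\,(t,x)\in\mathfrak{C}_f(-\infty,+\infty)\qquad |u_f(t,x)|\leqslant c^{(1)}(u_0,f)\,t^{-\frac\mu2}+c^{(2)}(u_0,f)\,t^{-\frac12},$$ $$\forall\,(t,x)\in\mathfrak{C}_f(-\infty,+\infty)^c\qquad |u_f(t,x)|\leqslant c_c^{(1)}(u_0,f)\,t^{-\mu}+c_c^{(2)}(u_0,f)\,t^{-1},$$ with the following constants. Put $N:=\lceil R\rceil+1$, $J_-:=[-N,0]$, $J_+:=[0,N]$, $m_\pm:=\min_{p\in J_\pm}f''(p)>0$,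 $\tilde m_-:=\min\{f'(-N)-a,\,b-f'(0)\}>0$, $\tilde m_+:=\min\{f'(0)-a,\,b-f'(N)\}>0$. Then $$c^{(1)}(u_0,f):=\sum_{s\in\{-,+\}}\left[\frac{1}{2\pi}\,\frac3\mu\,\|\tilde u\|_{L^\infty(J_s)}+\frac1\pi\left(4\|\tilde u\|_{L^\infty(J_s)}+\|\tilde u'\|_{L^1(J_s)}\right)m_s^{-1}\right],$$ $$c^{(2)}(u_0,f):=\frac{2^{2-\mu+\alpha}M}{\pi}\,\frac{\alpha+1-\mu}{\alpha-\mu}+\frac{2^{2-\mu+\beta_-}\,(2^{\alpha+2}M+M')}{\pi\,c_-}\,\frac{\alpha+1-\mu-\beta_-}{\alpha-\mu-\beta_-},$$ $$c_c^{(1)}(u_0,f):=\sum_{s\in\{-,+\}}\left[\frac{1}{2\pi}\,\frac1\mu\,\|\tilde u\|_{L^\infty(J_s)}+\frac1{2\pi}\left(4\|\tilde u\|_{L^\infty(J_s)}+\|\tilde u'\|_{L^1(J_s)}\right)\tilde m_s^{-1}\right],$$ $$c_c^{(2)}(u_0,f):=\frac{\beta_--1}{\pi\,c_-}\Big(3\cdot2^{-\mu+\alpha+\beta_-}M+2^{-\mu+\beta_-}(2^\alpha M+M')\Big)\,\frac{\alpha+2-\mu-\beta_-}{\alpha+1-\mu-\beta_-}.$$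
   Context: Fourier transform: $\mathcal{F}u(p)=\int_{\mathbb{R}}u(x)e^{-ixp}\,dx$, extended to tempered distributions $\mathcal{S}'(\mathbb{R})$. The Fourier multiplier $f(D):\mathcal{S}'(\mathbb{R})\to\mathcal{S}'(\mathbb{R})$ is $f(D)u=\mathcal{F}^{-1}(f\,\mathcal{F}u)$. The evolution equation has a unique solution in $\mathcal{C}^1(\mathbb{R}_+,\mathcal{S}'(\mathbb{R}))$, namely $u_f(t)=\mathcal{F}^{-1}(e^{-itf}\mathcal{F}u_0)$; when $\mathcal{F}u_0\in L^1(\mathbb{R})$ (as is the case under Condition (C3$_{\mu,\alpha,r}$)) it is the function $$u_f(t,x)=\frac{1}{2\pi}\int_{\mathbb{R}}\mathcal{F}u_0(p)\,e^{-itf(p)+ixp}\,dp,\qquad (t,x)\in\mathbb{R}_+\times\mathbb{R}.$$ Condition (S$_{\beta_+,\beta_-,R}$) ($\beta_-\geqslant\beta_+>1$, $R\geqslant1$): $f\in\mathcal{C}^\infty(\mathbb{R},\mathbb{R})$, $f''>0$ on $\mathbb{R}$, and there are constants $c_+\geqslant c_->0$ such that $c_-|p|^{-\beta_-}\leqslant f''(p)\leqslant c_+|p|^{-\beta_+}$ for all $|p|\geqslant R$. Condition (C3$_{\mu,\alpha,r}$) ($\mu\in(0,1]$, $\alpha>\mu$, $r\geqslant0$): there exists a bounded differentiable function $\tilde u:\mathbb{R}\to\mathbb{C}$, with $\tilde u(0)\neq0$ if $\mu\neq1$, such that $\mathcal{F}u_0(p)=|p|^{\mu-1}\,\tilde u(p)$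 for all $p\in\mathbb{R}\setminus\{0\}$; there is $M\geqslant0$ such that $|\tilde u(p)|\leqslant M(1+p^2)^{-\alpha/2}$ for all $p\in\mathbb{R}$; and $\tilde u'\in L^1_{loc}(\mathbb{R})$ and there is $M'\geqslant0$ such that $\|\tilde u'\|_{L^1(n,n+1)}\leqslant M'|n|^{-\alpha}$ for all $n\in\mathbb{Z}$ with $|n|\geqslant r$ (if $r=0$, the condition for $n=0$ is regarded as void). *)

(* Defs.v *)
From mathcomp Require Import all_boot all_order all_algebra.
From mathcomp Require Import all_classical all_reals all_analysis.
From mathcomp Require Export complex.

Set Implicit Arguments.
Unset Strict Implicit.
Unset Printing Implicit Defensive.

Import Order.TTheory GRing.Theory Num.Theory.
Import numFieldNormedType.Exports.

Local Open Scope ring_scope.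
Local Open Scope complex_scope.
Local Open Scope classical_set_scope.

(* The modulus of a complex number as an element of [R]; the generic norm
   [`|z|] of [z : R[i]] is an element of [R[i]]. *)
Notation normc := ComplexField.Normc.normc.

Section ComplexValuedFunctions.
Variable R : realType.
Implicit Types (g phi : R -> R[i]) (A : set R).

(* [R[i]] carries no normed-module structure over [R], so limits, derivatives
   and Lebesgue integrals of complex-valued functions are taken on the real
   and imaginary parts. *)
Definition ccvg_to (T : Type) (F : set_system T) (h : T -> R[i]) (l : R[i]) :=
  complex.Re (h x) @[x --> F] --> complex.Re l /\
  complex.Im (h x) @[x --> F] --> complex.Im l.

Definition re_part g (x : R) : R := complex.Re (g x).
Definition im_part g (x : R) : R := complex.Im (g x).

Definition cderivable g (x : R) : Prop :=
  derivable (re_part g) x 1 /\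
  derivable (im_part g) x 1.

Definition cderiv g (x : R) : R[i] :=
  (re_part g)^`() x +i* (im_part g)^`() x.

Definition cderivn (n : nat) g : R -> R[i] := iter n cderiv g.

Definition csmooth g : Prop := forall n x, cderivable (cderivn n g) x.

Definition cintegrable A g : Prop :=
  lebesgue_measure.-integrable A (EFin \o (re_part g)) /\
  lebesgue_measure.-integrable A (EFin \o (im_part g)).

Definition cintegral A g : R[i] :=
  (\int[lebesgue_measure]_(x in A) re_part g x) +i*
  (\int[lebesgue_measure]_(x in A) im_part g x).

Definition clocally_integrable g : Prop :=
  locally_integrable setT (re_part g) /\
  locally_integrable setT (im_part g).

Definition cLnorm (q : \bar R) A g : \bar R :=
  ('N[lebesgue_measure]_q [(fun x => (normc (g x))%:E) \_ A])%E.

Definition expi (y : R) : R[i] := cos y +i* sin y.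

Definition fourier phi (p : R) : R[i] :=
  cintegral setT (fun x => phi x * expi (- (x * p))).

Definition inv_fourier phi (x : R) : R[i] :=
  ((2 * pi)^-1)%:C * cintegral setT (fun p => phi p * expi (x * p)).

Definition schwartz phi : Prop :=
  csmooth phi /\
  forall k l : nat, exists C : R,
    forall x, `|x| ^+ k * normc (cderivn l phi x) <= C.

Definition schwartz_seminorm (k l : nat) phi : R :=
  sup (range (fun x : R => `|x| ^+ k * normc (cderivn l phi x))).

End ComplexValuedFunctions.

(* A tempered distribution is encoded as a total functional, of which only the
   values on Schwartz functions are meaningful; accordingly equality of
   distributions is [dist_eq]. *)
Definition dist (R : realType) : Type := (R -> R[i]) -> R[i].

Section TemperedDistributions.
Variable R : realType.
Implicit Types (T : dist R) (f : R -> R) (g : R -> R[i]) (u : R -> dist R).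

Definition dist_eq T1 T2 : Prop := forall phi, schwartz phi -> T1 phi = T2 phi.

Definition tempered T : Prop :=
  (forall (c : R[i]) phi psi, schwartz phi -> schwartz psi ->
     T (fun x => c * phi x + psi x) = c * T phi + T psi) /\
  (exists (C : R) (m : nat), forall phi, schwartz phi ->
     normc (T phi) <=
       C * \sum_(k < m.+1) \sum_(l < m.+1) schwartz_seminorm k l phi).

(* [T] is the regular distribution given by the function [g]. *)
Definition represented_by T g : Prop :=
  forall phi, schwartz phi ->
    cintegrable setT (fun x => g x * phi x) /\
    T phi = cintegral setT (fun x => g x * phi x).

Definition dist_fourier T : dist R := fun phi => T (fourier phi).

Definition dist_inv_fourier T : dist R := fun phi => T (inv_fourier phi).

Definition dist_mul f T : dist R := fun phi => T (fun p => (f p)%:C * phi p).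

Definition fourier_multiplier f T : dist R :=
  dist_inv_fourier (dist_mul f (dist_fourier T)).

(* [u] is of class C^1 from [0, +oo[ to the tempered distributions, with
   derivative [du]. The topology on distributions is that of pointwise
   convergence on Schwartz functions; limits at [t] are taken within
   [0, +oo[, hence one-sided at 0. *)
Definition C1_dist u (du : R -> dist R) : Prop :=
  forall t : R, 0 <= t ->
  [/\ tempered (u t), tempered (du t),
      forall phi, schwartz phi ->
        ccvg_to (within [set s : R | 0 <= s] (t^'))
          (fun s => ((s - t)^-1)%:C * (u s phi - u t phi)) (du t phi)
    & forall phi, schwartz phi ->
        ccvg_to (within [set s : R | 0 <= s] (nbhs t))
          (fun s => du s phi) (du t phi)].

Definition evolution_solution f (u0 : dist R) u : Prop :=
  exists du : R -> dist R,
    [/\ C1_dist u du,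
        forall t, 0 <= t ->
          dist_eq (fun phi => (0 +i* 1) * du t phi - fourier_multiplier f (u t) phi)
                  (fun=> 0)
      & dist_eq (u 0) u0].

End TemperedDistributions.

Section Conditions.
Variable R : realType.
Implicit Types (f : R -> R) (ut : R -> R[i]).

Definition smooth f : Prop := forall n x, derivable (f^`(n)) x 1.

Definition derivatives_poly_growth f : Prop :=
  forall n : nat, exists (C : R) (k : nat),
    forall p, `|(f^`(n)) p| <= C * (1 + `|p|) ^+ k.

Record condition_S f (betap betam rho cp cm : R) : Prop := ConditionS {
  S_beta : 1 < betap <= betam;
  S_rho : 1 <= rho;
  S_smooth : smooth f;
  S_convex : forall p, 0 < (f^`(2)) p;
  S_c : 0 < cm <= cp;
  S_bounds : forall p, rho <= `|p| ->
    cm * `|p| `^ (- betam) <= (f^`(2)) p <= cp * `|p| `^ (- betap) }.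

Definition amplitude (mu : R) ut (p : R) : R[i] :=
  (`|p| `^ (mu - 1))%:C * ut p.

Record condition_C3 (u0 : dist R) (mu alpha r : R) ut (M M' : R) : Prop :=
  ConditionC3 {
  C3_mu : 0 < mu <= 1;
  C3_alpha : mu < alpha;
  C3_r : 0 <= r;
  C3_bounded : exists B : R, forall p, normc (ut p) <= B;
  C3_derivable : forall p, cderivable ut p;
  C3_ut0 : mu != 1 -> ut 0 != 0;
  C3_fourier : represented_by (dist_fourier u0) (amplitude mu ut);
  C3_M : 0 <= M;
  C3_decay : forall p, normc (ut p) <= M * (1 + p ^+ 2) `^ (- (alpha / 2));
  C3_locint : clocally_integrable (cderiv ut);
  C3_M' : 0 <= M';
  C3_deriv_decay : forall n : int, r <= `|n%:~R| -> n != 0 ->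
    (cLnorm 1 `]n%:~R, (n + 1)%:~R[ (cderiv ut)
       <= (M' * `|n%:~R| `^ (- alpha))%:E)%E }.

(* The function representing the solution at time [t]. *)
Definition solution_fun f (mu : R) ut (t x : R) : R[i] :=
  ((2 * pi)^-1)%:C *
  cintegral setT (fun p => amplitude mu ut p * expi (- (t * f p) + x * p)).

End Conditions.

Section Constants.
Variable R : realType.
Implicit Types (f : R -> R) (ut : R -> R[i]) (A : set R).

Definition slope_ninfty f : R := lim ((f^`()) p @[p --> -oo]).
Definition slope_pinfty f : R := lim ((f^`()) p @[p --> +oo]).

Definition cone f : set (R * R) :=
  [set tx | 0 < tx.1 /\ slope_ninfty f < tx.2 / tx.1 < slope_pinfty f].

Definition cone_compl f : set (R * R) := [set tx | 0 < tx.1] `\` cone f.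

Definition cutoff (rho : R) : R := (Num.ceil rho + 1)%:~R.

Definition Jminus (rho : R) : set R := `[- cutoff rho, 0].
Definition Jplus (rho : R) : set R := `[0, cutoff rho].

(* On the compact intervals used below the infimum is a minimum. *)
Definition min_f2 f A : R := inf [set (f^`(2)) p | p in A].

Definition mtilde_minus f (rho : R) : R :=
  Num.min ((f^`())%classic (- cutoff rho) - slope_ninfty f)
          (slope_pinfty f - (f^`())%classic 0).

Definition mtilde_plus f (rho : R) : R :=
  Num.min ((f^`())%classic 0 - slope_ninfty f)
          (slope_pinfty f - (f^`())%classic (cutoff rho)).

Definition Linf_norm A (g : R -> R[i]) : R := fine (cLnorm +oo%E A g).
Definition L1_norm A (g : R -> R[i]) : R := fine (cLnorm 1 A g).

Definition c1_term (mu : R) ut A (m : R) : R :=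
  (2 * pi)^-1 * (3 / mu) * Linf_norm A ut
  + pi^-1 * (4 * Linf_norm A ut + L1_norm A (cderiv ut)) * m^-1.

Definition c1 f (mu : R) ut (rho : R) : R :=
  c1_term mu ut (Jminus rho) (min_f2 f (Jminus rho))
  + c1_term mu ut (Jplus rho) (min_f2 f (Jplus rho)).

Definition c2 (mu alpha betam cm M M' : R) : R :=
  2 `^ (2 - mu + alpha) * M / pi * ((alpha + 1 - mu) / (alpha - mu))
  + 2 `^ (2 - mu + betam) * (2 `^ (alpha + 2) * M + M') / (pi * cm)
    * ((alpha + 1 - mu - betam) / (alpha - mu - betam)).

Definition cc1_term (mu : R) ut A (m : R) : R :=
  (2 * pi)^-1 * (1 / mu) * Linf_norm A ut
  + (2 * pi)^-1 * (4 * Linf_norm A ut + L1_norm A (cderiv ut)) * m^-1.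

Definition cc1 f (mu : R) ut (rho : R) : R :=
  cc1_term mu ut (Jminus rho) (mtilde_minus f rho)
  + cc1_term mu ut (Jplus rho) (mtilde_plus f rho).

Definition cc2 (mu alpha betam cm M M' : R) : R :=
  (betam - 1) / (pi * cm)
  * (3 * 2 `^ (- mu + alpha + betam) * M
     + 2 `^ (- mu + betam) * (2 `^ alpha * M + M'))
  * ((alpha + 2 - mu - betam) / (alpha + 1 - mu - betam)).

End Constants.

(* Main.v *)
Require Import Defs.
From mathcomp Require Import all_boot all_order all_algebra.
From mathcomp Require Import all_classical all_reals all_analysis.
From mathcomp Require Import measurable_realfun ess_sup_inf.
From mathcomp Require Import ring lra.

Set Implicit Arguments.
Unset Strict Implicit.
Unset Printing Implicit Defensive.

Import Order.TTheory GRing.Theory Num.Theory.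
Import numFieldNormedType.Exports.

Local Open Scope ring_scope.
Local Open Scope complex_scope.
Local Open Scope classical_set_scope.

(** The solution is an oscillatory integral in the momentum [p] with phase
    [th p = x p - t f p], whose derivative [th' = t (x / t - f' p)] is strictly
    monotone. The cone consists of the [(t, x)] for which [x / t] is a value of
    [f'], that is, for which the phase has a stationary point.

    Pointwise estimates. On an interval where [|th'| >= L], an integration by
    parts bounds the integral of [U exp (i th)] by the supremum of [U] and the
    [L^1]-norm of [U'], divided by [L] ([normc_oscillatory_le]); the monotonicity
    of [th'] controls the term with [th'']. With a stationary point [q], a window
    of radius [del] around [q] is cut out and estimated by its size, while outside
    of it [|th'| >= t min f'' del] ([normc_osc_stationary_le]). For
    [U = |p|^(mu - 1) ut] this is done on [[0, N]], where the singularity at 0 is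
    integrated out over [[0, del]], and on each [[n, n + 1]] with [n >= N], where
    [f''] is at least a multiple of [(n + 1)^(- beta)] and [ut] and [ut'] are of
    size [n^(- alpha)]; the sum over [n] converges because [alpha - mu > beta].
    The choice [del = t^(-1/2)] gives the bound in the cone
    ([halfline_stationary_le]). Outside of the cone [th'] does not vanish, and on
    [[n, n + 1]] it is at least [t] times the distance of [f'] to its limit, which
    is bounded below by integrating [f'']; then [del = t^(-1)]
    ([halfline_away_le]). The negative half-line is reduced to the positive one by
    reflection. As [ut] is only assumed differentiable with integrable derivative,
    integration by parts rests on the fundamental theorem of calculus for
    everywhere differentiable functions ([Rintegral_derive]).

    Representation of the solution. Testing with the Fourier transform of
    [X tau = exp (- i tau f) chi], [chi] the inverse transform of a test function
    [phi], the equation gives two equal partial derivatives: the value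
    [K s tau] of [u s] on the transform of [X tau] satisfies
    [dK / ds = dK / dtau = D], where [D] is the value on the transform of
    [- i f X tau] (Fourier inversion on Schwartz functions is used here). Hence
    [K t 0 = K 0 t], which says that [u t phi] is [u0] applied to the transform of
    [exp (- i t f) chi]; Fubini's theorem turns this into integration of [phi]
    against the oscillatory integral ([solution_represented]). The
    topology on distributions is weak, so [D] is only known to be separately
    continuous and the chain rule along [s + tau = c] is not available directly.
    A Baire category argument replaces it ([equal_partials_antidiagonal]); its
    input is that second-order remainders in [tau] are [O (h^2)] for each [s], as
    [u s], being tempered, is bounded on the bounded family of Schwartz functions
    [(X (tau + h) - X tau + i h f X tau) / h^2]. *)

(** * Modulus and derivatives of complex-valued functions *)

Section ComplexModulus.
Variable R : realType.
Implicit Types z w : R[i].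

Lemma ReM z w :
  complex.Re (z * w) = complex.Re z * complex.Re w - complex.Im z * complex.Im w.
Proof. by case: z w => [a b] [c d]. Qed.

Lemma ImM z w :
  complex.Im (z * w) = complex.Re z * complex.Im w + complex.Im z * complex.Re w.
Proof. by case: z w => [a b] [c d]. Qed.

Lemma ReD z w : complex.Re (z + w) = complex.Re z + complex.Re w.
Proof. by case: z w => [a b] [c d]. Qed.

Lemma ImD z w : complex.Im (z + w) = complex.Im z + complex.Im w.
Proof. by case: z w => [a b] [c d]. Qed.

Lemma ReN z : complex.Re (- z) = - complex.Re z.
Proof. by case: z. Qed.

Lemma ImN z : complex.Im (- z) = - complex.Im z.
Proof. by case: z. Qed.

Definition ReImE := (ReD, ImD, ReM, ImM, ReN, ImN).

Lemma complex_ext z w :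
  complex.Re z = complex.Re w -> complex.Im z = complex.Im w -> z = w.
Proof. by case: z w => [a b] [c d] /= -> ->. Qed.

Lemma normcE_Re_Im z :
  normc z = Num.sqrt (complex.Re z ^+ 2 + complex.Im z ^+ 2).
Proof. by case: z. Qed.

Lemma normc_ge0 z : 0 <= normc z.
Proof. by rewrite normcE_Re_Im sqrtr_ge0. Qed.

Lemma sqr_normc_Re_Im z :
  normc z ^+ 2 = complex.Re z ^+ 2 + complex.Im z ^+ 2.
Proof. by rewrite normcE_Re_Im sqr_sqrtr// addr_ge0 ?sqr_ge0. Qed.

Lemma normr_Re_le_normc z : `|complex.Re z| <= normc z.
Proof.
rewrite -(@ler_sqr _ `|_|) ?nnegrE ?normc_ge0// real_normK ?num_real//.
by rewrite sqr_normc_Re_Im lerDl sqr_ge0.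
Qed.

Lemma normr_Im_le_normc z : `|complex.Im z| <= normc z.
Proof.
rewrite -(@ler_sqr _ `|_|) ?nnegrE ?normc_ge0// real_normK ?num_real//.
by rewrite sqr_normc_Re_Im lerDr sqr_ge0.
Qed.

Lemma normc_le_Re_Im z : normc z <= `|complex.Re z| + `|complex.Im z|.
Proof.
rewrite -(@ler_sqr _ (normc z)) ?nnegrE ?normc_ge0 ?addr_ge0//.
rewrite sqr_normc_Re_Im sqrrD !real_normK ?num_real//.
by rewrite -addrA lerD2l lerDr mulrn_wge0// mulr_ge0.
Qed.

Lemma normc_real (x : R) : normc x%:C = `|x|.
Proof. by rewrite /= expr0n /= addr0 sqrtr_sqr. Qed.

Lemma normcM z w : normc (z * w) = normc z * normc w.
Proof. exact: ComplexField.Normc.normcM. Qed.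

Lemma le_normcD z w : normc (z + w) <= normc z + normc w.
Proof. exact: complex.le_normcD. Qed.

Lemma normcN z : normc (- z) = normc z.
Proof. exact: complex.normcN. Qed.

Lemma le_normcB z w : normc (z - w) <= normc z + normc w.
Proof. by rewrite (le_trans (le_normcD _ _))// normcN. Qed.

Lemma normc_i : normc ('i : R[i]) = 1.
Proof. by rewrite /= expr0n expr1n add0r sqrtr1. Qed.

Lemma normc_expi (y : R) : normc (expi y) = 1.
Proof. by rewrite /= cos2Dsin2 sqrtr1. Qed.

Lemma expiD (x y : R) : expi (x + y) = expi x * expi y.
Proof.
by apply: complex_ext; rewrite !ReImE /= ?cosD ?sinD// addrC.
Qed.

Lemma expi0 : expi (0 : R) = 1.
Proof. by apply: complex_ext; rewrite /= ?cos0 ?sin0. Qed.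

End ComplexModulus.

Section ComplexDerivative.
Variable R : realType.
Implicit Types (g h : R -> R[i]) (f : R -> R) (x : R) (z : R[i]).

Definition is_cderive g x z :=
  is_derive x 1 (re_part g) (complex.Re z) /\
  is_derive x 1 (im_part g) (complex.Im z).

Lemma is_deriveE f x l :
  is_derive x 1 f l <-> derivable f x 1 /\ f^`() x = l.
Proof.
split; first by case=> df <-; rewrite derive1E.
by case=> df; rewrite derive1E => fl; split.
Qed.

Lemma is_cderiveP g x z : is_cderive g x z <-> cderivable g x /\ cderiv g x = z.
Proof.
split.
  move=> [/is_deriveE[d1 e1] /is_deriveE[d2 e2]]; split; first by split.
  by rewrite /cderiv e1 e2; case: z {e1 e2}.
by move=> [[d1 d2] <-]; split; apply/is_deriveE; split.
Qed.

Lemma cderivableP g x : cderivable g x -> is_cderive g x (cderiv g x).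
Proof. by move=> gx; apply/is_cderiveP; split. Qed.

Lemma is_cderive_cst z x : is_cderive (fun=> z) x 0.
Proof. by split; exact: is_derive_cst. Qed.

Lemma is_derive1_eq f x a b : is_derive x 1 f a -> a = b -> is_derive x 1 f b.
Proof. by move=> + <-. Qed.

Lemma is_derive1D f1 f2 x a b : is_derive x 1 f1 a -> is_derive x 1 f2 b ->
  is_derive x 1 (fun y => f1 y + f2 y) (a + b).
Proof. by move=> h1 h2; have := is_deriveD h1 h2. Qed.

Lemma is_derive1B f1 f2 x a b : is_derive x 1 f1 a -> is_derive x 1 f2 b ->
  is_derive x 1 (fun y => f1 y - f2 y) (a - b).
Proof. by move=> h1 h2; have := is_deriveB h1 h2. Qed.

Lemma is_derive1M f1 f2 x a b : is_derive x 1 f1 a -> is_derive x 1 f2 b ->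
  is_derive x 1 (fun y => f1 y * f2 y) (a * f2 x + f1 x * b).
Proof.
move=> h1 h2; have := is_deriveM h1 h2.
by rewrite /GRing.scale /= addrC [f2 x * a]mulrC.
Qed.

Lemma is_cderiveD g h x z w : is_cderive g x z -> is_cderive h x w ->
  is_cderive (fun y => g y + h y) x (z + w).
Proof.
move=> [g1 g2] [h1 h2]; rewrite /is_cderive /re_part /im_part.
rewrite !ReImE; split; under eq_fun do rewrite !ReImE.
  exact: is_derive1D.
exact: is_derive1D.
Qed.

Lemma is_cderiveM g h x z w : is_cderive g x z -> is_cderive h x w ->
  is_cderive (fun y => g y * h y) x (z * h x + g x * w).
Proof.
move=> [g1 g2] [h1 h2]; rewrite /is_cderive /re_part /im_part.
rewrite !ReImE; split; under eq_fun do rewrite !ReImE.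
  apply: (is_derive1_eq (is_derive1B (is_derive1M g1 h1) (is_derive1M g2 h2))).
  by rewrite /re_part /im_part; ring.
apply: (is_derive1_eq (is_derive1D (is_derive1M g1 h2) (is_derive1M g2 h1))).
by rewrite /re_part /im_part; ring.
Qed.

Lemma is_cderive_real f x l :
  is_derive x 1 f l -> is_cderive (fun y => (f y)%:C) x l%:C.
Proof. by move=> fl; split => //=; exact: is_derive_cst. Qed.

Lemma is_derive1_comp (f1 f2 : R -> R) x a b :
  is_derive (f2 x) 1 f1 a -> is_derive x 1 f2 b ->
  is_derive x 1 (fun y => f1 (f2 y)) (a * b).
Proof.
by move=> h1 h2; have := @is_derive1_comp _ f1 f2 x a b h1 h2.
Qed.

Lemma is_cderive_comp g f x z l : is_cderive g (f x) z -> is_derive x 1 f l ->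
  is_cderive (fun y => g (f y)) x (z * l%:C).
Proof.
move=> [g1 g2] fl; rewrite /is_cderive !ReImE /= !mulr0 subr0 add0r.
by split; [exact: (is_derive1_comp g1 fl)|exact: (is_derive1_comp g2 fl)].
Qed.

Lemma is_cderive_expi0 x : is_cderive (@expi R) x ('i * expi x).
Proof.
rewrite /is_cderive !ReImE /=; split.
  by apply: (is_derive1_eq (is_derive_cos x)); rewrite mul0r sub0r mul1r.
by apply: (is_derive1_eq (is_derive_sin x)); rewrite mul0r add0r mul1r.
Qed.

Lemma is_cderive_expi f x l : is_derive x 1 f l ->
  is_cderive (fun y => expi (f y)) x ('i * l%:C * expi (f x)).
Proof.
move=> fl; rewrite mulrAC.
exact: (is_cderive_comp (is_cderive_expi0 _) fl).
Qed.

Lemma is_cderive_continuous g x z : is_cderive g x z ->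
  {for x, continuous (re_part g)} /\ {for x, continuous (im_part g)}.
Proof.
by move=> [[d1 _] [d2 _]]; split; apply: differentiable_continuous;
  exact/derivable1_diffP.
Qed.

Lemma is_cderive_eq g x z w : is_cderive g x z -> z = w -> is_cderive g x w.
Proof. by move=> + <-. Qed.

End ComplexDerivative.

(** * Integrals of complex-valued functions *)

Section ComplexIntegral.
Variable R : realType.
Local Notation mu := (@lebesgue_measure R).
Implicit Types (g h : R -> R[i]) (A : set R) (z : R[i]).

Definition cmeasurable A g :=
  measurable_fun A (re_part g) /\ measurable_fun A (im_part g).

Lemma cmeasurableD A g h : cmeasurable A g -> cmeasurable A h ->
  cmeasurable A (fun x => g x + h x).
Proof.
move=> [g1 g2] [h1 h2]; rewrite /cmeasurable /re_part /im_part.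
by split; under eq_fun do rewrite !ReImE; exact: measurable_funD.
Qed.

Lemma cmeasurableM A g h : cmeasurable A g -> cmeasurable A h ->
  cmeasurable A (fun x => g x * h x).
Proof.
move=> [g1 g2] [h1 h2]; rewrite /cmeasurable /re_part /im_part.
split; under eq_fun do rewrite !ReImE.
  by apply: measurable_funB; exact: measurable_funM.
by apply: measurable_funD; exact: measurable_funM.
Qed.

Lemma cmeasurable_cst A z : cmeasurable A (fun=> z).
Proof. by split; exact: measurable_cst. Qed.

Lemma cmeasurable_real A (f : R -> R) : measurable_fun A f ->
  cmeasurable A (fun x => (f x)%:C).
Proof. by move=> mf; split => //; exact: measurable_cst. Qed.

Lemma cmeasurable_expi A (f : R -> R) : measurable_fun A f ->
  cmeasurable A (fun x => expi (f x)).
Proof.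
move=> mf; split; rewrite /re_part/im_part /=.
  apply: (@measurableT_comp _ _ _ _ _ _ (@cos R)) => //.
  by apply: continuous_measurable_fun; exact: continuous_cos.
apply: (@measurableT_comp _ _ _ _ _ _ (@sin R)) => //.
by apply: continuous_measurable_fun; exact: continuous_sin.
Qed.

Lemma measurable_normc A g : cmeasurable A g ->
  measurable_fun A (fun x => normc (g x)).
Proof.
move=> [g1 g2]; under eq_fun do rewrite normcE_Re_Im.
apply: (@measurableT_comp _ _ _ _ _ _ (@Num.sqrt R)).
  by apply: continuous_measurable_fun; exact: sqrt_continuous.
by apply: measurable_funD; exact: measurable_funX.
Qed.

Lemma cmeasurableS A B g : measurable B -> A `<=` B ->
  cmeasurable B g -> cmeasurable A g.
Proof. by move=> mB AB [g1 g2]; split; exact: measurable_funS _ g1 || exact: measurable_funS _ g2. Qed.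

Lemma cintegrable_measurable A g : cintegrable A g -> cmeasurable A g.
Proof.
by move=> [/integrableP[/measurable_EFinP ? _] /integrableP[/measurable_EFinP ? _]].
Qed.

Lemma le_cintegrable A g (h : R -> R) : measurable A -> cmeasurable A g ->
  mu.-integrable A (EFin \o h) -> (forall x, A x -> normc (g x) <= h x) ->
  cintegrable A g.
Proof.
move=> mA [g1 g2] hi gh; split; apply: le_integrable hi => //=.
- exact/measurable_EFinP.
- move=> x Ax; rewrite lee_fin (le_trans _ (ler_norm _))// (le_trans _ (gh x Ax))//.
  exact: normr_Re_le_normc.
- exact/measurable_EFinP.
- move=> x Ax; rewrite lee_fin (le_trans _ (ler_norm _))// (le_trans _ (gh x Ax))//.
  exact: normr_Im_le_normc.
Qed.

Lemma integrable_le A (f h : R -> R) : measurable A -> measurable_fun A f ->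
  mu.-integrable A (EFin \o h) -> (forall x, A x -> `|f x| <= h x) ->
  mu.-integrable A (EFin \o f).
Proof.
move=> mA mf hi fh; apply: le_integrable hi => //=.
  exact/measurable_EFinP.
by move=> x Ax; rewrite lee_fin (le_trans (fh x Ax))// ler_norm.
Qed.

Lemma integrable_EFinD A (f h : R -> R) : measurable A ->
  mu.-integrable A (EFin \o f) -> mu.-integrable A (EFin \o h) ->
  mu.-integrable A (EFin \o (fun x => f x + h x)).
Proof.
by move=> mA fi hi; apply: (eq_integrable _ _ _ _ (integrableD _ fi hi)).
Qed.

Lemma integrable_EFinB A (f h : R -> R) : measurable A ->
  mu.-integrable A (EFin \o f) -> mu.-integrable A (EFin \o h) ->
  mu.-integrable A (EFin \o (fun x => f x - h x)).
Proof.
by move=> mA fi hi; apply: (eq_integrable _ _ _ _ (integrableB _ fi hi)).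
Qed.

Lemma integrable_EFinZl A (f : R -> R) (k : R) : measurable A ->
  mu.-integrable A (EFin \o f) ->
  mu.-integrable A (EFin \o (fun x => k * f x)).
Proof.
by move=> mA fi; apply: (eq_integrable _ _ _ _ (integrableZl _ k fi)).
Qed.

Lemma integrable_normc A g : measurable A -> cintegrable A g ->
  mu.-integrable A (EFin \o (fun x => normc (g x))).
Proof.
move=> mA gi; have [g1 g2] := gi.
apply: (@integrable_le _ _ (fun x => `|re_part g x| + `|im_part g x|)) => //.
- by apply: measurable_normc; exact: cintegrable_measurable.
- by apply: integrable_EFinD => //; exact: integrable_norm.
- by move=> x _; rewrite ger0_norm ?normc_ge0// normc_le_Re_Im.
Qed.

Lemma cintegrableS A B g : measurable A -> measurable B -> B `<=` A ->
  cintegrable A g -> cintegrable B g.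
Proof. by move=> mA mB BA [g1 g2]; split; [exact: integrableS g1|exact: integrableS g2]. Qed.

Lemma eq_cintegrable A g h : measurable A -> {in A, g =1 h} ->
  cintegrable A g -> cintegrable A h.
Proof.
move=> mA gh [g1 g2]; split.
  by apply: eq_integrable g1 => // x xA; rewrite /= /re_part gh.
by apply: eq_integrable g2 => // x xA; rewrite /= /im_part gh.
Qed.

Lemma eq_cintegral A g h : {in A, g =1 h} -> cintegral A g = cintegral A h.
Proof.
move=> gh; rewrite /cintegral; congr (_ +i* _); apply: eq_Rintegral => x xA.
  by rewrite /re_part gh.
by rewrite /im_part gh.
Qed.

Lemma cintegrableD A g h : measurable A -> cintegrable A g -> cintegrable A h ->
  cintegrable A (fun x => g x + h x).
Proof.
move=> mA [g1 g2] [h1 h2]; rewrite /cintegrable /re_part /im_part.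
by split; under eq_fun do rewrite !ReImE; exact: integrable_EFinD.
Qed.

Lemma cintegrableZl A g z : measurable A -> cintegrable A g ->
  cintegrable A (fun x => z * g x).
Proof.
move=> mA [g1 g2]; rewrite /cintegrable /re_part /im_part.
split; under eq_fun do rewrite !ReImE.
  by apply: integrable_EFinB => //; exact: integrable_EFinZl.
by apply: integrable_EFinD => //; exact: integrable_EFinZl.
Qed.

Lemma cintegralD A g h : measurable A -> cintegrable A g -> cintegrable A h ->
  cintegral A (fun x => g x + h x) = cintegral A g + cintegral A h.
Proof.
move=> mA [g1 g2] [h1 h2]; apply: complex_ext; rewrite !ReImE /= -RintegralD//;
  by apply: eq_Rintegral => x _; rewrite /re_part /im_part !ReImE.
Qed.

Lemma cintegralZl A g z : measurable A -> cintegrable A g ->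
  cintegral A (fun x => z * g x) = z * cintegral A g.
Proof.
move=> mA [g1 g2]; apply: complex_ext; rewrite !ReImE /= -!RintegralZl//.
  rewrite -RintegralB//; try exact: integrable_EFinZl.
  by apply: eq_Rintegral => x _; rewrite /re_part /im_part !ReImE.
rewrite -RintegralD//; try exact: integrable_EFinZl.
by apply: eq_Rintegral => x _; rewrite /re_part /im_part !ReImE.
Qed.

Lemma cintegralN A g : measurable A -> cintegrable A g ->
  cintegral A (fun x => - g x) = - cintegral A g.
Proof.
move=> mA gi; rewrite -mulN1r -cintegralZl//.
by apply: eq_cintegral => x _; rewrite mulN1r.
Qed.

Lemma cintegrableN A g : measurable A -> cintegrable A g ->
  cintegrable A (fun x => - g x).
Proof.
move=> mA /(cintegrableZl (-1) mA); apply: eq_cintegrable => // x _.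
by rewrite mulN1r.
Qed.

Lemma cintegralB A g h : measurable A -> cintegrable A g -> cintegrable A h ->
  cintegral A (fun x => g x - h x) = cintegral A g - cintegral A h.
Proof.
by move=> mA gi hi; rewrite cintegralD// ?cintegralN//; exact: cintegrableN.
Qed.

Lemma cintegral_set1 (x : R) g : cintegral [set x] g = 0.
Proof. by rewrite /cintegral !Rintegral_set1. Qed.

(** Multiplying by the conjugate of the value of the integral turns it into its
    squared modulus; the real part of the integrand is then at most the
    modulus of the value times the modulus of [g]. *)
Lemma normc_cintegral_le A g : measurable A -> cintegrable A g ->
  normc (cintegral A g) <= \int[mu]_(x in A) normc (g x).
Proof.
move=> mA gi; move zE : (cintegral A g) => z.
have [z0|z0] := eqVneq (normc z) 0.
  by rewrite z0; apply: Rintegral_ge0 => x _; exact: normc_ge0.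
have zgt0 : 0 < normc z by rewrite lt_neqAle eq_sym z0 normc_ge0.
have zJ : normc (conjc z) = normc z by case: (z) => a b /=; rewrite sqrrN.
rewrite -(ler_pM2l zgt0) -expr2.
have -> : normc z ^+ 2 = complex.Re (conjc z * z).
  by rewrite sqr_normc_Re_Im; case: (z) => a b /=; ring.
have -> : conjc z * z = cintegral A (fun x => conjc z * g x).
  by rewrite cintegralZl// zE.
rewrite -RintegralZl//; last exact: integrable_normc.
apply: le_Rintegral => //.
- exact: (proj1 (cintegrableZl (conjc z) mA gi)).
- by apply: integrable_EFinZl => //; exact: integrable_normc.
- move=> x Ax; rewrite -zJ -normcM.
  by rewrite (le_trans (ler_norm _))// normr_Re_le_normc.
Qed.

Lemma normc_cintegral_le_trans A g (h : R -> R) : measurable A -> cintegrable A g ->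
  mu.-integrable A (EFin \o h) -> (forall x, A x -> normc (g x) <= h x) ->
  normc (cintegral A g) <= \int[mu]_(x in A) h x.
Proof.
move=> mA gi hi gh; apply: (le_trans (normc_cintegral_le mA gi)).
by apply: le_Rintegral => //; exact: integrable_normc.
Qed.

Lemma Rintegral_itv_cat (f : R -> R) (a b c : R) : a <= b -> b <= c ->
  mu.-integrable `[a, c] (EFin \o f) ->
  \int[mu]_(x in `[a, c]) f x =
  \int[mu]_(x in `[a, b]) f x + \int[mu]_(x in `[b, c]) f x.
Proof.
move=> ab bc fi.
have := @Rintegral_itvB _ f (BLeft a) (BRight c) b fi.
rewrite !bnd_simp => /(_ ab bc) /eqP; rewrite subr_eq addrC => /eqP ->.
congr (_ + _); rewrite Rintegral_itv_obnd_cbnd//.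
by apply: integrableS fi => //; apply: subset_itvr; rewrite bnd_simp.
Qed.

Lemma cintegral_itv_cat g (a b c : R) : a <= b -> b <= c ->
  cintegrable `[a, c] g ->
  cintegral `[a, c] g = cintegral `[a, b] g + cintegral `[b, c] g.
Proof.
move=> ab bc [g1 g2]; apply: complex_ext; rewrite ReImE /=;
  exact: Rintegral_itv_cat.
Qed.

Lemma lebesgue_measure_cc_lty (a b : R) : (mu `[a, b] < +oo)%E.
Proof.
by rewrite lebesgue_measure_itv/=; case: ifP => _; rewrite ?ltey// -EFinD ltry.
Qed.

Lemma integrable_cst_itv (a b k : R) :
  mu.-integrable `[a, b] (EFin \o (fun=> k)).
Proof.
apply: measurable_bounded_integrable => //; first exact: lebesgue_measure_cc_lty.
exists `|k|; split; first exact: num_real.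
by move=> y ky x _ /=; exact/ltW.
Qed.

Lemma Rintegral_cst_itv (a b k : R) : a <= b ->
  \int[mu]_(x in `[a, b]) k = k * (b - a).
Proof.
move=> ab; rewrite Rintegral_cst//= lebesgue_measure_itv/= lte_fin.
by case: ltP => //= ba; rewrite (@le_anti _ _ a b) ?ab ?ba// subrr mulr0.
Qed.

End ComplexIntegral.

(** * The fundamental theorem of calculus for everywhere differentiable functions *)

Section EverywhereDerivable.
Variable R : realType.
Local Notation mu := (@lebesgue_measure R).
Implicit Types (f g h : R -> R).

Lemma MVT_cc f df (a b : R) : a <= b ->
  (forall x, a <= x <= b -> is_derive x 1 f (df x)) ->
  exists2 c, a <= c <= b & f b - f a = df c * (b - a).
Proof.
move=> ab fd; have [] := @MVT_segment _ f df a b ab.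
- by move=> x; rewrite in_itv/= => /andP[/ltW ? /ltW ?]; apply: fd; apply/andP.
- apply: derivable_within_continuous => x; rewrite in_itv/= => xab.
  by have [] := fd x xab.
- by move=> c; rewrite in_itv/= => ? ?; exists c.
Qed.

Lemma is_derive_secant_le f (x l K : R) : is_derive x 1 f l -> l < K ->
  exists2 e : R, 0 < e & forall y, `|y - x| < e ->
    (x <= y -> f y - f x <= K * (y - x)) /\ (y <= x -> f x - f y <= K * (x - y)).
Proof.
move=> [fd fl] lK.
have : h^-1 *: (f (h *: 1 + x) - f x) @[h --> 0^'] --> l.
  by rewrite -fl; exact: fd.
move=> /cvgrPdist_lt /(_ (K - l)); rewrite subr_gt0 => /(_ lK) /nbhs_ballP[e /= e0 ef].
exists e => // y yxe.
have [->|yx] := eqVneq y x; first by rewrite !subrr mulr0 lexx; split.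
have := ef (y - x); rewrite /ball/= sub0r normrN => /(_ yxe).
rewrite subr_eq0 => /(_ yx) /=.
rewrite /GRing.scale /= mulr1 subrK => /ltr_distlCDr.
rewrite subrKC => slope; split => [xy|xy].
  have xy' : 0 < y - x by rewrite subr_gt0 lt_neqAle eq_sym yx.
  by move: slope; rewrite ltr_pdivrMl// => /ltW; rewrite mulrC.
have xy' : 0 < x - y by rewrite subr_gt0 lt_neqAle yx.
move: slope; rewrite -[y - x]opprB invrN mulNr -mulrN opprB.
by rewrite ltr_pdivrMl// => /ltW; rewrite mulrC.
Qed.

(** The supremum of the points up to which the value has not dropped below
    [f a] is attained, and cannot be smaller than [b]. *)
Lemma locally_nondecreasing f (a b : R) : a <= b ->
  (forall x, a <= x <= b -> exists2 e : R, 0 < e &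
     forall y, a <= y <= b -> `|y - x| < e ->
       (x <= y -> f x <= f y) /\ (y <= x -> f y <= f x)) ->
  f a <= f b.
Proof.
move=> ab floc.
pose S := [set x | a <= x <= b /\ f a <= f x].
have Sa : S a by rewrite /S/= !lexx ab.
have Sb : has_sup S by split; [exists a|exists b => x [/andP[]]].
pose s := sup S.
have sab : a <= s <= b.
  by rewrite (ub_le_sup _ Sa)/=; [apply: ge_sup; [exists a|move=> x [/andP[]]]|
    exists b => x [/andP[]]].
have [e e0 es] := floc s sab.
have Ss : f a <= f s.
  have [y [yab fay] sy] := @sup_adherent _ S e e0 Sb.
  have ys : y <= s by apply: ub_le_sup => //; exists b => x [/andP[]].
  apply: (le_trans fay); apply: (es y yab _).2 => //.
  by rewrite distrC ger0_norm ?subr_ge0// ltrBlDr -ltrBlDl.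
case/andP: sab => as_; rewrite le_eqVlt => /predU1P[<-//|sb].
pose z := Num.min b (s + e / 2).
have sz : s < z by rewrite /z lt_min sb ltrDl divr_gt0.
have zab : a <= z <= b by rewrite (le_trans as_ (ltW sz))/= /z ge_min lexx.
suff : S z.
  move=> Sz; have : z <= s by apply: ub_le_sup => //; exists b => x [/andP[]].
  by rewrite leNgt sz.
split=> //; apply: (le_trans Ss); apply: (es z zab _).1; last exact: ltW.
rewrite ger0_norm ?subr_ge0 ?(ltW sz)// ltrBlDl.
by rewrite (@le_lt_trans _ _ (s + e / 2)) ?ge_min ?lexx ?orbT// ltrD2l ltr_pdivrMr// ltr_pMr// ltr1n.
Qed.

(** Open sets [V k] around the superlevel sets [k * e <= g]: the function
    [e * \sum_k \1_(V k)] is then a lower semicontinuous majorant of [g] whose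
    integral exceeds that of [g] by little. *)
Lemma superlevel_open_cover g (a b e : R) : a <= b -> 0 < e ->
  (forall x, a <= x <= b -> 0 <= g x) ->
  mu.-integrable `[a, b] (EFin \o g) ->
  exists V : (set R)^nat, [/\ forall k, open (V k),
    forall x, a <= x <= b -> exists2 n : nat, g x < e * n%:R &
      forall k, (k < n)%N -> V k x
    & (\sum_(k <oo) e%:E * mu (V k `&` `[a, b])
       <= (\int[mu]_(x in `[a, b]) g x + e * (b - a) + e * e)%:E)%E].
Proof.
move=> ab e0 g0 gi.
have mg : measurable_fun `[a, b] g.
  by move/integrableP : gi => [/measurable_EFinP].
pose A k := `[a, b] `&` [set x | e * k%:R <= g x].
have mA k : measurable (A k).
  rewrite /A; have := mg (measurable_itv _) `[e * k%:R, +oo[ (measurable_itv _).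
  rewrite (_ : _ @^-1` _ = [set x | e * k%:R <= g x])//.
  by apply/seteqP; split => x /=; rewrite in_itv/= andbT.
have muA k : (mu (A k) < +oo)%E.
  apply: (le_lt_trans _ (lebesgue_measure_cc_lty a b)).
  by apply: le_measure; rewrite ?inE//; exact: mA || exact: subIsetl.
have e2 k : 0 < e / (2 ^ k.+1)%:R by rewrite divr_gt0// ltr0n expn_gt0.
have /choice[V VP] k := @lebesgue_regularity_outer R (A k) _ (mA k) (muA k) (e2 k).
exists V; split.
- by move=> k; have [] := VP k.
- move=> x xab; exists (Num.truncn (g x / e)).+1.
    rewrite mulrC -ltr_pdivrMr//; apply: (lt_le_trans (truncnS_gt _)).
    by [].
  move=> k; rewrite ltnS => kn; have [_ + _] := VP k; apply; split => //=.
  have ge0 : 0 <= g x / e by rewrite divr_ge0 ?g0// ltW.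
  rewrite mulrC -ler_pdivlMr//; apply: (@le_trans _ _ (Num.truncn (g x / e))%:R).
    by rewrite ler_nat.
  by have /andP[] := truncn_itv ge0.
- apply: (@le_trans _ _ (\sum_(k <oo) (e%:E * mu (A k) + e%:E * (e / (2 ^ k.+1)%:R)%:E))%E).
    apply: lee_nneseries => [k _ _|k _].
      by rewrite mule_ge0// lee_fin ltW.
    rewrite -muleDr//; last by rewrite ge0_adde_def// inE// lee_fin ltW.
    rewrite lee_pmul2l ?fin_numE ?lte_fin//.
    have [oV AV VA] := VP k.
    apply: (@le_trans _ _ (mu (A k `|` V k `\` A k))).
      apply: le_measure; rewrite ?inE.
      - by apply: measurableI => //; exact: open_measurable.
      - by apply: measurableU; [exact: mA|apply: measurableD; [exact: open_measurable|exact: mA]].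
      - by move=> x [Vx _]; have [?|?] := pselect (A k x); [left|right].
    apply: (le_trans (measureU2 _ _ _)) => //.
      - exact: mA.
      - by apply: measurableD; [exact: open_measurable|exact: mA].
    by rewrite leeD2l// ltW.
  rewrite nneseriesD; last 2 first.
  + by move=> k _ _; rewrite mule_ge0// lee_fin ltW.
  + by move=> k _ _; rewrite mule_ge0// lee_fin ltW.
  rewrite EFinD leeD//.
    apply: lime_le.
      by apply: is_cvg_nneseries => k _ _; rewrite mule_ge0// lee_fin ltW.
    apply: nearW => n.
    rewrite [leLHS](_ : _ = \int[mu]_(x in `[a, b]) (\sum_(0 <= k < n) (e * \1_(A k) x)%:E))%E; last first.
      rewrite ge0_integral_sum//.
      - apply: eq_bigr => k _; under eq_integral do rewrite EFinM.
        rewrite ge0_integralZl_EFin//.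
        + rewrite integral_indic//; last exact: mA.
          by rewrite setIC /A setIA setIid.
        + by apply/measurable_EFinP/measurable_indic; exact: mA.
        + exact: ltW.
      - move=> k; apply/measurable_EFinP/measurable_funM => //.
        by apply: measurable_indic; exact: mA.
      - by move=> k x _; rewrite lee_fin mulr_ge0// ltW.
    have gei : mu.-integrable `[a, b] (EFin \o (fun x => g x + e)).
      by apply: integrable_EFinD => //; exact: integrable_cst_itv.
    rewrite -(Rintegral_cst_itv e ab) -RintegralD//; last exact: integrable_cst_itv.
    rewrite /Rintegral fineK; last exact: integrable_fin_num.
    apply: ge0_le_integral => //.
    - by move=> x _; apply: sume_ge0 => k _; rewrite lee_fin mulr_ge0// ltW.
    - apply: emeasurable_sum => k; apply/measurable_EFinP/measurable_funM => //.
      by apply: measurable_indic; exact: mA.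
    - by case/integrableP : gei.
    - move=> x; rewrite /= in_itv/= => xab; rewrite sumEFin lee_fin.
      elim: n => [|n ih]; first by rewrite big_geq// addr_ge0 ?g0// ltW.
      have [nx|nx] := leP (e * n%:R) (g x).
        apply: (@le_trans _ _ (\sum_(0 <= k < n.+1) e)).
          apply: ler_sum => k _; rewrite indicE ler_piMr ?(ltW e0)//.
          by case: (_ \in _).
        by rewrite sumr_const_nat subn0 mulrSr lerD2r -mulr_natr.
      rewrite big_nat_recr//= indicE memNset ?mulr0 ?addr0//.
      by move=> [_ /=]; rewrite leNgt nx.
  rewrite nneseriesZl; last by move=> k _; rewrite lee_fin ltW.
  rewrite EFinM lee_pmul2l ?lte_fin//.
  by apply: (@epsilon_trick0 _ _ xpredT); exact: ltW.
Qed.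

(** With [V] as in [superlevel_open_cover], the set function
    [x |-> \sum_k e * mu (V k `&` [a, x])] grows near each point [x] at least at
    the rate [e * n > g x], which the increments of [h] cannot exceed there; so
    the difference is locally nondecreasing at every point, exceptional sets
    being absent because [h] is differentiable everywhere. *)
Lemma increment_le_Rintegral_ge0 h dh g (a b : R) : a <= b ->
  (forall x, a <= x <= b -> is_derive x 1 h (dh x)) ->
  (forall x, a <= x <= b -> dh x <= g x) ->
  (forall x, a <= x <= b -> 0 <= g x) ->
  mu.-integrable `[a, b] (EFin \o g) ->
  h b - h a <= \int[mu]_(x in `[a, b]) g x.
Proof.
move=> ab hd hg g0 gi.
suff main e : 0 < e ->
    h b - h a <= \int[mu]_(x in `[a, b]) g x + e * (b - a) + e * e.
  apply/ler_addgt0Pr => eps eps0.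
  have ba : 0 < b - a + 1 by rewrite ltr_wpDl// subr_ge0.
  pose e := Num.min 1 (eps / (b - a + 1)).
  have e0 : 0 < e by rewrite /e lt_min ltr01/= divr_gt0.
  have e1 : e <= 1 by rewrite ge_min lexx.
  apply: (le_trans (main e e0)); rewrite -addrA lerD2l.
  apply: (@le_trans _ _ (e * (b - a + 1))).
    by rewrite [leRHS]mulrDr lerD2l mulr1 ler_piMl// ltW.
  by rewrite -ler_pdivlMr// ge_min lexx orbT.
move=> e0; have [V [oV Vg SV]] := superlevel_open_cover ab e0 g0 gi.
pose S B := (\sum_(k <oo) e%:E * mu (V k `&` B))%E.
have mV k : measurable (V k) by apply: open_measurable; exact: oV.
have mVI k (i : interval R) : measurable (V k `&` [set` i]).
  by apply: measurableI; [exact: mV|exact: measurable_itv].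
have term_ge0 B k : (0 <= e%:E * mu (V k `&` B))%E.
  by rewrite mule_ge0// lee_fin ltW.
have Sfin x : a <= x <= b -> S `[a, x] \is a fin_num.
  move=> /andP[ax xb]; rewrite ge0_fin_numE; last by apply: nneseries_ge0.
  apply: le_lt_trans (ltry _); apply: le_trans SV; apply: lee_nneseries => // k _.
  rewrite lee_pmul2l ?lte_fin//; apply: le_measure; rewrite ?inE; [exact: mVI|exact: mVI|].
  by apply: setIS; apply: subset_itvl; rewrite bnd_simp.
have Sincr x y n : a <= x -> x <= y -> y <= b ->
    (forall k z, (k < n)%N -> x <= z <= y -> V k z) ->
    fine (S `[a, x]) + e * n%:R * (y - x) <= fine (S `[a, y]).
  move=> ax xy yb Vxy.
  rewrite -lee_fin EFinD !fineK ?Sfin ?ax ?(le_trans xy yb) ?yb ?(le_trans ax xy)//.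
  have -> : S `[a, y] = (S `[a, x] + S `]x, y])%E.
    rewrite /S -nneseriesD; [|by move=> *; exact: term_ge0..].
    apply: eq_eseriesr => k _; rewrite -ge0_muleDr//; congr (_ * _)%E.
    rewrite (@itv_bndbnd_setU _ _ (BLeft a) (BRight x) (BRight y)) ?bnd_simp//.
    rewrite setIUr measureU//; [exact: mVI|exact: mVI|].
    apply/seteqP; split => // z [[_ /=]]; rewrite in_itv/= => /andP[_ zx] [_ /=].
    by rewrite in_itv/= ltNge zx.
  rewrite leeD2l//.
  apply: (@le_trans _ _ (\sum_(0 <= k < n) e%:E * mu (V k `&` `]x, y]))%E);
    last by apply: nneseries_lim_ge => k _ _; exact: term_ge0.
  rewrite (@eq_big_nat _ _ _ 0 n _ (fun=> (e * (y - x))%:E)) ?sumEFin; last first.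
    move=> k /andP[_ kn]; rewrite setIidr; last first.
      by move=> z /=; rewrite in_itv/= => /andP[/ltW xz zy]; apply: Vxy; rewrite ?xz.
    rewrite lebesgue_measure_itv/= lte_fin.
    move: xy; rewrite le_eqVlt => /predU1P[->|xy]; first by rewrite ltxx subrr mulr0 mule0.
    by rewrite xy EFinM EFinB.
  by rewrite sumr_const_nat subn0 lee_fin -mulrA mulrCA -[leRHS]mulr_natl mulrA.
have loc : fine (S `[a, a]) - h a <= fine (S `[a, b]) - h b.
  apply: (@locally_nondecreasing (fun x => fine (S `[a, x]) - h x)) => // x xab.
  have [n gn Vn] := Vg x xab.
  have [d1 d10 hx] := is_derive_secant_le (hd x xab) (le_lt_trans (hg x xab) gn).
  have : \forall y \near x, forall k, (k < n)%N -> V k y.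
    elim: n {gn hx} Vn => [|n ih] Vn; first by near=> y.
    have : \forall y \near x, V n y.
      by apply: open_nbhs_nbhs; split; [exact: oV|exact: Vn].
    have : \forall y \near x, forall k, (k < n)%N -> V k y.
      by apply: ih => k kn; apply: Vn; rewrite ltnW.
    apply: filterS2 => y Vk Vny k; rewrite ltnS leq_eqVlt => /predU1P[->//|kn].
    exact: Vk.
  move=> /nbhs_ballP[d2 /= d20 Vx].
  exists (Num.min d1 d2); first by rewrite lt_min d10.
  move=> y /andP[ay yb]; rewrite lt_min => /andP[yd1 yd2].
  have [xy yx] := hx y yd1; case/andP: xab => ax xb; split => le.
  - have Vxy k z : (k < n)%N -> x <= z <= y -> V k z.
      move=> kn /andP[xz zy]; apply: Vx => //; rewrite /ball/= distrC.
      apply: le_lt_trans yd2; rewrite !ger0_norm ?subr_ge0//.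
      by rewrite lerD2r.
    by have := Sincr x y n ax le yb Vxy; have := xy le; lra.
  - have Vxy k z : (k < n)%N -> y <= z <= x -> V k z.
      move=> kn /andP[yz zx]; apply: Vx => //; rewrite /ball/=.
      apply: le_lt_trans yd2; rewrite distrC !ler0_norm ?subr_le0//.
      by rewrite !opprB lerD2l lerN2.
    by have := Sincr y x n ay le xb Vxy; have := yx le; lra.
have Saa : 0 <= fine (S `[a, a]) by rewrite fine_ge0//; apply: nneseries_ge0.
have Sab : fine (S `[a, b]) <= \int[mu]_(x in `[a, b]) g x + e * (b - a) + e * e.
  by rewrite -lee_fin fineK// Sfin// ab lexx.
lra.
Unshelve. all: by end_near. Qed.

End EverywhereDerivable.

Section FTC.
Variable R : realType.
Local Notation mu := (@lebesgue_measure R).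
Implicit Types (f g h : R -> R).

Lemma dominated_cvg_Rintegral (A : set R) (f_ : (R -> R)^nat) f g :
  measurable A -> (forall n, measurable_fun A (f_ n)) -> measurable_fun A f ->
  (forall x, A x -> f_ ^~ x @ \oo --> f x) ->
  mu.-integrable A (EFin \o g) ->
  (forall n x, A x -> `|f_ n x| <= g x) ->
  \int[mu]_(x in A) f_ n x @[n --> \oo] --> \int[mu]_(x in A) f x.
Proof.
move=> mA mf_ mf ff gi fg; apply: fine_cvg.
have fi : mu.-integrable A (EFin \o f).
  apply: integrable_le gi _ => // x Ax.
  have : `|f_ n x| @[n --> \oo] --> `|f x| by apply: cvg_norm; exact: ff.
  move/cvg_lim => <- //; apply: limr_le.
    by apply/cvg_ex; exists `|f x|; apply: cvg_norm; exact: ff.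
  by apply: nearW => n; exact: fg.
have [] := @dominated_convergence _ _ _ mu A _ (fun n x => (f_ n x)%:E)
  (EFin \o f) (EFin \o g).
- by [].
- by move=> n; apply/measurable_EFinP; exact: mf_.
- exact/measurable_EFinP.
- by apply: aeW => x Ax; apply/fine_cvgP; split; [exact: nearW|exact: ff].
- by [].
- by apply: aeW => x n Ax; rewrite lee_fin; exact: fg.
- by move=> _ _; rewrite /Rintegral fineK// integrable_fin_num.
Qed.

(** Truncating the derivative from below by [-k] reduces to a nonnegative
    majorant, after adding the linear function of slope [k]. *)
Lemma increment_le_Rintegral h dh (a b : R) : a <= b ->
  (forall x, a <= x <= b -> is_derive x 1 h (dh x)) ->
  mu.-integrable `[a, b] (EFin \o dh) ->
  h b - h a <= \int[mu]_(x in `[a, b]) dh x.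
Proof.
move=> ab hd di.
have md : measurable_fun `[a, b] dh.
  by move/integrableP : di => [/measurable_EFinP].
pose t (k : nat) x := Num.max (dh x) (- k%:R).
have mt k : measurable_fun `[a, b] (t k) by exact: measurable_maxr.
have t_le k x : `|t k x| <= `|dh x|.
  rewrite /t; case: (leP (dh x) (- k%:R)) => [dk|//].
  by rewrite normrN ger0_norm// ler_normr lerNr dk orbT.
have ti k : mu.-integrable `[a, b] (EFin \o t k).
  by apply: (@integrable_le _ _ _ (fun x => `|dh x|)) => //; exact: integrable_norm.
have step k : h b - h a <= \int[mu]_(x in `[a, b]) t k x.
  have H1 : forall x, a <= x <= b -> is_derive x 1 (fun x => h x + k%:R * x)
      (dh x + (0 * x + k%:R * 1)).
    move=> x xab; apply: is_derive1D; first exact: hd.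
    exact: is_derive1M.
  have H2 : forall x, a <= x <= b -> dh x + (0 * x + k%:R * 1) <= t k x + k%:R.
    by move=> x _; rewrite mul0r add0r mulr1 lerD2r /t le_max lexx.
  have H3 : forall x, a <= x <= b -> 0 <= t k x + k%:R.
    by move=> x _; rewrite -lerBlDr sub0r /t le_max lexx orbT.
  have H4 := integrable_EFinD (measurable_itv _) (ti k) (integrable_cst_itv a b k%:R).
  have := increment_le_Rintegral_ge0 ab H1 H2 H3 H4.
  rewrite RintegralD//; last exact: integrable_cst_itv.
  by rewrite Rintegral_cst_itv//; lra.
have tcvg : \int[mu]_(x in `[a, b]) t k x @[k --> \oo] -->
    \int[mu]_(x in `[a, b]) dh x.
  apply: (@dominated_cvg_Rintegral _ _ _ (fun x => `|dh x|)) => //.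
  - move=> x _; apply: cvg_near_cst.
    near=> k; rewrite /t; apply/max_idPl; rewrite lerNl.
    apply: (le_trans (ler_norm _)); rewrite normrN.
    by near: k; apply: nbhs_infty_ger.
  - exact: integrable_norm.
rewrite -(cvg_lim _ tcvg)//; apply: limr_ge; first by apply/cvg_ex; eexists; exact: tcvg.
by apply: nearW => k; exact: step.
Unshelve. all: by end_near. Qed.

(** Continuity of the derivative is not assumed: its integrability is enough,
    provided the function is differentiable at every point. *)
Lemma Rintegral_derive h dh (a b : R) : a <= b ->
  (forall x, a <= x <= b -> is_derive x 1 h (dh x)) ->
  mu.-integrable `[a, b] (EFin \o dh) ->
  \int[mu]_(x in `[a, b]) dh x = h b - h a.
Proof.
move=> ab hd di; apply/eqP; rewrite eq_le increment_le_Rintegral// andbT.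
have := @increment_le_Rintegral (fun x => - h x) (fun x => - dh x) a b ab.
have H1 : forall x, a <= x <= b -> is_derive x 1 (fun x => - h x) (- dh x).
  by move=> x xab; have := is_deriveN (hd x xab).
have -> : \int[mu]_(x in `[a, b]) - dh x = - \int[mu]_(x in `[a, b]) dh x.
  rewrite -mulN1r -RintegralZl//.
  by apply: eq_Rintegral => x _; rewrite mulN1r.
move=> /(_ H1); have := integrable_EFinZl (-1) (measurable_itv _) di.
have -> : (fun x => -1 * dh x) = (fun x => - dh x) by apply/funext => x; rewrite mulN1r.
by move=> di' /(_ di'); lra.
Qed.

Lemma cintegral_derive (g dg : R -> R[i]) (a b : R) : a <= b ->
  (forall x, a <= x <= b -> is_cderive g x (dg x)) ->
  cintegrable `[a, b] dg -> cintegral `[a, b] dg = g b - g a.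
Proof.
move=> ab gd [i1 i2]; apply: complex_ext; rewrite !ReImE /=.
  by apply: (@Rintegral_derive (re_part g)) => // x xab; have [] := gd x xab.
by apply: (@Rintegral_derive (im_part g)) => // x xab; have [] := gd x xab.
Qed.

End FTC.

(** * Oscillatory integrals without stationary points *)

Section VanDerCorput.
Variable R : realType.
Local Notation mu := (@lebesgue_measure R).

Lemma derive_within_continuous (f df : R -> R) (a b : R) :
  (forall x, a <= x <= b -> is_derive x 1 f (df x)) ->
  {within `[a, b], continuous f}.
Proof.
move=> fd; apply: derivable_within_continuous => x; rewrite in_itv/= => xab.
by have [] := fd x xab.
Qed.

Lemma within_continuous_measurable (f : R -> R) (a b : R) :
  {within `[a, b], continuous f} -> measurable_fun `[a, b] f.
Proof. exact: subspace_continuous_measurable_fun. Qed.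

Lemma derive_measurable (f df : R -> R) (a b : R) :
  (forall x, a <= x <= b -> is_derive x 1 f (df x)) ->
  measurable_fun `[a, b] f.
Proof. by move/derive_within_continuous/within_continuous_measurable. Qed.

Lemma cderive_measurable (g dg : R -> R[i]) (a b : R) :
  (forall x, a <= x <= b -> is_cderive g x (dg x)) -> cmeasurable `[a, b] g.
Proof.
move=> gd; split.
  exact: (derive_measurable (fun x xab => proj1 (gd x xab))).
exact: (derive_measurable (fun x xab => proj2 (gd x xab))).
Qed.

(** Writing [U * expi th] as the derivative of [U * expi th / ('i * th')]
    minus two terms, each of them divided by [th']. The first is controlled by
    [U'], the second by the variation of [1 / th'], which is at most [1 / L]
    because [th'] is monotone and keeps a constant sign. *)
Lemma normc_oscillatory_le (U dU : R -> R[i]) (th th1 th2 : R -> R)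
    (c d L A W : R) : c <= d -> 0 < L ->
  (forall p : R, c <= p <= d -> is_cderive U p (dU p)) ->
  cintegrable `[c, d] dU ->
  (forall p : R, c <= p <= d -> normc (U p) <= A) ->
  \int[mu]_(p in `[c, d]) normc (dU p) <= W ->
  (forall p : R, is_derive p 1 th (th1 p)) -> (forall p : R, is_derive p 1 th1 (th2 p)) ->
  continuous th2 -> (forall p : R, th2 p <= 0) ->
  (forall p : R, c <= p <= d -> L <= th1 p) \/ (forall p : R, c <= p <= d -> th1 p <= - L) ->
  normc (cintegral `[c, d] (fun p => U p * expi (th p))) <= (3 * A + W) / L.
Proof.
move=> cd L0 UdU dUi UA dUW thd th1d cth2 th2_le0 th1L.
have th1_ge p : c <= p <= d -> L <= `|th1 p|.
  move=> pcd; case: th1L => [|] /(_ p pcd) h; first by rewrite (le_trans h)// ler_norm.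
  by rewrite -normrN (le_trans _ (ler_norm _))// lerNr.
have th1_neq0 p : c <= p <= d -> th1 p != 0.
  by move=> /th1_ge Lp; rewrite -normr_gt0 (lt_le_trans L0).
pose J p := (th1 p)^-1; pose J' p := - th2 p / th1 p ^+ 2.
have J_le p : c <= p <= d -> `|J p| <= L^-1.
  move=> pcd; rewrite normfV lef_pV2 ?posrE ?normr_gt0 ?th1_neq0//.
  exact: th1_ge.
have Jd p : c <= p <= d -> is_derive p 1 J (J' p).
  move=> /th1_neq0 t0; apply: (is_derive1_eq (is_deriveV t0 (th1d p))).
  by rewrite /J' /GRing.scale /= mulNr mulNr mulrC.
have J'_ge0 p : 0 <= J' p by rewrite /J' divr_ge0 ?sqr_ge0// oppr_ge0.
have cJ' : {within `[c, d], continuous J'}.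
  apply: continuous_in_subspaceT => p; rewrite inE/= in_itv/= => pcd.
  have c1 : {for p, continuous th1}.
    by apply/differentiable_continuous/derivable1_diffP; have [] := th1d p.
  apply: cvgM; first by apply: cvgN; exact: cth2.
  apply: cvgV; first by rewrite expf_neq0// th1_neq0.
  by under eq_fun do rewrite expr2; rewrite expr2; exact: cvgM.
have J'i : mu.-integrable `[c, d] (EFin \o J').
  by apply: continuous_compact_integrable => //; exact: segment_compact.
have intJ' : \int[mu]_(p in `[c, d]) J' p <= L^-1.
  rewrite (Rintegral_derive cd Jd J'i).
  have cI : c <= c <= d by rewrite lexx.
  have dI : c <= d <= d by rewrite lexx andbT.
  have := J_le c cI; have := J_le d dI; rewrite !ler_norml => /andP[d1 d2] /andP[c1 c2].
  case: th1L => th1L.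
    have : 0 <= J c by rewrite invr_ge0 (le_trans (ltW L0))// th1L.
    by lra.
  have : J d <= 0.
    by rewrite invr_le0 (le_trans (th1L d dI))// lerNl oppr0 ltW.
  by lra.
pose e p := expi (th p).
have ne p : normc (e p) = 1 by exact: normc_expi.
pose K p : R[i] := - 'i * (J p)%:C * e p.
have Kd p : c <= p <= d ->
    is_cderive K p (- 'i * (J' p)%:C * e p + e p).
  move=> pcd; have /is_cderive_real Jr := Jd p pcd.
  apply: (is_cderive_eq (is_cderiveM (is_cderiveM (is_cderive_cst (- 'i) p) Jr)
    (is_cderive_expi (thd p)))).
  rewrite mul0r add0r; congr (_ + _); rewrite -/(e p) mulrA.
  rewrite -[RHS]mul1r; congr (_ * _).
  have -> : - 'i * (J p)%:C * ('i * (th1 p)%:C) = (- 'i * 'i) * ((J p)%:C * (th1 p)%:C) :> R[i].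
    by ring.
  rewrite -rmorphM /= mulVf ?th1_neq0// mulr1 mulNr -expr2.
  by rewrite sqr_i opprK.
have nK p : c <= p <= d -> normc (K p) <= L^-1.
  by move=> pcd; rewrite /K !normcM normcN normc_i mul1r ne mulr1 normc_real J_le.
pose E p := dU p * K p + U p * (- 'i * (J' p)%:C * e p).
have mU := cderive_measurable UdU.
have me : cmeasurable `[c, d] e.
  by apply: cmeasurable_expi; exact: (derive_measurable (fun p _ => thd p)).
have Ui : cintegrable `[c, d] (fun p => U p * e p).
  apply: (@le_cintegrable _ _ _ (fun=> A)) => //.
  - exact: cmeasurableM.
  - exact: integrable_cst_itv.
  - by move=> p; rewrite /= in_itv/= => /UA; rewrite normcM ne mulr1.
have Gi : mu.-integrable `[c, d] (EFin \o (fun p => L^-1 * normc (dU p) + A * J' p)).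
  apply: integrable_EFinD => //; apply: integrable_EFinZl => //.
  exact: integrable_normc.
have nE p : `[c, d] p -> normc (E p) <= L^-1 * normc (dU p) + A * J' p.
  rewrite /= in_itv/= => pcd; apply: (le_trans (le_normcD _ _)); apply: lerD.
    by rewrite normcM mulrC ler_wpM2r ?normc_ge0 ?nK.
  rewrite !normcM normcN normc_i mul1r ne mulr1 normc_real ger0_norm//.
  by rewrite ler_wpM2r ?UA.
have Ei : cintegrable `[c, d] E.
  apply: le_cintegrable Gi nE => //.
  apply: cmeasurableD; apply: cmeasurableM.
  - exact: cintegrable_measurable.
  - exact: cderive_measurable Kd.
  - by [].
  - apply: cmeasurableM => //; apply: cmeasurableM; first exact: cmeasurable_cst.
    by apply: cmeasurable_real; exact: within_continuous_measurable.
have intE : normc (cintegral `[c, d] E) <= (A + W) / L.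
  apply: (le_trans (normc_cintegral_le_trans _ Ei Gi nE)) => //.
  have A0 : 0 <= A by rewrite (le_trans (normc_ge0 _) (UA c _))// lexx cd.
  rewrite RintegralD//; last 2 first.
  - by apply: integrable_EFinZl => //; exact: integrable_normc.
  - by apply: integrable_EFinZl.
  rewrite !RintegralZl//; last exact: integrable_normc.
  rewrite mulrDl addrC lerD//; first by rewrite ler_wpM2l.
  by rewrite mulrC ler_wpM2r// invr_ge0 ltW.
have Hd p : c <= p <= d -> is_cderive (fun p => U p * K p) p (E p + U p * e p).
  move=> pcd; apply: (is_cderive_eq (is_cderiveM (UdU p pcd) (Kd p pcd))).
  by rewrite /E mulrDr addrA.
have /eqP := cintegral_derive cd Hd (cintegrableD (measurable_itv _) Ei Ui).
rewrite cintegralD// addrC eq_sym -subr_eq eq_sym => /eqP ->.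
have nH p : c <= p <= d -> normc (U p * K p) <= A / L.
  by move=> pcd; rewrite normcM ler_pM ?normc_ge0 ?UA ?nK.
rewrite (_ : _ / L = A / L + A / L + (A + W) / L); last by ring.
apply: (le_trans (le_normcB _ _)); rewrite lerD//.
apply: (le_trans (le_normcB _ _)); rewrite lerD ?nH ?lexx ?cd//.
Qed.

End VanDerCorput.

(** * Oscillatory integrals with a power amplitude *)

Section PowerAmplitude.
Variable R : realType.
Local Notation mu := (@lebesgue_measure R).

Lemma le_powR_npos (a x y : R) : a <= 0 -> 0 < x -> x <= y -> y `^ a <= x `^ a.
Proof.
move=> a0 x0 xy; rewrite -[a]opprK !(powRN _ (- a)).
rewrite lef_pV2 ?posrE ?powR_gt0 ?(lt_le_trans x0 xy)//.
by rewrite ge0_ler_powR ?nnegrE ?oppr_ge0 ?(ltW x0)// ltW// (lt_le_trans x0).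
Qed.

Lemma within_continuous_powR (a c d : R) : 0 < c ->
  {within `[c, d], continuous (fun p => p `^ a)}.
Proof.
move=> c0; apply: (@derive_within_continuous _ _ (fun p => a * p `^ (a - 1))).
by move=> x /andP[cx _]; apply: is_derive1_powR; exact: lt_le_trans cx.
Qed.

Lemma integrable_powR (a c d : R) : 0 < c ->
  mu.-integrable `[c, d] (EFin \o (fun p => p `^ a)).
Proof.
move=> c0; apply: continuous_compact_integrable; first exact: segment_compact.
exact: within_continuous_powR.
Qed.

Lemma Rintegral_powR (a c d : R) : 0 < c -> c <= d ->
  \int[mu]_(p in `[c, d]) (a * p `^ (a - 1)) = d `^ a - c `^ a.
Proof.
move=> c0 cd; apply: (@Rintegral_derive _ (fun p => p `^ a)) => //.
  by move=> x /andP[cx _]; apply: is_derive1_powR; exact: lt_le_trans cx.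
by apply: integrable_EFinZl => //; exact: integrable_powR.
Qed.

Lemma Rintegral_powR_div (a c d : R) : 0 < a -> 0 < c -> c <= d ->
  \int[mu]_(p in `[c, d]) p `^ (a - 1) = (d `^ a - c `^ a) / a.
Proof.
move=> a0 c0 cd; rewrite -Rintegral_powR// RintegralZl//; last exact: integrable_powR.
by rewrite mulrC mulKf// gt_eqF.
Qed.

(** With [w = x + y], each of [x / w] and [y / w] lies in [[0, 1]] and is thus at
    most its power of exponent [a]; these two fractions add up to 1. *)
Lemma powR_subadditive (a x y : R) : 0 < a <= 1 -> 0 <= x -> 0 <= y ->
  (x + y) `^ a <= x `^ a + y `^ a.
Proof.
move=> /andP[a0 a1]; rewrite le_eqVlt => /predU1P[<-|x0].
  by rewrite powR0 ?gt_eqF// !add0r.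
rewrite le_eqVlt => /predU1P[<-|y0]; first by rewrite powR0 ?gt_eqF// !addr0.
have w0 : 0 < x + y by rewrite addr_gt0.
have wa : 0 < (x + y) `^ a by rewrite powR_gt0.
have step z : 0 < z -> z <= x + y -> z / (x + y) * (x + y) `^ a <= z `^ a.
  move=> z0 zw; have -> : z `^ a = (z / (x + y)) `^ a * (x + y) `^ a.
    by rewrite -powRM ?divr_ge0 ?(ltW w0) ?(ltW z0)// divfK// gt_eqF.
  rewrite ler_wpM2r ?(ltW wa)// ger1_powR// divr_gt0//=.
  by rewrite ler_pdivrMr// mul1r.
have := lerD (step x x0 _) (step y y0 _); rewrite -mulrDl -mulrDl.
by rewrite divff ?gt_eqF// mul1r; apply; rewrite ?lerDl ?lerDr ltW.
Qed.

(** Near the singularity [0] the integral is computed as an increasing limit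
    of integrals over [[d / n.+1, d]]. *)
Lemma Rintegral_powR0 (a d : R) : 0 < a -> 0 <= d ->
  mu.-integrable `[0, d] (EFin \o (fun p => p `^ (a - 1))) /\
  \int[mu]_(p in `[0, d]) p `^ (a - 1) <= d `^ a / a.
Proof.
move=> a0; rewrite le_eqVlt => /predU1P[<-|d0].
  rewrite powR0 ?gt_eqF// mul0r set_itv1 Rintegral_set1; split => //.
  apply/integrableP; split; last by rewrite integral_set1.
  by apply/measurable_EFinP; apply: measurable_funTS; exact: measurable_powR.
have mp : measurable_fun `]0, d] (fun p : R => (p `^ (a - 1))%:E).
  by apply/measurable_EFinP; apply: measurable_funTS; exact: measurable_powR.
have d_n (n : nat) : 0 < d / n.+1%:R <= d.
  by rewrite divr_gt0//= ler_pdivrMr// ler_peMr ?(ltW d0)// ler1n.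
have bigU : \bigcup_n `[d / n.+1%:R, d] = `]0, d].
  apply/seteqP; split => x /=.
    move=> [n _ /=]; rewrite !in_itv/= => /andP[nx ->]; rewrite andbT.
    by rewrite (lt_le_trans _ nx)//; case/andP: (d_n n).
  rewrite in_itv/= => /andP[x0 xd]; exists (Num.truncn (d / x)) => //=.
  rewrite in_itv/= xd andbT ler_pdivrMr// mulrC -ler_pdivrMr//.
  by apply/ltW/truncnS_gt.
have le_n : (\int[mu]_(p in `]0%R, d]) (p `^ (a - 1))%:E <= (d `^ a / a)%:E)%E.
  have cvg_n : (\int[mu]_(p in `[(d / n.+1%:R)%R, d]) (p `^ (a - 1))%:E)%E @[n --> \oo]
      --> (\int[mu]_(p in `]0%R, d]) (p `^ (a - 1))%:E)%E.
    rewrite -bigU; apply: ge0_nondecreasing_set_cvg_integral => //.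
    - move=> n m nm; apply/subsetPset; apply: subset_itvr; rewrite bnd_simp.
      by rewrite ler_pM2l// lef_pV2 ?posrE// ler_nat.
    - move=> n; apply: measurable_funS mp => //; apply: subset_itvr.
      by rewrite bnd_simp; case/andP: (d_n n).
    - by move=> n x _; rewrite lee_fin powR_ge0.
  apply: (cvge_to_le cvg_n); apply: nearW => n; have /andP[n0 nd] := d_n n.
  have := Rintegral_powR_div a0 n0 nd; rewrite /Rintegral => e.
  rewrite -(fineK (integrable_fin_num _ (integrable_powR _ _ n0)))// e.
  by rewrite lee_fin ler_wpM2r ?invr_ge0 ?(ltW a0)// gerBl powR_ge0.
have ae : (\int[mu]_(p in `[0%R, d]) (p `^ (a - 1))%:E =
    \int[mu]_(p in `]0%R, d]) (p `^ (a - 1))%:E)%E.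
  rewrite integral_itv_obnd_cbnd//.
split.
  apply/integrableP; split.
    by apply/measurable_EFinP; apply: measurable_funTS; exact: measurable_powR.
  under eq_integral do rewrite gee0_abs ?lee_fin ?powR_ge0//.
  by rewrite ae (le_lt_trans le_n)// ltry.
rewrite /Rintegral ae -lee_fin fineK// ge0_fin_numE; first by rewrite (le_lt_trans le_n)// ltry.
by apply: integral_ge0 => x _; rewrite lee_fin powR_ge0.
Qed.

(** The power being nonincreasing, the amplitude is at most [c `^ (a - 1) * A] and
    its derivative has [L^1]-norm at most [c `^ (a - 1) * (A + V)]. *)
Lemma normc_power_oscillatory_le (ut dut : R -> R[i]) (th th1 th2 : R -> R)
    (a c d L A V : R) : 0 < a <= 1 -> 0 < c -> c <= d -> 0 < L ->
  (forall p : R, c <= p <= d -> is_cderive ut p (dut p)) ->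
  cintegrable `[c, d] dut ->
  (forall p : R, c <= p <= d -> normc (ut p) <= A) ->
  \int[mu]_(p in `[c, d]) normc (dut p) <= V ->
  (forall p : R, is_derive p 1 th (th1 p)) ->
  (forall p : R, is_derive p 1 th1 (th2 p)) ->
  continuous th2 -> (forall p : R, th2 p <= 0) ->
  (forall p : R, c <= p <= d -> L <= th1 p) \/
  (forall p : R, c <= p <= d -> th1 p <= - L) ->
  normc (cintegral `[c, d] (fun p => (p `^ (a - 1))%:C * ut p * expi (th p)))
    <= c `^ (a - 1) * (4 * A + V) / L.
Proof.
move=> /andP[a0 a1] c0 cd L0 utd duti utA dutV thd th1d cth2 th2_le0 th1L.
have A0 : 0 <= A by rewrite (le_trans (normc_ge0 _) (utA c _))// lexx cd.
pose P p : R := p `^ (a - 1); pose dP p : R := (a - 1) * p `^ (a - 1 - 1).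
have Pd p : c <= p <= d -> is_derive p 1 P (dP p).
  by move=> /andP[cp _]; apply: is_derive1_powR; exact: lt_le_trans cp.
have P_le p : c <= p <= d -> P p <= P c.
  by move=> /andP[cp _]; apply: le_powR_npos => //; rewrite subr_le0.
have P0 p : 0 <= P p by exact: powR_ge0.
have dP_le0 p : dP p <= 0 by rewrite mulr_le0_ge0 ?powR_ge0// subr_le0.
pose dU p := (dP p)%:C * ut p + (P p)%:C * dut p.
have Ud p : c <= p <= d -> is_cderive (fun p => (P p)%:C * ut p) p (dU p).
  by move=> pcd; exact: (is_cderiveM (is_cderive_real (Pd p pcd)) (utd p pcd)).
have mP : measurable_fun `[c, d] P by exact: derive_measurable Pd.
have dPi : mu.-integrable `[c, d] (EFin \o dP).
  by apply: integrable_EFinZl => //; exact: integrable_powR.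
have mdP : measurable_fun `[c, d] dP.
  by move/integrableP : dPi => [/measurable_EFinP].
pose G p := - A * dP p + P c * normc (dut p).
have Gi : mu.-integrable `[c, d] (EFin \o G).
  apply: integrable_EFinD => //; apply: integrable_EFinZl => //.
  exact: integrable_normc.
have dUG p : `[c, d] p -> normc (dU p) <= G p.
  rewrite /= in_itv/= => pcd; apply: (le_trans (le_normcD _ _)); apply: lerD.
    rewrite normcM normc_real ler0_norm// [leRHS]mulNr -[leRHS]mulrN mulrC.
    by rewrite ler_wpM2r ?utA// oppr_ge0.
  by rewrite normcM normc_real ger0_norm// ler_wpM2r ?normc_ge0 ?P_le.
have mut := cderive_measurable utd.
have dUi : cintegrable `[c, d] dU.
  apply: le_cintegrable Gi dUG => //.
  apply: cmeasurableD; apply: cmeasurableM => //; try exact: cmeasurable_real.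
  exact: cintegrable_measurable.
have intG : \int[mu]_(p in `[c, d]) normc (dU p) <= P c * (A + V).
  apply: (@le_trans _ _ (\int[mu]_(p in `[c, d]) G p)).
    by apply: le_Rintegral => //; exact: integrable_normc.
  rewrite RintegralD//; last 2 first.
  - exact: integrable_EFinZl.
  - by apply: integrable_EFinZl => //; exact: integrable_normc.
  rewrite !RintegralZl//; last exact: integrable_normc.
  rewrite mulrDr lerD//; last by rewrite ler_wpM2l.
  have := Rintegral_powR (a - 1) c0 cd.
  rewrite RintegralZl//; last exact: integrable_powR.
  move=> ->; rewrite mulNr -mulrN opprB mulrC ler_wpM2r//.
    by rewrite gerBl powR_ge0.
  exact: integrable_powR.
have := @normc_oscillatory_le _ _ _ th th1 th2 c d L (P c * A) (P c * (A + V))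
  cd L0 Ud dUi _ intG thd th1d cth2 th2_le0 th1L.
rewrite (_ : 3 * (P c * A) + P c * (A + V) = P c * (4 * A + V)); last by ring.
apply=> p pcd; rewrite normcM normc_real ger0_norm//.
by rewrite ler_pM ?normc_ge0 ?P_le ?utA.
Qed.

End PowerAmplitude.

Section OscillatoryPieces.
Variable R : realType.
Local Notation mu := (@lebesgue_measure R).

Lemma le_Rintegral_subset (A B : set R) (f : R -> R) :
  measurable A -> measurable B -> A `<=` B ->
  mu.-integrable B (EFin \o f) -> (forall x, B x -> 0 <= f x) ->
  \int[mu]_(x in A) f x <= \int[mu]_(x in B) f x.
Proof.
move=> mA mB AB fi f0.
have fiA : mu.-integrable A (EFin \o f) by apply: integrableS fi.
rewrite -lee_fin /Rintegral !fineK ?integrable_fin_num//.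
apply: ge0_subset_integral => //.
by case/integrableP : fi.
Qed.

Variables (ut dut : R -> R[i]) (th th1 th2 : R -> R) (a : R).
Hypothesis a01 : 0 < a <= 1.
Hypothesis utd : forall p : R, is_cderive ut p (dut p).
Hypothesis duti : forall c d : R, cintegrable `[c, d] dut.
Hypothesis thd : forall p : R, is_derive p 1 th (th1 p).
Hypothesis th1d : forall p : R, is_derive p 1 th1 (th2 p).
Hypothesis cth2 : continuous th2.
Hypothesis th2_le0 : forall p : R, th2 p <= 0.

Definition osc (p : R) : R[i] := (p `^ (a - 1))%:C * ut p * expi (th p).

Lemma osc_measurable (c d : R) : cmeasurable `[c, d] osc.
Proof.
apply: cmeasurableM; first apply: cmeasurableM.
- by apply: cmeasurable_real; apply: measurable_funTS; exact: measurable_powR.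
- exact: (cderive_measurable (fun p _ => utd p)).
- by apply: cmeasurable_expi; exact: (derive_measurable (fun p _ => thd p)).
Qed.

Lemma normc_osc p : normc (osc p) = p `^ (a - 1) * normc (ut p).
Proof.
by rewrite !normcM normc_expi mulr1 normc_real ger0_norm// powR_ge0.
Qed.

Lemma osc_integrable (c d A : R) : 0 <= c ->
  (forall p : R, c <= p <= d -> normc (ut p) <= A) -> cintegrable `[c, d] osc.
Proof.
move=> c0 utA; case: (leP 0 d) => [d0|d0]; last first.
  rewrite set_itv_ge ?bnd_simp -?ltNge ?(lt_le_trans d0)//.
  by split; exact: integrable_set0.
have /andP[a0 _] := a01.
apply: (@le_cintegrable _ _ _ (fun p => A * p `^ (a - 1))) => //.
- exact: osc_measurable.
- apply: integrable_EFinZl => //.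
  apply: integrableS (Rintegral_powR0 a0 d0).1 => //.
  by apply: subset_itvr; rewrite bnd_simp.
- by move=> p; rewrite /= in_itv/= => /utA ?; rewrite normc_osc mulrC ler_wpM2r ?powR_ge0.
Qed.

Lemma normc_osc_le (c d A : R) : 0 <= c -> c <= d ->
  (forall p : R, c <= p <= d -> normc (ut p) <= A) ->
  normc (cintegral `[c, d] osc) <= A * \int[mu]_(p in `[c, d]) p `^ (a - 1).
Proof.
move=> c0 cd utA; have d0 := le_trans c0 cd.
have /andP[a0 _] := a01.
have pi : mu.-integrable `[c, d] (EFin \o (fun p => p `^ (a - 1))).
  apply: integrableS (Rintegral_powR0 a0 d0).1 => //.
  by apply: subset_itvr; rewrite bnd_simp.
rewrite -RintegralZl//; apply: normc_cintegral_le_trans => //.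
- exact: osc_integrable utA.
- exact: integrable_EFinZl.
- by move=> p; rewrite /= in_itv/= => /utA ?; rewrite normc_osc mulrC ler_wpM2r ?powR_ge0.
Qed.

Lemma normc_dut_sub_le (c d e e' V : R) : c <= e -> e' <= d ->
  \int[mu]_(p in `[c, d]) normc (dut p) <= V ->
  \int[mu]_(p in `[e, e']) normc (dut p) <= V.
Proof.
move=> ce ed; apply: le_trans; apply: le_Rintegral_subset => //.
- by apply: subset_itv; rewrite bnd_simp.
- by apply: integrable_normc => //; exact: duti.
- by move=> p _; exact: normc_ge0.
Qed.

Lemma normc_osc_away_le (c d e e' A V L : R) : 0 < c -> c <= e -> e <= e' -> e' <= d ->
  0 < L -> (forall p : R, c <= p <= d -> normc (ut p) <= A) ->
  \int[mu]_(p in `[c, d]) normc (dut p) <= V ->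
  (forall p : R, e <= p <= e' -> L <= th1 p) \/
  (forall p : R, e <= p <= e' -> th1 p <= - L) ->
  normc (cintegral `[e, e'] osc) <= c `^ (a - 1) * (4 * A + V) / L.
Proof.
move=> c0 ce ee ed L0 utA dutV th1L.
have e0 := lt_le_trans c0 ce; have cd : c <= d by rewrite (le_trans ce)// (le_trans ee).
have sub p : e <= p <= e' -> c <= p <= d.
  by move=> /andP[ep pe]; rewrite (le_trans ce ep) (le_trans pe ed).
apply: (le_trans (normc_power_oscillatory_le a01 e0 ee L0 (fun p _ => utd p)
  (duti _ _) (fun p h => utA p (sub p h)) (normc_dut_sub_le ce ed dutV)
  thd th1d cth2 th2_le0 th1L)).
have A0 : 0 <= A by rewrite (le_trans (normc_ge0 _) (utA c _))// lexx.
have V0 : 0 <= V.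
  by rewrite (le_trans _ dutV)//; apply: Rintegral_ge0 => p _; exact: normc_ge0.
rewrite ler_wpM2r ?invr_ge0 ?(ltW L0)// ler_wpM2r ?addr_ge0 ?mulr_ge0//.
by apply: le_powR_npos => //; case/andP: a01 => _; rewrite subr_le0.
Qed.

(** The interval is cut at distance [del] of the stationary point [q]; beyond
    that distance [|th'| >= rho * del]. The window [[e, e']] is left in the bound,
    as the power is integrated differently near 0 and far from it. *)
Lemma normc_osc_stationary_le (c d q rho del A V : R) :
  0 < c -> c <= d -> 0 < rho -> 0 < del ->
  (forall p : R, c <= p <= d -> normc (ut p) <= A) ->
  \int[mu]_(p in `[c, d]) normc (dut p) <= V ->
  (forall p : R, c <= p <= d -> p < q -> rho * (q - p) <= th1 p) ->
  (forall p : R, c <= p <= d -> q < p -> th1 p <= - (rho * (p - q))) ->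
  exists e e', [/\ c <= e, e <= e', e' <= d, e' - e <= 2 * del &
    normc (cintegral `[c, d] osc) <=
      A * (\int[mu]_(p in `[e, e']) p `^ (a - 1)) +
      2 * (c `^ (a - 1) * (4 * A + V) / (rho * del))].
Proof.
move=> c0 cd rho0 del0 utA dutV thl thr.
pose e := Num.max c (Num.min d (q - del)).
pose e' := Num.max c (Num.min d (q + del)).
have ce : c <= e by rewrite le_max lexx.
have ed : e <= d by rewrite ge_max cd ge_min lexx.
have ed' : e' <= d by rewrite ge_max cd ge_min lexx.
have ce' : c <= e' by rewrite le_max lexx.
have [ee ee2] : e <= e' /\ e' - e <= 2 * del.
  rewrite /e /e'; have [h1|h1] := lerP d (q - del); have [h2|h2] := lerP d (q + del);
    rewrite ?(max_r cd); try lra.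
    by have [h3|h3] := lerP c (q - del); lra.
  by have [h3|h3] := lerP c (q - del); have [h4|h4] := lerP c (q + del); lra.
have L0 : 0 < rho * del by rewrite mulr_gt0.
exists e, e'; split => //.
have oi := osc_integrable (ltW c0) utA.
rewrite (cintegral_itv_cat ce ed oi).
rewrite (cintegral_itv_cat ee ed'); last first.
  by apply: cintegrableS oi => //; apply: subset_itvr; rewrite bnd_simp.
have A0 : 0 <= A by rewrite (le_trans (normc_ge0 _) (utA c _))// lexx.
have V0 : 0 <= V.
  by rewrite (le_trans _ dutV)//; apply: Rintegral_ge0 => p _; exact: normc_ge0.
have B0 : 0 <= c `^ (a - 1) * (4 * A + V) / (rho * del).
  by rewrite divr_ge0 ?(ltW L0)// mulr_ge0 ?powR_ge0// addr_ge0 ?mulr_ge0.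
have left_ : normc (cintegral `[c, e] osc) <= c `^ (a - 1) * (4 * A + V) / (rho * del).
  have [->|ec] := eqVneq e c.
    by rewrite set_itv1 cintegral_set1 normc_real normr0.
  apply: (normc_osc_away_le c0 _ ce ed) => //.
  left => p /andP[cp pe]; have : e <= q - del.
    have : c < e by rewrite lt_neqAle eq_sym ec.
    by rewrite /e lt_max ltxx/= => /ltW/max_idPr ->; rewrite ge_min lexx orbT.
  move=> eq; apply: (le_trans _ (thl p _ _)); first by rewrite ler_pM2l//; lra.
    by rewrite cp (le_trans pe).
  by lra.
have right_ : normc (cintegral `[e', d] osc) <= c `^ (a - 1) * (4 * A + V) / (rho * del).
  have [->|ed1] := eqVneq e' d.
    by rewrite set_itv1 cintegral_set1 normc_real normr0.
  apply: (normc_osc_away_le c0 ce' ed') => //.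
  right => p /andP[ep pd]; have : q + del <= e'.
    have : e' < d by rewrite lt_neqAle ed1.
    rewrite {1}/e' gt_max gt_min ltxx/= => /andP[_ h].
    by rewrite /e' (min_r (ltW h)) le_max lexx orbT.
  move=> eq; apply: (le_trans (thr p _ _)).
  - by rewrite (le_trans ce').
  - by lra.
  - by rewrite lerN2 ler_pM2l//; lra.
have middle : normc (cintegral `[e, e'] osc) <= A * \int[mu]_(p in `[e, e']) p `^ (a - 1).
  apply: normc_osc_le => //; first exact: le_trans (ltW c0) ce.
  by move=> p /andP[ep pe]; rewrite utA// (le_trans ce ep) (le_trans pe).
apply: (le_trans (le_normcD _ _)); rewrite [leRHS]addrC mulrDl mul1r -addrA.
apply: lerD => //; apply: (le_trans (le_normcD _ _)).
by rewrite addrC lerD.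
Qed.

Lemma Rintegral_powR_le (c d del : R) : 0 < c -> c <= d -> d - c <= 2 * del ->
  0 <= del -> \int[mu]_(p in `[c, d]) p `^ (a - 1) <= 2 / a * del `^ a.
Proof.
move=> c0 cd dc del0; have /andP[a0 a1] := a01.
rewrite Rintegral_powR_div// mulrAC ler_wpM2r ?invr_ge0 ?(ltW a0)//.
have := powR_subadditive a01 (ltW c0) (_ : 0 <= d - c).
rewrite subr_ge0 subrKC => /(_ cd) h.
have : (d - c) `^ a <= 2 * del `^ a.
  apply: (@le_trans _ _ ((2 * del) `^ a)).
    by rewrite ge0_ler_powR ?nnegrE ?(ltW a0)// ?subr_ge0// mulr_ge0.
  by rewrite powRM// ler_wpM2r ?powR_ge0// ler1_powR// ler1n.
by lra.
Qed.

Lemma Rintegral_powR_le_left (c e e' : R) : 0 < c -> c <= e -> e <= e' ->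
  \int[mu]_(p in `[e, e']) p `^ (a - 1) <= c `^ (a - 1) * (e' - e).
Proof.
move=> c0 ce ee; rewrite -Rintegral_cst_itv//; apply: le_Rintegral => //.
- by apply: integrable_powR; exact: lt_le_trans ce.
- exact: integrable_cst_itv.
- move=> p; rewrite /= in_itv/= => /andP[ep _].
  apply: le_powR_npos => //; last exact: le_trans ep.
  by rewrite subr_le0; case/andP: a01.
Qed.

(** The constant [3] collects [del `^ a / a] from the singularity at 0, and twice
    that amount from the window of length [2 * del] around [q], by
    subadditivity of the power. *)
Lemma normc_osc0_stationary_le (N q rho del A V : R) :
  0 <= N -> 0 < rho -> 0 < del ->
  (forall p : R, 0 <= p <= N -> normc (ut p) <= A) ->
  \int[mu]_(p in `[0, N]) normc (dut p) <= V ->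
  (forall p : R, 0 <= p <= N -> p < q -> rho * (q - p) <= th1 p) ->
  (forall p : R, 0 <= p <= N -> q < p -> th1 p <= - (rho * (p - q))) ->
  normc (cintegral `[0, N] osc) <=
    3 / a * A * del `^ a + 2 * (del `^ (a - 1) * (4 * A + V) / (rho * del)).
Proof.
move=> N0 rho0 del0 utA dutV thl thr; have /andP[a0 a1] := a01.
have A0 : 0 <= A by rewrite (le_trans (normc_ge0 _) (utA 0 _))// lexx.
have V0 : 0 <= V.
  by rewrite (le_trans _ dutV)//; apply: Rintegral_ge0 => p _; exact: normc_ge0.
have B0 : 0 <= del `^ (a - 1) * (4 * A + V) / (rho * del).
  by rewrite divr_ge0 ?mulr_ge0 ?powR_ge0 ?addr_ge0 ?mulr_ge0// ltW.
have P0 := powR_ge0 del a.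
have Ap : 0 <= A / a * del `^ a by rewrite mulr_ge0// divr_ge0// ltW.
have near0 d : 0 <= d -> d <= del -> d <= N ->
    normc (cintegral `[0, d] osc) <= A / a * del `^ a.
  move=> d0 ddel dN; have [_ ih] := Rintegral_powR0 a0 d0.
  apply: (@le_trans _ _ (A * (\int[mu]_(p in `[0, d]) p `^ (a - 1)))).
    apply: normc_osc_le => // p /andP[p0 pd]; apply: utA.
    by rewrite p0 (le_trans pd).
  rewrite -mulrA [a^-1 * _]mulrC ler_wpM2l// (le_trans ih)//.
  by rewrite ler_wpM2r ?invr_ge0 ?(ltW a0)// ge0_ler_powR ?nnegrE// ltW.
have [Ndel|delN] := leP N del.
  apply: (le_trans (near0 N N0 Ndel (lexx _))).
  by rewrite -subr_ge0; lra.
have oi : cintegrable `[0, N] osc by exact: osc_integrable utA.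
rewrite (cintegral_itv_cat (ltW del0) (ltW delN) oi).
have sub p : del <= p <= N -> 0 <= p <= N.
  by move=> /andP[dp ->]; rewrite (le_trans (ltW del0) dp).
have [e [e' [de ee eN ee2 main]]] := normc_osc_stationary_le del0 (ltW delN) rho0 del0
  (fun p h => utA p (sub p h)) (normc_dut_sub_le (ltW del0) (lexx N) dutV)
  (fun p h => thl p (sub p h)) (fun p h => thr p (sub p h)).
have e0 := lt_le_trans del0 de.
have := Rintegral_powR_le e0 ee ee2 (ltW del0) => hI.
have := near0 del (ltW del0) (lexx _) (ltW delN).
have := ler_wpM2l A0 hI; have := le_normcD (cintegral `[0, del] osc) (cintegral `[del, N] osc).
have -> : 3 / a * A * del `^ a = A / a * del `^ a + A * (2 / a * del `^ a) by ring.
by lra.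
Qed.

Lemma normc_osc0_away_le (N del A V L : R) : 0 <= N -> 0 < L -> 0 < del ->
  (forall p : R, 0 <= p <= N -> normc (ut p) <= A) ->
  \int[mu]_(p in `[0, N]) normc (dut p) <= V ->
  (forall p : R, 0 <= p <= N -> L <= th1 p) \/
  (forall p : R, 0 <= p <= N -> th1 p <= - L) ->
  normc (cintegral `[0, N] osc) <=
    1 / a * A * del `^ a + del `^ (a - 1) * (4 * A + V) / L.
Proof.
move=> N0 L0 del0 utA dutV th1L; have /andP[a0 a1] := a01.
have A0 : 0 <= A by rewrite (le_trans (normc_ge0 _) (utA 0 _))// lexx.
have V0 : 0 <= V.
  by rewrite (le_trans _ dutV)//; apply: Rintegral_ge0 => p _; exact: normc_ge0.
have B0 : 0 <= del `^ (a - 1) * (4 * A + V) / L.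
  by rewrite divr_ge0 ?mulr_ge0 ?powR_ge0 ?addr_ge0 ?mulr_ge0// ltW.
have near0 d : 0 <= d -> d <= del -> d <= N ->
    normc (cintegral `[0, d] osc) <= 1 / a * A * del `^ a.
  move=> d0 ddel dN; have [_ ih] := Rintegral_powR0 a0 d0.
  apply: (@le_trans _ _ (A * (\int[mu]_(p in `[0, d]) p `^ (a - 1)))).
    apply: normc_osc_le => // p /andP[p0 pd]; apply: utA.
    by rewrite p0 (le_trans pd).
  rewrite mul1r -mulrA mulrCA ler_wpM2l// (le_trans ih)// mulrC.
  by rewrite ler_wpM2l ?invr_ge0 ?(ltW a0)// ge0_ler_powR ?nnegrE// ltW.
have [Ndel|delN] := leP N del.
  by apply: (le_trans (near0 N N0 Ndel (lexx _))); rewrite lerDl.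
have oi : cintegrable `[0, N] osc by exact: osc_integrable utA.
rewrite (cintegral_itv_cat (ltW del0) (ltW delN) oi).
have sub p : del <= p <= N -> 0 <= p <= N.
  by move=> /andP[dp ->]; rewrite (le_trans (ltW del0) dp).
apply: (le_trans (le_normcD _ _)); apply: lerD; first exact: near0 (ltW del0) (lexx _) (ltW delN).
apply: (normc_osc_away_le del0 (lexx _) (ltW delN) (lexx _) L0).
- by move=> p /sub/utA.
- exact: normc_dut_sub_le (ltW del0) (lexx N) dutV.
- by case: th1L => h; [left|right] => p /sub/h.
Qed.

End OscillatoryPieces.

(** * Half-lines and reflection *)

Section Reflection.
Variable R : realType.
Local Notation mu := (@lebesgue_measure R).
Local Notation opp := (fun x : measurableTypeR R => - x : measurableTypeR R).

Lemma measurable_opp : measurable_fun [set: measurableTypeR R] opp.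
Proof. by apply: measurable_funN; exact: measurable_id. Qed.

Lemma preimage_opp_itv (i : interval R) :
  opp @^-1` [set` i] =
  [set` let: Interval a b := i in Interval
     (match b with BSide c x => BSide (~~ c) (- x) | BInfty c => BInfty _ (~~ c) end)
     (match a with BSide c x => BSide (~~ c) (- x) | BInfty c => BInfty _ (~~ c) end)].
Proof.
apply/seteqP; case: i => [[[] a|[]] [[] b|[]]]; split => x /=;
  rewrite !in_itv/= ?andbT ?andbF//; lra.
Qed.

(** Lebesgue measure is determined by its values on the intervals [`]a, b]], whose
    reflections have the same length. *)
Lemma lebesgue_measure_opp (A : set (measurableTypeR R)) : measurable A ->
  mu A = pushforward mu opp A.
Proof.
apply: (@lebesgue_measure_unique R
  (measure_function_pushforward__canonical__measure_function_Measure mu measurable_opp)) => X.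
move=> /ocitvP[->|[[a b] /= ab ->]]; first by rewrite !measure0.
change (mu `]a, b] = mu (opp @^-1` `]a, b])).
rewrite preimage_opp_itv/= !lebesgue_measure_itv/= !lte_fin ltrN2.
by case: ifP => // _; rewrite -!EFinD opprK addrC.
Qed.

Lemma integral_opp (A : set R) (f : R -> \bar R) : measurable A ->
  measurable_fun A f -> (forall x, A x -> 0 <= f x)%E ->
  (\int[mu]_(x in A) f x)%E = (\int[mu]_(x in [set x : R | A (- x)%R]) f (- x)%R)%E.
Proof.
move=> mA mf f0.
transitivity (\int[pushforward mu opp]_(x in A) f x)%E.
  apply: eq_measure_integral; first exact: measurable_opp.
  by move=> mo B mB _; exact: lebesgue_measure_opp.
rewrite ge0_integral_pushforward//; first exact: measurable_opp.
by move=> x; rewrite inE; exact: f0.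
Qed.

Lemma integrable_opp (A : set R) (f : R -> R) : measurable A ->
  mu.-integrable A (EFin \o f) ->
  mu.-integrable [set x | A (- x)] (EFin \o (fun x => f (- x))) /\
  \int[mu]_(x in A) f x = \int[mu]_(x in [set x | A (- x)]) f (- x).
Proof.
move=> mA fi; have mf : measurable_fun A f.
  by move/integrableP : fi => [/measurable_EFinP].
have mA' : measurable [set x | A (- x)].
  by rewrite -[X in measurable X]setTI; exact: measurable_opp.
have mf' : measurable_fun [set x | A (- x)] (fun x => f (- x)).
  apply: (@measurable_comp _ _ _ _ _ _ A f) => //.
  by move=> _ [x Ax <-].
split.
  apply/integrableP; split; first exact/measurable_EFinP.
  move/integrableP : fi => [_]; rewrite integral_opp//.
  by do 2 apply: measurableT_comp => //.
rewrite /Rintegral integralE [in RHS]integralE.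
congr (fine (_ - _)).
  rewrite integral_opp//; last by apply: measurable_funepos; exact/measurable_EFinP.
  by apply: eq_integral => x _; rewrite !funeposE.
rewrite integral_opp//; last by apply: measurable_funeneg; exact/measurable_EFinP.
by apply: eq_integral => x _; rewrite !funenegE.
Qed.

Lemma cintegrable_opp (A : set R) (g : R -> R[i]) : measurable A ->
  cintegrable A g ->
  cintegrable [set x | A (- x)] (fun x => g (- x)) /\
  cintegral A g = cintegral [set x | A (- x)] (fun x => g (- x)).
Proof.
move=> mA [/(integrable_opp mA)[h1 e1] /(integrable_opp mA)[h2 e2]].
by split; [split|rewrite /cintegral e1 e2].
Qed.

End Reflection.

Section HalfLine.
Variable R : realType.
Local Notation mu := (@lebesgue_measure R).

Lemma cvg_Rintegral_halfline (f : R -> R) :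
  mu.-integrable `[0, +oo[ (EFin \o f) ->
  \int[mu]_(x in `[0, n%:R]) f x @[n --> \oo] --> \int[mu]_(x in `[0, +oo[) f x.
Proof.
move=> fi; pose H : set R := `[0, +oo[; have mf : measurable_fun H f.
  by move/integrableP : fi => [/measurable_EFinP].
pose J (n : nat) : set R := `[0, n%:R].
rewrite (_ : (fun n : nat => _) =
    (fun n : nat => \int[mu]_(x in H) (f \_ (J n)) x)); last first.
  apply/funext => n; rewrite -Rintegral_mkcondr; congr (Rintegral _ _ _).
  by apply/seteqP; split => x; rewrite /H /J /= !in_itv/= andbT; [move=> /andP[-> ->]|case].
apply: (@dominated_cvg_Rintegral _ _ _ _ (fun x => `|f x|)) => //.
- exact: measurable_itv.
- move=> n; have [+ _] := @measurable_restrict _ _ R R (J n) H f (measurable_itv _) (measurable_itv _); apply.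
  by apply: measurable_funS mf => //; first exact: measurable_itv; exact: subIsetl.
- move=> x; rewrite /H /= in_itv/= andbT => x0; apply: cvg_near_cst; near=> n.
  rewrite patchE mem_set// /J /= in_itv/= x0/=.
  by near: n; exact: nbhs_infty_ger.
- exact: integrable_norm.
- by move=> n x _; rewrite patchE; case: ifP => // _; rewrite normr0.
Unshelve. all: by end_near. Qed.

Lemma normc_cintegral_halfline_le (g : R -> R[i]) (B : R) (N : nat) :
  cintegrable `[0, +oo[ g ->
  (forall n, (N <= n)%N -> normc (cintegral `[0, n%:R] g) <= B) ->
  normc (cintegral `[0, +oo[ g) <= B.
Proof.
move=> [g1 g2] gB; pose I n := cintegral `[0, n%:R] g.
have c1 : complex.Re (I n) @[n --> \oo] --> complex.Re (cintegral `[0, +oo[ g).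
  exact: cvg_Rintegral_halfline.
have c2 : complex.Im (I n) @[n --> \oo] --> complex.Im (cintegral `[0, +oo[ g).
  exact: cvg_Rintegral_halfline.
have cI : normc (I n) @[n --> \oo] --> normc (cintegral `[0, +oo[ g).
  rewrite normcE_Re_Im; under eq_fun do rewrite normcE_Re_Im.
  have c3 : complex.Re (I n) ^+ 2 + complex.Im (I n) ^+ 2 @[n --> \oo] -->
      complex.Re (cintegral `[0, +oo[ g) ^+ 2 + complex.Im (cintegral `[0, +oo[ g) ^+ 2.
    by rewrite !expr2; under eq_fun do rewrite !expr2; apply: cvgD; apply: cvgM.
  by apply: continuous_cvg; [exact: sqrt_continuous|exact: c3].
rewrite -(cvg_lim _ cI)//; apply: limr_le; first by apply/cvg_ex; eexists; exact: cI.
by exists N => // n /= Nn; exact: gB.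
Qed.

Lemma normc_cintegral_pieces_le (g : R -> R[i]) (N : nat) (B T : R) (w : nat -> R) :
  cintegrable `[0, +oo[ g -> normc (cintegral `[0, N%:R] g) <= B ->
  (forall n, (N <= n)%N -> normc (cintegral `[n%:R, n.+1%:R] g) <= w n) ->
  (forall n, \sum_(N <= k < n) w k <= T) ->
  normc (cintegral `[0, +oo[ g) <= B + T.
Proof.
move=> gi gB gw wT; apply: (@normc_cintegral_halfline_le _ _ N) => // n Nn.
apply: (@le_trans _ _ (B + \sum_(N <= k < n) w k)); last by rewrite lerD2l.
rewrite -(subnKC Nn); elim: (n - N)%N => [|l ih].
  by rewrite addn0 big_geq// addr0.
rewrite addnS (@cintegral_itv_cat _ _ 0 (N + l)%:R) ?ler0n ?ler_nat//; last first.
  by apply: cintegrableS gi => //; apply: subset_itvl.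
rewrite big_nat_recr ?leq_addr// addrA.
by apply: (le_trans (le_normcD _ _)); apply: lerD => //; apply: gw; exact: leq_addr.
Qed.

(** Telescoping against [- p `^ (- s) / s], an antiderivative of the summand. *)
Lemma sum_powR_le (s : R) (N n : nat) : 0 < s -> (2 <= N)%N ->
  \sum_(N <= k < n) k%:R `^ (- s - 1) <= (s + 1) / s.
Proof.
move=> s0 N2.
have step k : (2 <= k)%N ->
    k%:R `^ (- s - 1) <= ((k.-1)%:R `^ (- s) - k%:R `^ (- s)) / s :> R.
  case: k => // k; rewrite ltnS => k1; rewrite [_.-1]/=.
  have k0 : 0 < k%:R :> R by rewrite ltr0n.
  have [] := @MVT_cc R (fun p => p `^ (- s)) (fun p => - s * p `^ (- s - 1)) k%:R k.+1%:R.
  - by rewrite ler_nat.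
  - by move=> x /andP[kx _]; apply: is_derive1_powR; exact: lt_le_trans kx.
  have d1 : k.+1%:R - k%:R = 1 :> R by rewrite -natr1 addrAC subrr add0r.
  move=> c /andP[kc ck]; rewrite d1 mulr1 => e.
  have -> : k%:R `^ (- s) - k.+1%:R `^ (- s) = s * c `^ (- s - 1) by lra.
  rewrite mulrAC divff ?gt_eqF// mul1r.
  by apply: le_powR_npos => //; [lra|exact: lt_le_trans kc].
have N1 : (N.-1)%:R `^ (- s) <= 1 :> R.
  rewrite powRN invf_le1 ?powR_gt0 ?ltr0n//; last by case: (N) N2 => [|[]].
  have := @ge0_ler_powR R s (ltW s0) 1 (N.-1)%:R; rewrite powR1; apply.
  - by rewrite nnegrE.
  - by rewrite nnegrE.
  - by rewrite ler1n; case: (N) N2 => [|[]].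
have main l : \sum_(N <= k < N + l) k%:R `^ (- s - 1)
    <= ((N.-1)%:R `^ (- s) - (N + l).-1%:R `^ (- s)) / s :> R.
  elim: l => [|l ih]; first by rewrite addn0 big_geq// subrr mul0r.
  rewrite addnS big_nat_recr ?leq_addr//=.
  have := step (N + l)%N (leq_trans N2 (leq_addr _ _)).
  by move: ih; rewrite !mulrBl; lra.
have [nN|nN] := leqP n N; first by rewrite big_geq// divr_ge0 ?addr_ge0// ltW.
rewrite -(subnKC (ltnW nN)); apply: (le_trans (main _)).
rewrite ler_wpM2r ?invr_ge0 ?(ltW s0)//.
have := powR_ge0 ((N + (n - N)).-1%:R : R) (- s); lra.
Qed.

End HalfLine.

(** * Estimates on a half-line, with and without stationary point *)

Section HalfLineEstimates.
Variable R : realType.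

Lemma powRD_gt0 (y r s : R) : 0 < y -> y `^ (r + s) = y `^ r * y `^ s.
Proof. by move=> y0; rewrite powRD// (gt_eqF y0) implybT. Qed.

Local Notation mu := (@lebesgue_measure R).
Variables (ut dut : R -> R[i]) (f f1 f2 : R -> R).
Variables (a alpha beta cm A V M M' : R) (N : nat).
Hypothesis a01 : 0 < a <= 1.
Hypothesis utd : forall p : R, is_cderive ut p (dut p).
Hypothesis duti : forall c d : R, cintegrable `[c, d] dut.
Hypothesis fd : forall p : R, is_derive p 1 f (f1 p).
Hypothesis f1d : forall p : R, is_derive p 1 f1 (f2 p).
Hypothesis cf2 : continuous f2.
Hypothesis f2_gt0 : forall p, 0 < f2 p.
Hypothesis N2 : (2 <= N)%N.
Hypothesis utA : forall p : R, 0 <= p <= N%:R -> normc (ut p) <= A.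
Hypothesis dutV : \int[mu]_(p in `[0, N%:R]) normc (dut p) <= V.
Hypothesis M_ge0 : 0 <= M.
Hypothesis M'_ge0 : 0 <= M'.
Hypothesis utM : forall p : R, N%:R <= p -> normc (ut p) <= M * p `^ (- alpha).
Hypothesis dutM' : forall n : nat, (N <= n)%N ->
  \int[mu]_(p in `[n%:R, n.+1%:R]) normc (dut p) <= M' * n%:R `^ (- alpha).
Hypothesis cm_gt0 : 0 < cm.
Hypothesis f2_ge : forall p : R, N%:R <= p -> cm * p `^ (- beta) <= f2 p.
Hypothesis beta_gt1 : 1 < beta.
Hypothesis alpha_gt : beta < alpha - a.
Variables (t x : R).
Hypothesis t_gt0 : 0 < t.
Hypothesis gi : cintegrable `[0, +oo[ (osc ut (fun p => x * p - t * f p) a).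

Let th p := x * p - t * f p.
Let th1 p := x - t * f1 p.
Let th2 p := - (t * f2 p).

Let thd (p : R) : is_derive p 1 th (th1 p).
Proof.
have h1 : is_derive p 1 (fun p : R => x * p) (0 * p + x * 1) by exact: is_derive1M.
have h2 : is_derive p 1 (fun p : R => t * f p) (0 * f p + t * f1 p).
  exact: (is_derive1M (is_derive_cst t p 1) (fd p)).
apply: (is_derive1_eq (is_derive1B h1 h2)); rewrite /th1; ring.
Qed.

Let th1d (p : R) : is_derive p 1 th1 (th2 p).
Proof.
have h2 : is_derive p 1 (fun p : R => t * f1 p) (0 * f1 p + t * f2 p).
  exact: (is_derive1M (is_derive_cst t p 1) (f1d p)).
apply: (is_derive1_eq (is_derive1B (is_derive_cst x p 1) h2)); rewrite /th2; ring.
Qed.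

Let cth2 : continuous th2.
Proof. by move=> p; apply: cvgN; apply: cvgM; [exact: cvg_cst|exact: cf2]. Qed.

Let th2_le0 p : th2 p <= 0.
Proof. by rewrite oppr_le0 mulr_ge0 ?ltW. Qed.

Let f1_incr p q : p <= q -> f1 p <= f1 q.
Proof.
move=> pq; have [c _ e] := MVT_cc pq (fun y _ => f1d y).
by rewrite -subr_ge0 e mulr_ge0 ?subr_ge0// ltW.
Qed.

Lemma f1_slope (c d m p q : R) : c <= p -> p <= q -> q <= d ->
  (forall y, c <= y <= d -> m <= f2 y) -> m * (q - p) <= f1 q - f1 p.
Proof.
move=> cp pq qd mf; have [y /andP[py yq] ->] := MVT_cc pq (fun y _ => f1d y).
by rewrite ler_wpM2r ?subr_ge0// mf// (le_trans cp py) (le_trans yq qd).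
Qed.

(** With [q] the projection of the stationary point [p0] on [[c, d]], the phase
    derivative [t * (f1 p0 - f1 p)] is at least [t * m * `|p - q|] there, even
    when [p0] lies outside. *)
Lemma th1_slope (c d m p0 : R) : c <= d -> x = t * f1 p0 ->
  (forall y, c <= y <= d -> m <= f2 y) ->
  exists q, (forall p : R, c <= p <= d -> p < q -> t * m * (q - p) <= th1 p) /\
    (forall p : R, c <= p <= d -> q < p -> th1 p <= - (t * m * (p - q))).
Proof.
move=> cd xp0 mf; exists (Num.max c (Num.min d p0)); set q := Num.max _ _.
have cq : c <= q by rewrite le_max lexx.
have qd : q <= d by rewrite ge_max cd ge_min lexx.
split=> p /andP[cp pd] pq.
- have qp0 : q <= p0.
    have : c < q by exact: le_lt_trans cp pq.
    by rewrite /q lt_max ltxx/= => h; rewrite (max_r (ltW h)) ge_min lexx orbT.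
  rewrite /th1 xp0 -mulrBr -mulrA ler_pM2l//.
  apply: (le_trans (f1_slope cp (ltW pq) qd mf)).
  by rewrite lerD2r; exact: f1_incr.
- have qp0 : p0 <= q.
    have : q < d by exact: lt_le_trans pq pd.
    rewrite /q gt_max => /andP[_]; rewrite gt_min ltxx/= => h.
    by rewrite (min_r (ltW h)) le_max lexx orbT.
  rewrite /th1 xp0 -mulrBr -mulrA -mulrN ler_pM2l// lerNr opprB.
  apply: (le_trans (f1_slope cq (ltW pq) pd mf)).
  by rewrite lerD2l lerN2; exact: f1_incr.
Qed.

Let N_ge n : (N <= n)%N -> 0 < n%:R :> R.
Proof. by move=> Nn; rewrite ltr0n (leq_trans _ Nn)// (leq_trans _ N2). Qed.

Let utMn n (p : R) : (N <= n)%N -> n%:R <= p <= n.+1%:R ->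
  normc (ut p) <= M * n%:R `^ (- alpha).
Proof.
move=> Nn /andP[np _]; apply: (le_trans (utM _)).
  by rewrite (le_trans _ np)// ler_nat.
rewrite ler_wpM2l// le_powR_npos ?N_ge//.
by move/andP: a01 => [? ?]; move: beta_gt1 alpha_gt; lra.
Qed.

Let powR_natS n (b : R) : (N <= n)%N -> 0 <= b ->
  n.+1%:R `^ b <= 2 `^ b * n%:R `^ b.
Proof.
move=> Nn b0; rewrite -powRM// ge0_ler_powR ?nnegrE//.
have : 1 <= n%:R :> R by rewrite ler1n (leq_trans _ Nn)// (leq_trans _ N2).
by rewrite -natr1; lra.
Qed.

Let osc_th := osc ut th a.

Let f2_piece n (y : R) : (N <= n)%N -> n%:R <= y <= n.+1%:R ->
  cm * n.+1%:R `^ (- beta) <= f2 y.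
Proof.
move=> Nn /andP[ny yn]; apply: (le_trans _ (f2_ge _)); last first.
  by rewrite (le_trans _ ny)// ler_nat.
rewrite ler_pM2l// le_powR_npos//; last by rewrite (lt_le_trans (N_ge Nn)).
by move: beta_gt1; lra.
Qed.

(** With [del = t `^ (- (1 / 2))] the window and the remaining part balance: on
    [[0, N]] both are of order [del `^ a], and on [[n, n + 1]] of order [del], with
    coefficients summable in [n]. *)
Lemma halfline_stationary_le (m p0 : R) : 0 < m ->
  (forall p : R, 0 <= p <= N%:R -> m <= f2 p) -> x = t * f1 p0 ->
  normc (cintegral `[0, +oo[ osc_th) <=
    (3 / a * A + 2 * (4 * A + V) / m) * t `^ (- (a / 2)) +
    (2 * M * ((alpha - a + 1) / (alpha - a)) +
     2 * 2 `^ beta * (4 * M + M') / cm *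
       ((alpha - a - beta + 1) / (alpha - a - beta))) * t `^ (- (1 / 2)).
Proof.
move=> m0 mf xp0; have /andP[a0 a1] := a01.
pose del := t `^ (- (1 / 2)).
have del0 : 0 < del by exact: powR_gt0.
have tdel : t * (del * del) = 1.
  rewrite /del -powRD_gt0//.
  have -> : - (1 / 2) + - (1 / 2) = -1 :> R by field.
  by rewrite powR_inv1 ?(ltW t_gt0)// divff// gt_eqF.
have t_inv : t = (del * del)^-1.
  have dd : del * del != 0 by rewrite gt_eqF// mulr_gt0.
  by apply: (mulIf dd); rewrite tdel mulVf.
have dela : t `^ (- (a / 2)) = del `^ a.
  by rewrite /del -powRrM; congr (_ `^ _); field.
have s10 : 0 < alpha - a by move: beta_gt1 alpha_gt; lra.
have s20 : 0 < alpha - a - beta by move: alpha_gt; lra.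
pose w (n : nat) := 2 * M * del * n%:R `^ (- (alpha - a) - 1) +
  2 * 2 `^ beta * (4 * M + M') / cm * del * n%:R `^ (- (alpha - a - beta) - 1).
rewrite dela -/del.
have -> : (3 / a * A + 2 * (4 * A + V) / m) * del `^ a =
    3 / a * A * del `^ a + 2 * (del `^ (a - 1) * (4 * A + V) / (t * m * del)).
  rewrite powRD_gt0// powR_inv1 ?(ltW del0)// t_inv; field.
  by rewrite !gt_eqF.
apply: (@normc_cintegral_pieces_le _ _ N _ _ w) => //.
- have [q [q1 q2]] := th1_slope (ler0n _ N) xp0 mf.
  apply: (normc_osc0_stationary_le a01 utd duti thd th1d cth2 th2_le0 _ _ _ utA dutV q1 q2) => //.
  exact: mulr_gt0.
- move=> n Nn; have n0 := N_ge Nn.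
  have nn : n%:R <= n.+1%:R :> R by rewrite ler_nat.
  have mn0 : 0 < cm * n.+1%:R `^ (- beta) by rewrite mulr_gt0// powR_gt0.
  have [q [q1 q2]] := th1_slope nn xp0 (fun y => @f2_piece n y Nn).
  have [e [e' [ne ee en ee2]]] := normc_osc_stationary_le a01 utd duti thd th1d cth2 th2_le0
    n0 nn (mulr_gt0 t_gt0 mn0) del0 (fun p => @utMn n p Nn) (dutM' Nn) q1 q2.
  move=> /le_trans; apply; rewrite /w; apply: lerD.
    have I1 : \int[mu]_(p in `[e, e']) p `^ (a - 1) <= n%:R `^ (a - 1) * (2 * del).
      apply: (le_trans (Rintegral_powR_le_left a01 n0 ne ee)).
      by rewrite ler_wpM2l ?powR_ge0.
    apply: (le_trans (ler_wpM2l _ I1)); first by rewrite mulr_ge0 ?powR_ge0.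
    have -> : - (alpha - a) - 1 = - alpha + (a - 1) by ring.
    by rewrite (powRD_gt0 (- alpha) (a - 1))// le_eqVlt; apply/orP; left; apply/eqP; ring.
  have -> : - (alpha - a - beta) - 1 = (- alpha + (a - 1)) + beta by ring.
  rewrite (powRD_gt0 _ beta)// (powRD_gt0 (- alpha) (a - 1))//.
  rewrite [n.+1%:R `^ (- beta)]powRN.
  have Pn := powR_natS Nn (ltW (lt_trans ltr01 beta_gt1)).
  have -> : 2 * (n%:R `^ (a - 1) * (4 * (M * n%:R `^ (- alpha)) + M' * n%:R `^ (- alpha)) /
      (t * (cm * (n.+1%:R `^ beta)^-1) * del)) =
      2 * (4 * M + M') / cm * del * (n%:R `^ (- alpha) * n%:R `^ (a - 1)) * n.+1%:R `^ beta.
    rewrite t_inv; field.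
    by rewrite !gt_eqF// powR_gt0.
  apply: (le_trans (ler_wpM2l _ Pn)); last by rewrite le_eqVlt; apply/orP; left; apply/eqP; ring.
  by rewrite !mulr_ge0 ?powR_ge0 ?invr_ge0 ?addr_ge0 ?mulr_ge0// ltW.
- move=> n; rewrite big_split/= -!mulr_sumr [leRHS]mulrDl; apply: lerD.
    have C0 : 0 <= 2 * M * del by rewrite !mulr_ge0// ltW.
    apply: (le_trans (ler_wpM2l C0 (sum_powR_le n s10 N2))).
    by rewrite le_eqVlt; apply/orP; left; apply/eqP; ring.
  have C0 : 0 <= 2 * 2 `^ beta * (4 * M + M') / cm * del.
    by rewrite !mulr_ge0 ?powR_ge0 ?invr_ge0 ?addr_ge0 ?mulr_ge0// ltW.
  apply: (le_trans (ler_wpM2l C0 (sum_powR_le n s20 N2))).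
  by rewrite le_eqVlt; apply/orP; left; apply/eqP; ring.
Qed.

(** Here [x / t] lies beyond one of the limits [aa], [b] of the slope [f1], so
    that the phase derivative keeps a sign and is at least [t] times the gap between
    [f1] and that limit. *)
Lemma halfline_away_le (aa b m : R) : 0 < m ->
  m <= f1 0 - aa -> m <= b - f1 N%:R ->
  (forall p : R, N%:R <= p -> cm / (beta - 1) * p `^ (1 - beta) <= b - f1 p) ->
  (forall p : R, N%:R <= p -> cm / (beta - 1) * p `^ (1 - beta) <= f1 p - aa) ->
  (t * b <= x \/ x <= t * aa) ->
  normc (cintegral `[0, +oo[ osc_th) <=
    (1 / a * A + (4 * A + V) / m) * t `^ (- a) +
    (2 `^ (beta - 1) * (4 * M + M') * (beta - 1) / cm *
       ((alpha + 2 - a - beta) / (alpha + 1 - a - beta))) * t^-1.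
Proof.
move=> m0 ma mb fb fa xab; have /andP[a0 a1] := a01.
have b1 : 0 < beta - 1 by rewrite subr_gt0.
pose del := t^-1.
have del0 : 0 < del by rewrite invr_gt0.
have dela : t `^ (- a) = del `^ a by rewrite /del -powR_inv1 ?(ltW t_gt0)// -powRrM mulN1r.
have t_inv : t = del^-1 by rewrite invrK.
have s0 : 0 < alpha + 1 - a - beta by move: alpha_gt; lra.
pose C := 2 `^ (beta - 1) * (4 * M + M') * (beta - 1) / cm * del.
pose w (n : nat) := C * n%:R `^ (- (alpha + 1 - a - beta) - 1).
rewrite dela -/del.
have -> : (1 / a * A + (4 * A + V) / m) * del `^ a =
    1 / a * A * del `^ a + del `^ (a - 1) * (4 * A + V) / (t * m).
  rewrite powRD_gt0// powR_inv1 ?(ltW del0)// t_inv; field.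
  by rewrite !gt_eqF.
have sign (c d L : R) : L <= b - f1 d -> L <= f1 c - aa ->
    (forall p : R, c <= p <= d -> t * L <= th1 p) \/
    (forall p : R, c <= p <= d -> th1 p <= - (t * L)).
  move=> Lb La; case: xab => xab; [left|right] => p /andP[cp pd]; rewrite /th1.
    have h : t * L <= t * (b - f1 p).
      by rewrite ler_pM2l// (le_trans Lb)// lerD2l lerN2 f1_incr.
    by lra.
  have h : t * L <= t * (f1 p - aa).
    by rewrite ler_pM2l// (le_trans La)// lerD2r f1_incr.
  by lra.
apply: (@normc_cintegral_pieces_le _ _ N _ _ w) => //.
- apply: (normc_osc0_away_le a01 utd duti thd th1d cth2 th2_le0 _ _ _ utA dutV) => //.
    exact: mulr_gt0.
  exact: sign.
- move=> n Nn; have n0 := N_ge Nn.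
  have nn : n%:R <= n.+1%:R :> R by rewrite ler_nat.
  have NS : N%:R <= n.+1%:R :> R by rewrite ler_nat leqW.
  pose L := cm / (beta - 1) * n.+1%:R `^ (1 - beta).
  have L0 : 0 < L by rewrite mulr_gt0 ?powR_gt0// divr_gt0.
  have La : L <= f1 n%:R - aa.
    apply: (le_trans _ (fa n%:R _)); last by rewrite ler_nat.
    rewrite ler_wpM2l ?divr_ge0 ?(ltW cm_gt0) ?(ltW b1)// le_powR_npos//.
    by rewrite subr_le0 ltW.
  have := normc_osc_away_le a01 utd duti thd th1d cth2 th2_le0 n0 (lexx _) nn (lexx _)
    (mulr_gt0 t_gt0 L0) (fun p => @utMn n p Nn) (dutM' Nn) (sign _ _ _ (fb _ NS) La).
  move=> /le_trans; apply; rewrite /w /C /L.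
  have -> : - (alpha + 1 - a - beta) - 1 = (- alpha + (a - 1)) + (beta - 1) by ring.
  have -> : 1 - beta = - (beta - 1) by ring.
  rewrite (powRD_gt0 _ (beta - 1))// (powRD_gt0 (- alpha) (a - 1))//.
  rewrite [n.+1%:R `^ (- (beta - 1))]powRN.
  have Pn := powR_natS Nn (ltW b1).
  have -> : n%:R `^ (a - 1) * (4 * (M * n%:R `^ (- alpha)) + M' * n%:R `^ (- alpha)) /
      (t * (cm / (beta - 1) * (n.+1%:R `^ (beta - 1))^-1)) =
      (4 * M + M') * (beta - 1) / cm * del * (n%:R `^ (- alpha) * n%:R `^ (a - 1)) *
        n.+1%:R `^ (beta - 1).
    rewrite t_inv; field.
    by rewrite !gt_eqF// powR_gt0.
  apply: (le_trans (ler_wpM2l _ Pn)); last by rewrite le_eqVlt; apply/orP; left; apply/eqP; ring.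
  by rewrite !mulr_ge0 ?powR_ge0 ?invr_ge0 ?(ltW b1) ?(ltW cm_gt0) ?(ltW t_gt0)// addr_ge0 ?mulr_ge0.
- move=> n; rewrite -!mulr_sumr.
  have C0 : 0 <= C.
    by rewrite !mulr_ge0 ?powR_ge0 ?invr_ge0 ?(ltW b1) ?(ltW cm_gt0) ?(ltW t_gt0)// addr_ge0 ?mulr_ge0.
  have h := sum_powR_le n s0 N2.
  apply: (le_trans (ler_wpM2l C0 h)); rewrite /C le_eqVlt; apply/orP; left; apply/eqP.
  field.
  by rewrite !gt_eqF.
Qed.

End HalfLineEstimates.

(** * Integrals over the line and limits at infinity *)

Section Line.
Variable R : realType.
Local Notation mu := (@lebesgue_measure R).

(** Monotone convergence along [[0, n]]. *)
Lemma integrable_halfline (h : R -> R) (K : R) :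
  measurable_fun setT h -> (forall x, 0 <= x -> 0 <= h x) ->
  (forall n : nat, mu.-integrable `[0, n%:R] (EFin \o h) /\
     \int[mu]_(x in `[0, n%:R]) h x <= K) ->
  mu.-integrable `[0, +oo[ (EFin \o h) /\ \int[mu]_(x in `[0, +oo[) h x <= K.
Proof.
move=> mh h0 hn.
have mh' (A : set R) : measurable_fun A (EFin \o h).
  by apply/measurable_EFinP; apply: measurable_funTS.
pose H : set R := `[0, +oo[; pose J (n : nat) : set R := `[0, n%:R].
have JU : \bigcup_n J n = H.
  apply/seteqP; split => x; rewrite /H /J /= !in_itv/= andbT.
    by move=> [n _ /=]; rewrite in_itv/= => /andP[].
  move=> x0; exists (Num.truncn x).+1 => //=; rewrite in_itv/= x0/=.
  exact/ltW/truncnS_gt.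
have H_le : (\int[mu]_(x in H) (h x)%:E <= K%:E)%E.
  have cvg_n : (\int[mu]_(x in J n) (h x)%:E)%E @[n --> \oo] --> (\int[mu]_(x in H) (h x)%:E)%E.
    rewrite -JU; apply: ge0_nondecreasing_set_cvg_integral.
    - move=> n m nm; apply/subsetPset; apply: subset_itvl.
      by rewrite bnd_simp ler_nat.
    - by move=> n; exact: measurable_itv.
    - by move=> n; exact: mh'.
    - by move=> n x; rewrite /J/= in_itv/= lee_fin => /andP[/h0].
  apply: (cvge_to_le cvg_n); apply: nearW => n; have [hi hK] := hn n.
  by rewrite -(fineK (integrable_fin_num _ hi))// lee_fin.
have hi : mu.-integrable H (EFin \o h).
  apply/integrableP; split; first exact: mh'.
  apply: le_lt_trans (ltry K); apply: le_trans H_le.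
  rewrite le_eqVlt; apply/orP; left; apply/eqP; apply: eq_integral => x.
  by rewrite inE /H/= in_itv/= andbT => x0; rewrite ger0_norm ?h0.
split => //; rewrite /Rintegral -lee_fin fineK//.
by apply: integrable_fin_num => //; exact: measurable_itv.
Qed.

Lemma integrable_line (f : R -> R) :
  mu.-integrable `[0, +oo[ (EFin \o f) ->
  mu.-integrable `[0, +oo[ (EFin \o (fun x => f (- x))) ->
  mu.-integrable setT (EFin \o f) /\
  \int[mu]_x f x =
    \int[mu]_(x in `[0, +oo[) f x + \int[mu]_(x in `[0, +oo[) f (- x).
Proof.
move=> fi fNi.
have oE : [set x : R | `]0, +oo[%classic (- x)] = `]-oo, 0[.
  by apply/seteqP; split => x /=; rewrite !in_itv/= ?andbT oppr_gt0.
have fNi' : mu.-integrable `]0, +oo[ (EFin \o (fun x => f (- x))).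
  by apply: integrableS fNi => //; apply: subset_itvr; rewrite bnd_simp.
have := @integrable_opp _ `]0, +oo[ (fun x => f (- x)) (measurable_itv _) fNi'.
rewrite oE (_ : (fun x => f (- - x)) = f); last by apply/funext => x; rewrite opprK.
move=> [fl el].
have TE : [set: R] = `]-oo, 0[ `|` `[0, +oo[.
  apply/seteqP; split => x //= _; rewrite !in_itv/= andbT.
  by case: (ltP x 0); [left|right].
have fT : mu.-integrable setT (EFin \o f).
  have mT : measurable_fun setT f.
    rewrite TE; apply/measurable_funU => //; split.
      by move/integrableP : fl => [/measurable_EFinP].
    by move/integrableP : fi => [/measurable_EFinP].
  apply/integrableP; split; first exact/measurable_EFinP.
  rewrite TE ge0_integral_setU//.
  - rewrite lte_add_pinfty//.
      by move/integrableP : fl => [_].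
    by move/integrableP : fi => [_].
  - by apply: measurableT_comp => //; apply/measurable_EFinP; rewrite -TE.
  - apply/disj_setPS => x [/=]; rewrite !in_itv/= andbT => x0.
    by rewrite leNgt x0.
split => //.
rewrite [in LHS]TE Rintegral_setU//=.
- rewrite -el addrC; congr (_ + _).
  by rewrite Rintegral_itv_obnd_cbnd.
- by rewrite -TE.
- apply/disj_setPS => x [/=]; rewrite !in_itv/= andbT => x0.
  by rewrite leNgt x0.
Qed.

Lemma cintegral_line (g : R -> R[i]) :
  cintegrable `[0, +oo[ g -> cintegrable `[0, +oo[ (fun x => g (- x)) ->
  cintegrable setT g /\
  cintegral setT g =
    cintegral `[0, +oo[ g + cintegral `[0, +oo[ (fun x => g (- x)).
Proof.
move=> [g1 g2] [g1' g2'].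
have [h1 e1] := integrable_line g1 g1'; have [h2 e2] := integrable_line g2 g2'.
by split; [split|apply: complex_ext; rewrite ReImE /= ?e1 ?e2].
Qed.

Lemma nondecreasing_cvg_pinfty (g : R -> R) (B : R) :
  {homo g : x y / x <= y} -> (forall x, g x <= B) ->
  g x @[x --> +oo] --> sup (range g).
Proof.
move=> gm gB.
have hs : has_sup (range g).
  by split; [exists (g 0), 0|exists B => _ [x _ <-]].
apply/cvgrPdist_le => e e0.
have [_ [x0 _ <-] hx0] := sup_adherent e0 hs.
near=> x; rewrite ger0_norm.
  have : g x0 <= g x by apply: gm; near: x; apply: nbhs_pinfty_ge; exact: num_real.
  by move: hx0; lra.
rewrite subr_ge0; apply: ub_le_sup; last by exists x.
by case: hs.
Unshelve. all: by end_near. Qed.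

(** The Lorentzian [1 / (1 + x ^+ 2)] serves as universal integrable majorant. *)
Lemma lorentz_integrable : mu.-integrable setT (EFin \o (fun x : R => (1 + x ^+ 2)^-1)).
Proof.
pose L (x : R) := (1 + x ^+ 2)^-1.
have mL : measurable_fun setT L.
  by apply: continuous_measurable_fun; exact: continuous_oneDsqrV.
have L0 x : 0 <= x -> 0 <= L x by move=> _; rewrite invr_ge0 addr_ge0 ?sqr_ge0.
have [H _] : mu.-integrable `[0, +oo[ (EFin \o L) /\
    \int[mu]_(x in `[0, +oo[) L x <= pi / 2.
  apply: integrable_halfline => // n.
  have ci : mu.-integrable `[0, n%:R] (EFin \o L).
    apply: continuous_compact_integrable; first exact: segment_compact.
    by apply: continuous_subspaceT; exact: continuous_oneDsqrV.
  split => //.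
  rewrite (Rintegral_derive (ler0n _ n) (fun x _ => is_derive1_atan x) ci).
  by rewrite atan0 subr0 ltW// atan_ltpi2.
have HN : mu.-integrable `[0, +oo[ (EFin \o (fun x : R => L (- x))).
  by apply: eq_integrable H => // x _ /=; rewrite /L sqrrN.
exact: (integrable_line H HN).1.
Qed.

End Line.

(** * Limits of the slope at infinity *)

Section SlopeLimit.
Variable R : realType.
Variables (g1 g2 : R -> R) (c c' beta beta' rho : R).
Hypothesis g1d : forall p : R, is_derive p 1 g1 (g2 p).
Hypothesis g2_gt0 : forall p, 0 < g2 p.
Hypothesis rho_ge1 : 1 <= rho.
Hypothesis c_gt0 : 0 < c.
Hypothesis beta_gt1 : 1 < beta.
Hypothesis beta'_gt1 : 1 < beta'.
Hypothesis g2_ge : forall p, rho <= p -> c * p `^ (- beta) <= g2 p.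
Hypothesis g2_le : forall p, rho <= p -> g2 p <= c' * p `^ (- beta').

Lemma derive_gt0_lt p q : p < q -> g1 p < g1 q.
Proof.
move=> pq; have [y _ e] := MVT_cc (ltW pq) (fun y _ => g1d y).
by rewrite -subr_gt0 e mulr_gt0 ?subr_gt0.
Qed.

Let powRd k b (p : R) : rho <= p ->
  is_derive p 1 (fun p => g1 p + k * p `^ b) (g2 p + k * (b * p `^ (b - 1))).
Proof.
move=> rp; have p0 : 0 < p by rewrite (lt_le_trans _ (le_trans rho_ge1 rp)).
have h := is_derive1M (is_derive_cst k p 1) (is_derive1_powR b p0).
by apply: (is_derive1_eq (is_derive1D (g1d p) h)); rewrite mul0r add0r.
Qed.

(** [c / (beta - 1) * p `^ (1 - beta)] has derivative [- c * p `^ (- beta)], so that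
    adding it to [g1] leaves a nondecreasing function. *)
Lemma slope_increment_ge p q : rho <= p -> p <= q ->
  c / (beta - 1) * (p `^ (1 - beta) - q `^ (1 - beta)) <= g1 q - g1 p.
Proof.
move=> rp pq; have b1 : 0 < beta - 1 by rewrite subr_gt0.
have [y /andP[py _]] := MVT_cc pq (fun y h => powRd (c / (beta - 1)) (1 - beta)
  (le_trans rp (proj1 (andP h)))).
have -> : 1 - beta - 1 = - beta by ring.
have -> : g2 y + c / (beta - 1) * ((1 - beta) * y `^ (- beta)) = g2 y - c * y `^ (- beta).
  by field; rewrite gt_eqF.
move=> e; have : 0 <= (g2 y - c * y `^ (- beta)) * (q - p).
  by rewrite mulr_ge0 ?subr_ge0// g2_ge// (le_trans rp).
by rewrite -e; lra.
Qed.

Lemma slope_bounded : exists B, forall p, g1 p <= B.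
Proof.
have b1 : 0 < beta' - 1 by rewrite subr_gt0.
exists (g1 rho + c' / (beta' - 1) * rho `^ (1 - beta')) => p.
have c'0 : 0 <= c'.
  have := le_trans (ltW (g2_gt0 rho)) (g2_le (lexx _)).
  by rewrite pmulr_lge0// powR_gt0// (lt_le_trans ltr01).
have k0 x : 0 <= c' / (beta' - 1) * x `^ (1 - beta').
  by rewrite mulr_ge0 ?powR_ge0// divr_ge0// ltW.
have [pr|rp] := leP p rho.
  apply: (@le_trans _ _ (g1 rho)); last by rewrite lerDl.
  by move: pr; rewrite le_eqVlt => /predU1P[->//|/derive_gt0_lt/ltW].
have [y /andP[ry _]] := MVT_cc (ltW rp) (fun y h => powRd (c' / (beta' - 1)) (1 - beta')
  (proj1 (andP h))).
have -> : 1 - beta' - 1 = - beta' by ring.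
have -> : g2 y + c' / (beta' - 1) * ((1 - beta') * y `^ (- beta')) = g2 y - c' * y `^ (- beta').
  by field; rewrite gt_eqF.
move=> e; have : (g2 y - c' * y `^ (- beta')) * (p - rho) <= 0.
  by rewrite mulr_le0_ge0 ?subr_ge0 ?subr_le0 ?g2_le// ltW.
by rewrite -e; have := k0 p; lra.
Qed.

Lemma slope_cvg : cvg (g1 p @[p --> +oo]).
Proof.
have [B g1B] := slope_bounded.
apply/cvg_ex; exists (sup (range g1)); apply: (nondecreasing_cvg_pinfty _ g1B).
by move=> x y; rewrite le_eqVlt => /predU1P[->//|/derive_gt0_lt/ltW].
Qed.

Let l := lim (g1 p @[p --> +oo]).

Lemma slope_le_lim p : g1 p <= l.
Proof.
apply: limr_ge; first exact: slope_cvg.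
near=> q; have : p <= q by near: q; apply: nbhs_pinfty_ge; exact: num_real.
by rewrite le_eqVlt => /predU1P[->//|/derive_gt0_lt/ltW].
Unshelve. all: by end_near. Qed.

Lemma slope_lt_lim p : g1 p < l.
Proof. by apply: (lt_le_trans (derive_gt0_lt _) (slope_le_lim (p + 1))); rewrite ltrDl. Qed.

(** [slope_increment_ge] with [q] tending to infinity. *)
Lemma slope_gap p : rho <= p -> c / (beta - 1) * p `^ (1 - beta) <= l - g1 p.
Proof.
move=> rp; have b1 : 0 < beta - 1 by rewrite subr_gt0.
have k0 : 0 < c / (beta - 1) by rewrite divr_gt0.
apply/ler_addgt0Pr => e e0.
pose q := Num.max p ((e / (c / (beta - 1))) `^ (1 - beta)^-1).
have q_le : c / (beta - 1) * q `^ (1 - beta) <= e.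
  rewrite mulrC -ler_pdivlMr//.
  have p0 : 0 < e / (c / (beta - 1)) by rewrite divr_gt0.
  apply: (@le_trans _ _ (((e / (c / (beta - 1))) `^ (1 - beta)^-1) `^ (1 - beta))).
    by apply: le_powR_npos; [lra|exact: powR_gt0|rewrite le_max lexx orbT].
  by rewrite -powRrM mulVf ?powRr1 ?(ltW p0)// lt_eqF// subr_lt0.
have pq : p <= q by rewrite le_max lexx.
have := slope_increment_ge rp pq; have := slope_le_lim q.
by rewrite mulrBr; lra.
Qed.

End SlopeLimit.

Section PhaseFacts.
Variable R : realType.
Variables (f : R -> R) (betap betam rho cp cm : R).
Hypothesis fS : condition_S f betap betam rho cp cm.

Lemma smooth_is_derive n (p : R) : is_derive p 1 (f^`(n)) ((f^`(n.+1)) p).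
Proof. by apply/is_deriveE; split; first exact: (S_smooth fS). Qed.

Lemma smooth_is_derive0 (p : R) : is_derive p 1 f (f^`() p).
Proof. exact: (smooth_is_derive 0). Qed.

Lemma smooth_is_derive1 (p : R) : is_derive p 1 f^`() ((f^`(2)) p).
Proof. exact: (smooth_is_derive 1). Qed.

Lemma derive2_continuous : continuous (f^`(2)).
Proof.
by move=> p; apply/differentiable_continuous/derivable1_diffP; exact: (S_smooth fS).
Qed.

Lemma is_derive_opp (p : R) : is_derive p 1 (fun p : R => - p) (- 1).
Proof. exact: (is_deriveN (is_derive_id p 1)). Qed.

Definition reflected_slope (p : R) : R := - f^`()%classic (- p).

Lemma reflected_slope_derive (p : R) :
  is_derive p 1 reflected_slope ((f^`(2)) (- p)).
Proof.
have h := is_derive1_comp (smooth_is_derive1 (- p)) (is_derive_opp p).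
by apply: (is_derive1_eq (is_deriveN h)); rewrite mulrN1 opprK.
Qed.

Let b1 : 1 < betam. Proof. by have /andP[h] := S_beta fS; exact: lt_le_trans. Qed.
Let bp1 : 1 < betap. Proof. by have /andP[] := S_beta fS. Qed.
Let cm0 : 0 < cm. Proof. by have /andP[] := S_c fS. Qed.

Let rho0 : 0 < rho. Proof. exact: lt_le_trans ltr01 (S_rho fS). Qed.

Let bound p : rho <= p -> cm * p `^ (- betam) <= (f^`(2)) p <= cp * p `^ (- betap).
Proof.
move=> rp; have p0 := lt_le_trans rho0 rp.
by have := S_bounds fS (p := p); rewrite (gtr0_norm p0); exact.
Qed.

Let boundN p : rho <= p -> cm * p `^ (- betam) <= (f^`(2)) (- p) <= cp * p `^ (- betap).
Proof.
move=> rp; have p0 := lt_le_trans rho0 rp.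
by have := S_bounds fS (p := - p); rewrite normrN (gtr0_norm p0); exact.
Qed.

Let ge_ p (rp : rho <= p) := proj1 (andP (bound rp)).
Let le_ p (rp : rho <= p) := proj2 (andP (bound rp)).
Let geN p (rp : rho <= p) := proj1 (andP (boundN rp)).
Let leN p (rp : rho <= p) := proj2 (andP (boundN rp)).

Lemma slope_pinfty_cvg : cvg (f^`()%classic p @[p --> +oo]).
Proof.
exact: (slope_cvg smooth_is_derive1 (S_convex fS) (S_rho fS) bp1 le_).
Qed.

Let cvg_refl : cvg (reflected_slope p @[p --> +oo]).
Proof.
exact: (slope_cvg reflected_slope_derive (fun p => S_convex fS (- p)) (S_rho fS) bp1 leN).
Qed.

Let cvg_ninfty : f^`()%classic p @[p --> -oo] --> - lim (reflected_slope p @[p --> +oo]).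
Proof.
apply/cvgNy_compNP.
rewrite (_ : f^`()%classic \o -%R = (fun p => - reflected_slope p)).
  by apply: cvgN; exact: cvg_refl.
by apply/funext => p; rewrite /reflected_slope opprK.
Qed.

Lemma slope_ninfty_cvg : cvg (f^`()%classic p @[p --> -oo]).
Proof. by apply/cvg_ex; eexists; exact: cvg_ninfty. Qed.

Lemma slope_ninftyE : slope_ninfty f = - lim (reflected_slope p @[p --> +oo]).
Proof. exact: (cvg_lim _ cvg_ninfty). Qed.

Lemma slope_lt (p q : R) : p < q -> f^`()%classic p < f^`()%classic q.
Proof. exact: (derive_gt0_lt smooth_is_derive1 (S_convex fS)). Qed.

Lemma slope_lt_pinfty (p : R) : f^`()%classic p < slope_pinfty f.
Proof.
exact: (slope_lt_lim smooth_is_derive1 (S_convex fS) (S_rho fS) bp1 le_).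
Qed.

Lemma slope_gt_ninfty (p : R) : slope_ninfty f < f^`()%classic p.
Proof.
have := slope_lt_lim reflected_slope_derive (fun p => S_convex fS (- p)) (S_rho fS) bp1 leN (- p).
by rewrite slope_ninftyE /reflected_slope opprK ltrNl.
Qed.

Lemma slope_gap_pinfty (p : R) : rho <= p ->
  cm / (betam - 1) * p `^ (1 - betam) <= slope_pinfty f - f^`()%classic p.
Proof.
exact: (slope_gap smooth_is_derive1 (S_convex fS) (S_rho fS) cm0 b1 bp1 ge_ le_).
Qed.

Lemma slope_gap_ninfty (p : R) : rho <= p ->
  cm / (betam - 1) * p `^ (1 - betam) <= f^`()%classic (- p) - slope_ninfty f.
Proof.
move=> rp.
have := slope_gap reflected_slope_derive (fun p => S_convex fS (- p)) (S_rho fS) cm0 b1 bp1 geN leN rp.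
by rewrite slope_ninftyE /reflected_slope; lra.
Qed.

(** The second derivative is continuous, hence attains its minimum on a segment. *)
Lemma min_f2P (c d : R) : c <= d -> 0 < min_f2 f `[c, d] /\
  forall p, c <= p <= d -> min_f2 f `[c, d] <= (f^`(2)) p.
Proof.
move=> cd; have [p0 p0cd p0min] := @EVT_min R (f^`(2)) c d cd
  (continuous_subspaceT derive2_continuous).
have lb : has_lbound [set (f^`(2)) p | p in `[c, d]].
  by exists 0 => _ [p _ <-]; exact/ltW/(S_convex fS).
split.
  apply: (lt_le_trans (S_convex fS p0)); apply: lb_le_inf.
    by exists ((f^`(2)) c), c => //=; rewrite in_itv/= lexx.
  by move=> _ [p /= pcd <-]; exact: p0min.
by move=> p pcd; apply: ge_inf => //; exists p => //=; rewrite in_itv.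
Qed.

End PhaseFacts.

(** * Norms of the amplitude *)

Section Norms.
Variable R : realType.
Local Notation mu := (@lebesgue_measure R).

Lemma cLnorm1E (A : set R) (g : R -> R[i]) : measurable A ->
  cLnorm 1%E A g = (\int[mu]_(x in A) (normc (g x))%:E)%E.
Proof.
move=> mA; rewrite /cLnorm Lnorm1 [RHS]integral_mkcond.
apply: eq_integral => x _; rewrite patchE; case: ifP => _; last by rewrite abse0.
by rewrite gee0_abs// lee_fin normc_ge0.
Qed.

Lemma L1_normE (A : set R) (g : R -> R[i]) : measurable A ->
  L1_norm A g = \int[mu]_(x in A) normc (g x).
Proof. by move=> mA; rewrite /L1_norm cLnorm1E. Qed.

Lemma clocally_integrable_itv (g : R -> R[i]) (c d : R) :
  clocally_integrable g -> cintegrable `[c, d] g.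
Proof.
move=> [[m1 _ i1] [m2 _ i2]]; split; apply/integrableP; split.
- by apply/measurable_EFinP; apply: measurable_funTS.
- by apply: i1 => //; exact: segment_compact.
- by apply/measurable_EFinP; apply: measurable_funTS.
- by apply: i2 => //; exact: segment_compact.
Qed.

(** Where the modulus exceeds the essential supremum it does so, by continuity, on
    a nonempty interval of [[c, d]], which is not negligible. *)
Lemma normc_le_Linf_norm (g : R -> R[i]) (c d B : R) : c < d ->
  continuous (re_part g) -> continuous (im_part g) ->
  (forall p, normc (g p) <= B) ->
  forall p, c <= p <= d -> normc (g p) <= Linf_norm `[c, d] g.
Proof.
move=> cd cre cim gB p /andP[cp pd]; rewrite leNgt; apply/negP => Lp.
have muT : (0 < mu [set: R])%E.
  apply: (@lt_le_trans _ _ (mu `[0, 1])).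
    by rewrite lebesgue_measure_itv/= lte_fin ltr01 oppr0 adde0 lte_fin.
  by apply: le_measure; rewrite ?inE.
pose h := (fun x => (normc (g x))%:E) \_ `[c, d].
have LE : cLnorm +oo%E `[c, d] g = ess_sup mu (abse \o h).
  by rewrite /cLnorm unlock muT.
have B0 : 0 <= B := le_trans (normc_ge0 _) (gB 0).
have LB : (cLnorm +oo%E `[c, d] g <= B%:E)%E.
  rewrite LE; apply/ess_supP; apply: aeW => x /=; rewrite /h patchE.
  by case: ifP => _; rewrite ?abse0 ?gee0_abs ?lee_fin ?normc_ge0 ?gB.
have L0 : (0 <= cLnorm +oo%E `[c, d] g)%E by exact: Lnorm_ge0.
have Lfin : cLnorm +oo%E `[c, d] g \is a fin_num.
  by rewrite ge0_fin_numE// (le_lt_trans LB)// ltry.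
have cg : normc (g x) @[x --> p] --> normc (g p).
  have c3 : (fun x => re_part g x ^+ 2 + im_part g x ^+ 2) @ p -->
      re_part g p ^+ 2 + im_part g p ^+ 2.
    by rewrite !expr2; under eq_fun do rewrite !expr2; apply: cvgD; apply: cvgM;
      (exact: cre || exact: cim).
  rewrite normcE_Re_Im; under eq_fun do rewrite normcE_Re_Im.
  by apply: continuous_cvg; [exact: sqrt_continuous|exact: c3].
have /nbhs_ballP[e /= e0 eL] : \forall x \near p, Linf_norm `[c, d] g < normc (g x).
  exact: cvgr_gt cg _ Lp.
pose c' := Num.max c (p - e); pose d' := Num.min d (p + e).
have cd' : c' < d'.
  rewrite /c' /d' lt_min !gt_max cd/= ltrBlDr.
  by apply/and3P; split; lra.
have [X [mX X0 XN]] := ess_sup_ge mu (abse \o h).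
have : (mu `]c', d'[ <= mu X)%E.
  apply: le_measure; rewrite ?inE// => x; rewrite /= in_itv/= => /andP[c'x xd'].
  apply: XN => /=; rewrite -LE -(fineK Lfin) /h patchE mem_set/=; last first.
    rewrite in_itv/=; move: c'x xd'; rewrite /c' /d' gt_max lt_min.
    by move=> /andP[/ltW -> _] /andP[/ltW -> _].
  rewrite lee_fin ger0_norm ?normc_ge0// => h1.
  have : Linf_norm `[c, d] g < normc (g x).
    apply: eL; rewrite /ball/= ltr_norml.
    move: c'x xd'; rewrite /c' /d' gt_max lt_min => /andP[_ h2] /andP[_ h3].
    by apply/andP; split; lra.
  by rewrite ltNge h1.
rewrite X0 lebesgue_measure_itv/= lte_fin cd'.
by rewrite leNgt -EFinD lte_fin subr_gt0 cd'.
Qed.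

End Norms.

(** * Pointwise estimates of the solution *)

Section Constants.
Variable R : realType.
Implicit Types mu alpha beta cm M t : R.

Let pi0 : 0 < pi :> R. Proof. exact: pi_gt0. Qed.

Let le_2powR (b : R) : 1 <= b -> 2 <= 2 `^ b :> R.
Proof. by move=> b1; rewrite le1r_powR// ler1n. Qed.

Let four_powR : 4 = 2 `^ 2 :> R.
Proof. rewrite powR_mulrn// expr2; ring. Qed.

Let le_powR2 (b c : R) : b <= c -> 2 `^ b <= 2 `^ c :> R.
Proof. by move=> bc; rewrite ler_powR// ler1n. Qed.

Let two_powRD (b c : R) : 2 `^ (b + c) = 2 `^ b * 2 `^ c :> R.
Proof. by rewrite powRD_gt0. Qed.

Lemma c1_terms_eq mu (A V m A' V' m' : R) : 0 < mu -> 0 < m -> 0 < m' ->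
  (2 * pi)^-1 * (3 / mu) * A + pi^-1 * (4 * A + V) * m^-1 +
  ((2 * pi)^-1 * (3 / mu) * A' + pi^-1 * (4 * A' + V') * m'^-1) =
  (2 * pi)^-1 * ((3 / mu * A' + 2 * (4 * A' + V') / m') +
    (3 / mu * A + 2 * (4 * A + V) / m)).
Proof. by move: pi pi0 => p p0 mu0 m0 m'0; field; rewrite !gt_eqF. Qed.

Lemma cc1_terms_eq mu (A V m A' V' m' : R) : 0 < mu -> 0 < m -> 0 < m' ->
  (2 * pi)^-1 * (1 / mu) * A + (2 * pi)^-1 * (4 * A + V) * m^-1 +
  ((2 * pi)^-1 * (1 / mu) * A' + (2 * pi)^-1 * (4 * A' + V') * m'^-1) =
  (2 * pi)^-1 * ((1 / mu * A' + (4 * A' + V') / m') +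
    (1 / mu * A + (4 * A + V) / m)).
Proof. by move: pi pi0 => p p0 mu0 m0 m'0; field; rewrite !gt_eqF. Qed.

(** The estimates of the previous part come with constants smaller than [c2] and
    [cc2]; only powers of 2 have to be compared. *)
Lemma c2_ge mu alpha beta cm M M' : mu <= 1 -> 1 < beta -> beta < alpha - mu ->
  0 < mu -> 0 < cm -> 0 <= M -> 0 <= M' ->
  pi^-1 * (2 * M * ((alpha - mu + 1) / (alpha - mu)) +
    2 * 2 `^ beta * (4 * M + M') / cm *
      ((alpha - mu - beta + 1) / (alpha - mu - beta)))
  <= c2 mu alpha beta cm M M'.
Proof.
move=> mu1 b1 ab mu0 cm0 M0 M'0.
rewrite /c2.
have -> : (alpha + 1 - mu) / (alpha - mu) = (alpha - mu + 1) / (alpha - mu).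
  by congr (_ / _); ring.
have -> : (alpha + 1 - mu - beta) / (alpha - mu - beta) =
    (alpha - mu - beta + 1) / (alpha - mu - beta) by congr (_ / _); ring.
have S10 : 0 <= (alpha - mu + 1) / (alpha - mu) by apply: divr_ge0; lra.
have S20 : 0 <= (alpha - mu - beta + 1) / (alpha - mu - beta) by apply: divr_ge0; lra.
move: (_ / (alpha - mu)) (_ / (alpha - mu - beta)) S10 S20 => S1 S2 S10 S20.
have -> : pi^-1 * (2 * M * S1 + 2 * 2 `^ beta * (4 * M + M') / cm * S2) =
    2 * M / pi * S1 + (2 `^ 1 * 2 `^ beta) * (4 * M + M') / (pi * cm) * S2.
  rewrite powRr1//; move: pi pi0 => p p0; field.
  by rewrite !gt_eqF.
have pc : 0 <= (pi * cm)^-1 by rewrite invr_ge0 mulr_ge0 ?(ltW cm0) ?(ltW pi0).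
apply: lerD; apply: ler_wpM2r => //.
  rewrite ler_wpM2r ?invr_ge0 ?(ltW pi0)// ler_wpM2r//.
  by apply: le_2powR; lra.
apply: ler_wpM2r => //; apply: ler_pM.
- by rewrite mulr_ge0 ?powR_ge0.
- by rewrite addr_ge0 ?mulr_ge0.
- by rewrite -two_powRD le_powR2//; lra.
- by rewrite lerD2r ler_wpM2r// four_powR le_powR2//; lra.
Qed.

Lemma cc2_ge mu alpha beta cm M M' : mu <= 1 -> 1 < beta -> beta < alpha - mu ->
  0 < mu -> 0 < cm -> 0 <= M -> 0 <= M' ->
  pi^-1 * (2 `^ (beta - 1) * (4 * M + M') * (beta - 1) / cm *
      ((alpha + 2 - mu - beta) / (alpha + 1 - mu - beta)))
  <= cc2 mu alpha beta cm M M'.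
Proof.
move=> mu1 b1 ab mu0 cm0 M0 M'0.
have S0 : 0 <= (alpha + 2 - mu - beta) / (alpha + 1 - mu - beta) by apply: divr_ge0; lra.
rewrite /cc2; move: (_ / (alpha + 1 - mu - beta)) S0 => S S0.
rewrite [leLHS]mulrA; apply: ler_wpM2r => //.
have -> : pi^-1 * (2 `^ (beta - 1) * (4 * M + M') * (beta - 1) / cm) =
    (beta - 1) / (pi * cm) * (2 `^ (beta - 1) * (4 * M + M')).
  by move: pi pi0 => p p0; field; rewrite !gt_eqF.
apply: ler_wpM2l; first by rewrite divr_ge0 ?mulr_ge0 ?(ltW cm0) ?(ltW pi0)//; lra.
have -> : 3 * 2 `^ (- mu + alpha + beta) * M + 2 `^ (- mu + beta) * (2 `^ alpha * M + M') =
    2 `^ (- mu + alpha + beta) * (4 * M) + 2 `^ (- mu + beta) * M'.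
  have -> : - mu + alpha + beta = (- mu + beta) + alpha by ring.
  by rewrite (two_powRD (- mu + beta)); ring.
rewrite mulrDr; apply: lerD; apply: ler_wpM2r; rewrite ?mulr_ge0//;
  by apply: le_powR2; lra.
Qed.

End Constants.

Section Estimates.
Variable R : realType.
Local Notation leb := (@lebesgue_measure R).
Variables (f : R -> R) (betap betam rho cp cm : R).
Variables (u0 : dist R) (mu alpha r : R) (ut : R -> R[i]) (M M' : R).
Hypothesis fS : condition_S f betap betam rho cp cm.
Hypothesis u0_C3 : condition_C3 u0 mu alpha r ut M M'.
Hypothesis alpha_mu : betam < alpha - mu.
Hypothesis r_rho : r <= rho.

Local Notation dut := (cderiv ut).
Let mu01 := C3_mu u0_C3.
Let mu0 : 0 < mu. Proof. by case/andP: mu01. Qed.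
Let mu1 : mu <= 1. Proof. by case/andP: mu01. Qed.
Let betam1 : 1 < betam.
Proof. by have /andP[h] := S_beta fS; exact: lt_le_trans. Qed.
Let cm0 : 0 < cm. Proof. by have /andP[] := S_c fS. Qed.
Let alpha0 : 0 < alpha. Proof. by move: mu0 betam1 alpha_mu; lra. Qed.

Lemma cutoff_nat : exists2 N : nat, cutoff rho = N%:R & (2 <= N)%N /\ rho <= N%:R.
Proof.
have c1 : (0 < Num.ceil rho)%R.
  by rewrite -(ltr_int R) (lt_le_trans _ (ceil_ge _))// (lt_le_trans ltr01 (S_rho fS)).
have [k ck] : exists k : nat, Num.ceil rho = Posz k.
  by exists (absz (Num.ceil rho)); rewrite gez0_abs// ltW.
exists k.+1; first by rewrite /cutoff ck intrD -natr1.
split; first by move: c1; rewrite ck.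
by rewrite (le_trans (ceil_ge _))// ck -natr1 -pmulrn lerDl.
Qed.

Let utd (p : R) : is_cderive ut p (dut p).
Proof. by apply: cderivableP; exact: (C3_derivable u0_C3). Qed.

Let duti (c d : R) : cintegrable `[c, d] dut.
Proof. by apply: clocally_integrable_itv; exact: (C3_locint u0_C3). Qed.

Let reut_continuous : continuous (re_part ut).
Proof. by move=> p; have [] := is_cderive_continuous (utd p). Qed.

Let imut_continuous : continuous (im_part ut).
Proof. by move=> p; have [] := is_cderive_continuous (utd p). Qed.

Lemma ut_decay (p : R) : 0 < `|p| -> normc (ut p) <= M * `|p| `^ (- alpha).
Proof.
move=> p0; apply: (le_trans (C3_decay u0_C3 p)); rewrite ler_wpM2l ?(C3_M u0_C3)//.
apply: (@le_trans _ _ ((p ^+ 2) `^ (- (alpha / 2)))).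
  apply: le_powR_npos; last by rewrite lerDr.
    by rewrite oppr_le0 divr_ge0// ltW.
  by rewrite -real_normK ?num_real// exprn_gt0.
rewrite -real_normK ?num_real// -powR_mulrn// -powRrM.
by rewrite le_eqVlt; apply/orP; left; apply/eqP; congr (_ `^ _); field.
Qed.

Lemma dut_decay (k : int) : rho <= `|k%:~R| -> k != 0 ->
  \int[leb]_(p in `[k%:~R, (k + 1)%:~R]) normc (dut p) <= M' * `|k%:~R| `^ (- alpha).
Proof.
move=> rk k0; have := C3_deriv_decay u0_C3 (le_trans r_rho rk) k0.
rewrite cLnorm1E//; have kk : (k%:~R : R) < (k + 1)%:~R by rewrite ltr_int ltzD1.
have di : leb.-integrable `[k%:~R, (k + 1)%:~R] (EFin \o (fun p => normc (dut p))).
  by apply: integrable_normc => //; exact: duti.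
rewrite -lee_fin /Rintegral fineK; last exact: integrable_fin_num.
pose J : set R := `[k%:~R, (k + 1)%:~R].
have mdi : measurable_fun J (fun p => (normc (dut p))%:E).
  by case/integrableP : di.
rewrite -(@integral_itv_obnd_cbnd _ _ (BRight (k + 1)%:~R)); last first.
  by apply: measurable_funS mdi; [exact: measurable_itv|apply: subset_itvr; rewrite bnd_simp].
rewrite -(@integral_itv_bndo_bndc _ (BRight k%:~R)) //.
by apply: measurable_funS mdi; [exact: measurable_itv|apply: subset_itv; rewrite bnd_simp].
Qed.

(** Integrability at 0 comes from [0 < mu], at infinity from [mu < alpha]. *)
Lemma osc_halfline_integrable (v : R -> R[i]) (dv : R -> R[i]) (th dth : R -> R) (B : R) :
  (forall p : R, is_cderive v p (dv p)) -> (forall p : R, is_derive p 1 th (dth p)) ->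
  (forall p, normc (v p) <= B) ->
  (forall p : R, 0 < p -> normc (v p) <= M * p `^ (- alpha)) ->
  cintegrable `[0, +oo[ (osc v th mu).
Proof.
move=> vd thd vB vM; have B0 := le_trans (normc_ge0 _) (vB 0).
have cv : continuous (re_part v) /\ continuous (im_part v).
  by split=> p; have [] := is_cderive_continuous (vd p).
have mosc : cmeasurable setT (osc v th mu).
  apply: cmeasurableM; first apply: cmeasurableM.
  - by apply: cmeasurable_real; exact: measurable_powR.
  - by split; apply: continuous_measurable_fun; case: cv.
  - apply: cmeasurable_expi; apply: continuous_measurable_fun => p.
    by apply/differentiable_continuous/derivable1_diffP; have [] := thd p.
have oi n : cintegrable `[0, n%:R] (osc v th mu).
  by apply: (osc_integrable mu01 vd thd (lexx _) (A := B)).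
have M0 := C3_M u0_C3.
have s0 : 0 < alpha - mu by move: betam1 alpha_mu; lra.
have [hi _] : leb.-integrable `[0, +oo[ (EFin \o (fun p => normc (osc v th mu p))) /\
    \int[leb]_(p in `[0, +oo[) normc (osc v th mu p) <= B * (1 `^ mu / mu) + M / (alpha - mu).
  apply: integrable_halfline.
  - exact: measurable_normc.
  - by move=> p _; exact: normc_ge0.
  - move=> n; have ni : leb.-integrable `[0, n%:R] (EFin \o (fun p => normc (osc v th mu p))).
      by apply: integrable_normc => //; exact: oi.
    split=> //; case: n ni => [|n] ni.
      rewrite set_itv1 Rintegral_set1 addr_ge0 ?divr_ge0 ?mulr_ge0 ?powR_ge0 ?invr_ge0// ltW//.
    have n1 : 1 <= n.+1%:R :> R by rewrite ler1n.
    rewrite (Rintegral_itv_cat ler01 n1 ni); apply: lerD.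
      have [pi pint] := Rintegral_powR0 mu0 (ler01 : 0 <= 1 :> R).
      apply: (@le_trans _ _ (\int[leb]_(p in `[0, 1]) (B * p `^ (mu - 1)))).
        apply: le_Rintegral => //.
        - by apply: integrableS ni => //; apply: subset_itvl; rewrite bnd_simp.
        - exact: integrable_EFinZl.
        - by move=> p _; rewrite normc_osc// mulrC ler_wpM2r ?powR_ge0.
      by rewrite RintegralZl// ler_wpM2l.
    have pi := integrable_powR (mu - alpha - 1) (n.+1%:R : R) ltr01.
    apply: (@le_trans _ _ (\int[leb]_(p in `[1, n.+1%:R]) (M * p `^ (mu - alpha - 1)))).
      apply: le_Rintegral => //.
      - by apply: integrableS ni => //; apply: subset_itvr; rewrite bnd_simp.
      - exact: integrable_EFinZl.
      - move=> p; rewrite /= in_itv/= => /andP[p1 _].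
        have p0 : 0 < p := lt_le_trans ltr01 p1.
        rewrite normc_osc//.
        have -> : mu - alpha - 1 = - alpha + (mu - 1) by ring.
        by rewrite (powRD_gt0 (- alpha) (mu - 1))// mulrA [leRHS]mulrC ler_wpM2l ?powR_ge0 ?vM.
    rewrite RintegralZl// ler_wpM2l//.
    have := Rintegral_powR (mu - alpha) ltr01 n1.
    rewrite RintegralZl// powR1 => e.
    have := powR_ge0 (n.+1%:R : R) (mu - alpha).
    move=> P0; rewrite -[leRHS]mul1r ler_pdivlMr//; move: P0.
    by move: e; lra.
apply: (le_cintegrable _ _ hi) => //.
by apply: cmeasurableS mosc.
Qed.

Let utN (p : R) := ut (- p).
Let dutN (p : R) := - dut (- p).
Let fN (p : R) := f (- p).

Let utNd (p : R) : is_cderive utN p (dutN p).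
Proof.
apply: (is_cderive_eq (is_cderive_comp (utd (- p)) (is_derive_opp p))).
by apply: complex_ext; rewrite !ReImE /=; ring.
Qed.

Let dutNi (c d : R) : cintegrable `[c, d] dutN.
Proof.
have := (@cintegrable_opp _ `[- d, - c] _ (measurable_itv _) (duti (- d) (- c))).1.
have -> : [set x : R | `[- d, - c]%classic (- x)] = `[c, d].
  by apply/seteqP; split => x /=; rewrite !in_itv/= !lerN2 andbC.
exact: cintegrableN.
Qed.

Let Rintegral_dutN (c d : R) :
  \int[leb]_(p in `[c, d]) normc (dutN p) = \int[leb]_(p in `[- d, - c]) normc (dut p).
Proof.
have di : leb.-integrable `[- d, - c] (EFin \o (fun p => normc (dut p))).
  by apply: integrable_normc => //; exact: duti.
have [_ ->] := @integrable_opp _ `[- d, - c] _ (measurable_itv _) di.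
have -> : [set x : R | `[- d, - c]%classic (- x)] = `[c, d].
  by apply/seteqP; split => x /=; rewrite !in_itv/= !lerN2 andbC.
by apply: eq_Rintegral => p _; rewrite /dutN normcN.
Qed.

Let fNd (p : R) : is_derive p 1 fN (reflected_slope f p).
Proof.
apply: (is_derive1_eq (is_derive1_comp (smooth_is_derive0 fS (- p)) (is_derive_opp p))).
by rewrite mulrN1.
Qed.

Let utB : exists B, forall p, normc (ut p) <= B := C3_bounded u0_C3.

Let phase t x (p : R) := x * p - t * f p.
Let phaseN t x (p : R) := - x * p - t * fN p.

Let phased t x (p : R) : exists l, is_derive p 1 (phase t x) l.
Proof.
have h := is_derive1M (is_derive_cst t p 1) (smooth_is_derive0 fS p).
by eexists; exact: (is_derive1B (is_derive1M (is_derive_cst x p 1) (is_derive_id p 1)) h).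
Qed.

Let phaseNd t x (p : R) : exists l, is_derive p 1 (phaseN t x) l.
Proof.
have h := is_derive1M (is_derive_cst t p 1) (fNd p).
by eexists; exact: (is_derive1B (is_derive1M (is_derive_cst (- x) p 1) (is_derive_id p 1)) h).
Qed.

Let osc_integrable t x : cintegrable `[0, +oo[ (osc ut (phase t x) mu).
Proof.
have [B utB'] := utB; have /choice[dth thd] := phased t x.
apply: (osc_halfline_integrable utd thd utB') => p p0.
by have := @ut_decay p; rewrite gtr0_norm//; exact.
Qed.

Let oscN_integrable t x : cintegrable `[0, +oo[ (osc utN (phaseN t x) mu).
Proof.
have [B utB'] := utB; have /choice[dth thd] := phaseNd t x.
apply: (osc_halfline_integrable utNd thd (fun p => utB' (- p))) => p p0.
by have := @ut_decay (- p); rewrite normrN gtr0_norm//; exact.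
Qed.

Let integrand t x (p : R) := amplitude mu ut p * expi (- (t * f p) + x * p).

Let integrandE t x (p : R) : 0 <= p -> integrand t x p = osc ut (phase t x) mu p.
Proof. by move=> p0; rewrite /integrand /amplitude /osc ger0_norm// [- (t * _) + _]addrC. Qed.

Let integrandNE t x (p : R) : 0 <= p -> integrand t x (- p) = osc utN (phaseN t x) mu p.
Proof.
move=> p0; rewrite /integrand /amplitude /osc normrN ger0_norm//.
rewrite [- (t * _) + _]addrC; by rewrite /phaseN mulrN mulNr.
Qed.

Lemma solution_integrable t x : cintegrable setT (integrand t x) /\
  cintegral setT (integrand t x) =
    cintegral `[0, +oo[ (osc ut (phase t x) mu) +
    cintegral `[0, +oo[ (osc utN (phaseN t x) mu).
Proof.
have e1 : {in `[0, +oo[, osc ut (phase t x) mu =1 integrand t x}.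
  by move=> p; rewrite inE/= in_itv/= andbT => p0; rewrite integrandE.
have e2 : {in `[0, +oo[, osc utN (phaseN t x) mu =1 (fun p => integrand t x (- p))}.
  by move=> p; rewrite inE/= in_itv/= andbT => p0; rewrite integrandNE.
have i1 := eq_cintegrable (measurable_itv _) e1 (osc_integrable t x).
have i2 := eq_cintegrable (measurable_itv _) e2 (oscN_integrable t x).
have [i ->] := cintegral_line i1 i2.
split; first exact: i.
by rewrite (eq_cintegral e1) (eq_cintegral e2).
Qed.

Lemma normc_solution_le t x :
  normc (solution_fun f mu ut t x) <= (2 * pi)^-1 *
    (normc (cintegral `[0, +oo[ (osc ut (phase t x) mu)) +
     normc (cintegral `[0, +oo[ (osc utN (phaseN t x) mu))).
Proof.
rewrite /solution_fun normcM normc_real ger0_norm; last first.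
  by rewrite invr_ge0 mulr_ge0// pi_ge0.
rewrite ler_wpM2l ?invr_ge0 ?mulr_ge0 ?pi_ge0//.
have [_ e] := solution_integrable t x.
by rewrite -/(integrand t x) e le_normcD.
Qed.

Let N := sval (cid2 cutoff_nat).
Let cutE : cutoff rho = N%:R. Proof. exact: (s2valP (cid2 cutoff_nat)). Qed.
Let N2 : (2 <= N)%N. Proof. by have [] := s2valP' (cid2 cutoff_nat). Qed.
Let rhoN : rho <= N%:R. Proof. by have [] := s2valP' (cid2 cutoff_nat). Qed.

Let Ap := Linf_norm (Jplus rho) ut.
Let Am := Linf_norm (Jminus rho) ut.
Let Vp := L1_norm (Jplus rho) dut.
Let Vm := L1_norm (Jminus rho) dut.

Let N0 : 0 < N%:R :> R. Proof. by rewrite ltr0n (leq_trans _ N2). Qed.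

Let utAp p : 0 <= p <= N%:R -> normc (ut p) <= Ap.
Proof.
have [B utB'] := utB; rewrite /Ap /Jplus cutE => h.
exact: (normc_le_Linf_norm N0 reut_continuous imut_continuous utB').
Qed.

Let utAm p : 0 <= p <= N%:R -> normc (utN p) <= Am.
Proof.
have [B utB'] := utB; rewrite /Am /Jminus cutE => /andP[p0 pN].
apply: (normc_le_Linf_norm _ reut_continuous imut_continuous utB').
  by rewrite oppr_lt0.
by rewrite lerN2 pN oppr_le0.
Qed.

Let dutVp : \int[leb]_(p in `[0, N%:R]) normc (dut p) <= Vp.
Proof. by rewrite /Vp /Jplus cutE L1_normE. Qed.

Let dutVm : \int[leb]_(p in `[0, N%:R]) normc (dutN p) <= Vm.
Proof. by rewrite /Vm /Jminus cutE L1_normE// Rintegral_dutN oppr0. Qed.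

Let utMp (p : R) : N%:R <= p -> normc (ut p) <= M * p `^ (- alpha).
Proof.
by move=> Np; have p0 := lt_le_trans N0 Np; have := @ut_decay p; rewrite gtr0_norm//; exact.
Qed.

Let utMm (p : R) : N%:R <= p -> normc (utN p) <= M * p `^ (- alpha).
Proof.
move=> Np; have p0 := lt_le_trans N0 Np.
by have := @ut_decay (- p); rewrite normrN gtr0_norm//; exact.
Qed.

Let dutMp (n : nat) : (N <= n)%N ->
  \int[leb]_(p in `[n%:R, n.+1%:R]) normc (dut p) <= M' * n%:R `^ (- alpha).
Proof.
move=> Nn; have n0 : (0 < n)%N by rewrite (leq_trans _ Nn)// (leq_trans _ N2).
have := @dut_decay n; rewrite intrD -pmulrn natr1 ger0_norm ?ler0n//; apply.
  by rewrite (le_trans rhoN)// ler_nat.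
by rewrite -lt0n.
Qed.

(** On the negative half-line the piece [[- n.+1, - n]] is indexed by its
    endpoint of largest modulus, hence decays slightly faster than required. *)
Let dutMm (n : nat) : (N <= n)%N ->
  \int[leb]_(p in `[n%:R, n.+1%:R]) normc (dutN p) <= M' * n%:R `^ (- alpha).
Proof.
move=> Nn; rewrite Rintegral_dutN.
have n0 : 0 < n%:R :> R by rewrite ltr0n (leq_trans _ Nn)// (leq_trans _ N2).
have := @dut_decay (- n.+1%:Z).
have -> : (- n.+1%:Z + 1)%:~R = - n%:R :> R.
  by rewrite intrD mulrNz -pmulrn -natr1; ring.
rewrite mulrNz -pmulrn normrN ger0_norm ?ler0n// => h.
apply: (le_trans (h _ _)) => //.
  by rewrite (le_trans rhoN)// ler_nat leqW.
rewrite ler_wpM2l ?(C3_M' u0_C3)//; apply: le_powR_npos => //.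
  by rewrite oppr_le0 ltW.
by rewrite ler_nat.
Qed.

Let f2p (p : R) : N%:R <= p -> cm * p `^ (- betam) <= (f^`(2)) p.
Proof.
move=> Np; have p0 := lt_le_trans N0 Np.
have := S_bounds fS (p := p); rewrite gtr0_norm// => h.
by have /andP[] := h (le_trans rhoN Np).
Qed.

Let f2m (p : R) : N%:R <= p -> cm * p `^ (- betam) <= (f^`(2)) (- p).
Proof.
move=> Np; have p0 := lt_le_trans N0 Np.
have := S_bounds fS (p := - p); rewrite normrN gtr0_norm// => h.
by have /andP[] := h (le_trans rhoN Np).
Qed.

Let cf2N : continuous (fun p : R => (f^`(2)) (- p)).
Proof.
move=> p; apply: (@continuous_comp _ _ _ (fun p : R => - p) (f^`(2))).
  exact: opp_continuous.
exact: (derive2_continuous fS).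
Qed.

Let mp := min_f2 f (Jplus rho).
Let mm := min_f2 f (Jminus rho).

Lemma min_f2_Jplus : 0 < mp /\ forall p, 0 <= p <= N%:R -> mp <= (f^`(2)) p.
Proof. by rewrite /mp /Jplus cutE; apply: (min_f2P fS); exact: ltW. Qed.

Lemma min_f2_Jminus : 0 < mm /\ forall p, 0 <= p <= N%:R -> mm <= (f^`(2)) (- p).
Proof.
rewrite /mm /Jminus cutE; have [|m0 mP] := min_f2P fS (c := - N%:R) (d := 0).
  by rewrite oppr_le0 ltW.
by split => // p /andP[p0 pN]; apply: mP; rewrite lerN2 pN oppr_le0.
Qed.

Lemma mtilde_gt0 : 0 < mtilde_minus f rho /\ 0 < mtilde_plus f rho.
Proof.
rewrite /mtilde_minus /mtilde_plus !lt_min !subr_gt0.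
by rewrite !(slope_lt_pinfty fS) !(slope_gt_ninfty fS).
Qed.

(** Inside the cone [x / t] is a value of [f'], which is continuous and tends
    to the endpoints of the cone. *)
Lemma cone_stationary_point (y : R) : slope_ninfty f < y < slope_pinfty f ->
  exists p0, f^`()%classic p0 = y.
Proof.
move=> /andP[ya yb].
have [p1 py1] : exists p1, f^`()%classic p1 < y.
  have : \forall p \near -oo, f^`()%classic p < y.
    by apply: cvgr_lt ya; exact: slope_ninfty_cvg fS.
  by move=> [B [_ hB]]; exists (B - 1); apply: hB; rewrite ltrBlDr ltrDl.
have [p2 py2] : exists p2, y < f^`()%classic p2.
  have : \forall p \near +oo, y < f^`()%classic p.
    by apply: cvgr_gt yb; exact: slope_pinfty_cvg fS.
  by move=> [B [_ hB]]; exists (B + 1); apply: hB; rewrite ltrDl.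
have p12 : p1 <= p2.
  rewrite leNgt; apply/negP => /(slope_lt fS) h.
  by have := lt_trans (lt_trans py1 py2) h; rewrite ltxx.
have yb' : Num.min (f^`()%classic p1) (f^`()%classic p2) <= y <=
    Num.max (f^`()%classic p1) (f^`()%classic p2).
  by rewrite ge_min (ltW py1)/= le_max (ltW py2) orbT.
have [c _ <-] := IVT p12
  (derive_within_continuous (fun q _ => smooth_is_derive1 fS q)) yb'.
by exists c.
Qed.

Let pi0 : 0 < pi :> R. Proof. exact: pi_gt0. Qed.

(** On the negative half-line [p] is replaced by [- p]: the phase becomes that of
    the reflected function [p |-> f (- p)] at the point [- x]. *)
Lemma solution_cone_le t x : cone f (t, x) ->
  normc (solution_fun f mu ut t x)
    <= c1 f mu ut rho * t `^ (- (mu / 2))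
       + c2 mu alpha betam cm M M' * t `^ (- (1 / 2)).
Proof.
move=> [/= t0 xt]; have [p0 p0E] := cone_stationary_point xt.
have xE : x = t * f^`()%classic p0 by rewrite p0E mulrCA divff ?mulr1// gt_eqF.
have xNE : - x = t * reflected_slope f (- p0) by rewrite /reflected_slope opprK mulrN -xE.
have [mp0 mpP] := min_f2_Jplus; have [mm0 mmP] := min_f2_Jminus.
have hp := halfline_stationary_le mu01 utd duti (smooth_is_derive0 fS) (smooth_is_derive1 fS)
  (derive2_continuous fS) (S_convex fS) N2 utAp dutVp (C3_M u0_C3) (C3_M' u0_C3)
  utMp dutMp cm0 f2p betam1 alpha_mu t0 (osc_integrable t x) mp0 mpP xE.
have hm := halfline_stationary_le mu01 utNd dutNi fNd (reflected_slope_derive fS)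
  cf2N (fun p => S_convex fS (- p)) N2 utAm dutVm (C3_M u0_C3) (C3_M' u0_C3)
  utMm dutMm cm0 f2m betam1 alpha_mu t0 (oscN_integrable t x) mm0 mmP xNE.
apply: (le_trans (normc_solution_le t x)).
apply: (le_trans (ler_wpM2l _ (lerD hp hm))).
  by rewrite invr_ge0 mulr_ge0// ltW.
have := c1_terms_eq Am Vm Ap Vp mu0 mm0 mp0; rewrite -/(c1 f mu ut rho).
have := c2_ge mu1 betam1 alpha_mu mu0 cm0 (C3_M u0_C3) (C3_M' u0_C3).
set c2_ := c2 _ _ _ _ _ _; set S := (X in pi^-1 * X).
have := powR_ge0 t (- (1 / 2)).
move: (c1 f mu ut rho) (t `^ (- (mu / 2))) (t `^ (- (1 / 2))) => c X Y Y0 S_le ->.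
have := ler_wpM2r Y0 S_le.
move: (3 / mu * Ap + _) (3 / mu * Am + _) => P1 P2 h.
apply: le_trans (lerD (lexx _) h).
suff : (2 * pi)^-1 * (P1 * X + S * Y + (P2 * X + S * Y)) <=
    (2 * pi)^-1 * (P1 + P2) * X + pi^-1 * S * Y by [].
rewrite le_eqVlt; apply/orP; left; apply/eqP; move: S {S_le h} => S.
by move: pi pi0 => q q0; field; rewrite gt_eqF.
Qed.

Lemma solution_cone_compl_le t x : cone_compl f (t, x) ->
  normc (solution_fun f mu ut t x)
    <= cc1 f mu ut rho * t `^ (- mu) + cc2 mu alpha betam cm M M' * t^-1.
Proof.
move=> [/= t0 xt].
have xab : t * slope_pinfty f <= x \/ x <= t * slope_ninfty f.
  have [|xa] := leP x (t * slope_ninfty f); first by right.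
  left; rewrite leNgt; apply/negP => xb; apply: xt; split => //=.
  by rewrite ltr_pdivlMr// ltr_pdivrMr// ![_ * t]mulrC xa.
have [mtm0 mtp0] := mtilde_gt0.
set mtm := mtilde_minus f rho in mtm0 *; set mtp := mtilde_plus f rho in mtp0 *.
have hp := halfline_away_le mu01 utd duti (smooth_is_derive0 fS) (smooth_is_derive1 fS)
  (derive2_continuous fS) (S_convex fS) N2 utAp dutVp (C3_M u0_C3) (C3_M' u0_C3)
  utMp dutMp cm0 betam1 alpha_mu t0 (osc_integrable t x)
  (aa := slope_ninfty f) (b := slope_pinfty f) mtp0.
have {}hp := hp _ _ _ _ xab.
have hm := halfline_away_le mu01 utNd dutNi fNd (reflected_slope_derive fS)
  cf2N (fun p => S_convex fS (- p)) N2 utAm dutVm (C3_M u0_C3) (C3_M' u0_C3)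
  utMm dutMm cm0 betam1 alpha_mu t0 (oscN_integrable t x)
  (aa := - slope_pinfty f) (b := - slope_ninfty f) mtm0.
have xab' : t * - slope_ninfty f <= - x \/ - x <= t * - slope_pinfty f.
  by rewrite !mulrN !lerN2; case: xab; [right|left].
have {}hm := hm _ _ _ _ xab'.
have slope_opp (p : R) : N%:R <= p -> f^`()%classic (- p) <= f^`()%classic p.
  by move=> Np; apply/ltW/(slope_lt fS); have := lt_le_trans N0 Np; lra.
apply: (le_trans (normc_solution_le t x)).
apply: (le_trans (ler_wpM2l _ (lerD (hp _ _ _ _) (hm _ _ _ _)))).
- by rewrite invr_ge0 mulr_ge0// ltW.
- by rewrite /mtp /mtilde_plus ge_min lexx.
- by rewrite /mtp /mtilde_plus cutE ge_min lexx orbT.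
- by move=> p Np; apply: (slope_gap_pinfty fS); exact: le_trans rhoN Np.
- move=> p Np; apply: (le_trans (slope_gap_ninfty fS (le_trans rhoN Np))).
  by rewrite lerD2r slope_opp.
- by rewrite [leRHS]addrC /mtm /mtilde_minus /reflected_slope oppr0 opprK ge_min lexx orbT.
- by rewrite [leRHS]addrC /mtm /mtilde_minus /reflected_slope cutE !opprK ge_min lexx.
- move=> p Np; apply: (le_trans (slope_gap_ninfty fS (le_trans rhoN Np))).
  by rewrite /reflected_slope opprK addrC.
- move=> p Np; apply: (le_trans (slope_gap_pinfty fS (le_trans rhoN Np))).
  by rewrite /reflected_slope opprK [leRHS]addrC lerD2l lerN2 slope_opp.
have := cc1_terms_eq Am Vm Ap Vp mu0 mtm0 mtp0; rewrite -/(cc1 f mu ut rho).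
have := cc2_ge mu1 betam1 alpha_mu mu0 cm0 (C3_M u0_C3) (C3_M' u0_C3).
set cc2_ := cc2 _ _ _ _ _ _; set S := (X in pi^-1 * X).
have : 0 <= t^-1 by rewrite invr_ge0 ltW.
move: (cc1 f mu ut rho) (t `^ (- mu)) (t^-1) => c X Y Y0 S_le ->.
have := ler_wpM2r Y0 S_le.
move: (1 / mu * Ap + _) (1 / mu * Am + _) => P1 P2 h.
apply: le_trans (lerD (lexx _) h).
suff : (2 * pi)^-1 * (P1 * X + S * Y + (P2 * X + S * Y)) <=
    (2 * pi)^-1 * (P1 + P2) * X + pi^-1 * S * Y by [].
rewrite le_eqVlt; apply/orP; left; apply/eqP; move: S {S_le h} => S.
by move: pi pi0 => q q0; field; rewrite gt_eqF.
Qed.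

End Estimates.

(** * Bounded families of Schwartz functions *)

Section Families.
Variable R : realType.
Variable I : Type.
Implicit Types (A B F G : I -> R -> R[i]) (P Q S : (I -> R -> R[i]) -> Prop).

(** Schwartz functions are handled through families, because the time derivative
    of a propagated test function has to be controlled uniformly in the time. *)
Definition uniformly_rapid F := forall k : nat, exists C : R,
  forall i x, (1 + `|x|) ^+ k * normc (F i x) <= C.

Definition uniformly_poly F := exists (C : R) (k : nat),
  forall i x, normc (F i x) <= C * (1 + `|x|) ^+ k.

(** [P] holds for the derivatives of order at most [n]. The recursion on the order
    makes the product rule an induction, without binomial sums. *)
Fixpoint derivs P (n : nat) F : Prop := P F /\
  if n is n'.+1 then (forall i x, cderivable (F i) x) /\
    derivs P n' (fun i => cderiv (F i)) else True.

Lemma derivs0 P n F : derivs P n F -> P F.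
Proof. by case: n => [|n] []. Qed.

Lemma derivs_le P m n F : (m <= n)%N -> derivs P n F -> derivs P m F.
Proof.
elim: m n F => [|m ih] n F; first by move=> _ /derivs0.
by case: n => // n; rewrite ltnS => mn [PF [dF h]]; split => //; split => //; exact: ih h.
Qed.

Lemma derivsS P n F : derivs P n.+1 F -> derivs P n F.
Proof. by apply: derivs_le. Qed.

Lemma derivs_intro P n F F' : P F -> (forall i x, is_cderive (F i) x (F' i x)) ->
  derivs P n F' -> derivs P n.+1 F.
Proof.
move=> PF dF dF'; split => //; split; first by move=> i x; have /is_cderiveP[] := dF i x.
rewrite (_ : (fun i => cderiv (F i)) = F')//.
by apply/funext => i; apply/funext => x; have /is_cderiveP[] := dF i x.
Qed.

Lemma derivsD P : (forall A B, P A -> P B -> P (fun i x => A i x + B i x)) ->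
  forall n A B, derivs P n A -> derivs P n B -> derivs P n (fun i x => A i x + B i x).
Proof.
move=> PD; elim=> [|n ih] A B; first by move=> [PA _] [PB _]; split => //; exact: PD.
move=> [PA [dA hA]] [PB [dB hB]].
apply: (@derivs_intro _ _ _ (fun i x => cderiv (A i) x + cderiv (B i) x)).
- exact: PD.
- by move=> i x; apply: is_cderiveD; exact: cderivableP.
- exact: ih.
Qed.

Lemma derivsM P Q S : (forall A B, S A -> S B -> S (fun i x => A i x + B i x)) ->
  (forall A B, P A -> Q B -> S (fun i x => A i x * B i x)) ->
  forall n A B, derivs P n A -> derivs Q n B -> derivs S n (fun i x => A i x * B i x).
Proof.
move=> SD PQ; elim=> [|n ih] A B; first by move=> [PA _] [QB _]; split => //; exact: PQ.
move=> hA hB; have [PA [dA hA']] := hA; have [QB [dB hB']] := hB.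
apply: (@derivs_intro _ _ _ (fun i x => cderiv (A i) x * B i x + A i x * cderiv (B i) x)).
- exact: PQ.
- by move=> i x; apply: is_cderiveM; exact: cderivableP.
- by apply: derivsD => //; apply: ih => //; exact: derivsS.
Qed.

Lemma uniformly_rapidD A B : uniformly_rapid A -> uniformly_rapid B ->
  uniformly_rapid (fun i x => A i x + B i x).
Proof.
move=> hA hB k; have [C hC] := hA k; have [D hD] := hB k; exists (C + D) => i x.
by apply: (le_trans _ (lerD (hC i x) (hD i x))); rewrite -mulrDr ler_wpM2l ?le_normcD//.
Qed.

Lemma one_normr_ge1 (x : R) : 1 <= 1 + `|x|.
Proof. by rewrite lerDl. Qed.

Lemma one_normr_ge0 (x : R) : 0 <= 1 + `|x|.
Proof. exact: le_trans (one_normr_ge1 x). Qed.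

Lemma uniformly_polyP F : uniformly_poly F -> exists2 C : R, 0 <= C & exists k : nat,
  forall i x, normc (F i x) <= C * (1 + `|x|) ^+ k.
Proof.
move=> [C [k h]]; exists `|C| => //; exists k => i x; apply: (le_trans (h i x)).
by rewrite ler_wpM2r ?ler_norm// exprn_ge0// one_normr_ge0.
Qed.

Lemma uniformly_polyD A B : uniformly_poly A -> uniformly_poly B ->
  uniformly_poly (fun i x => A i x + B i x).
Proof.
move=> /uniformly_polyP[C C0 [k hk]] /uniformly_polyP[D D0 [l hl]].
exists (C + D), (k + l)%N => i x; apply: (le_trans (le_normcD _ _)); rewrite mulrDl.
apply: lerD.
  apply: (le_trans (hk i x)); rewrite ler_wpM2l// ler_weXn2l ?one_normr_ge1//; exact: leq_addr.
apply: (le_trans (hl i x)); rewrite ler_wpM2l// ler_weXn2l ?one_normr_ge1//; exact: leq_addl.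
Qed.

Lemma uniformly_polyM A B : uniformly_poly A -> uniformly_poly B ->
  uniformly_poly (fun i x => A i x * B i x).
Proof.
move=> /uniformly_polyP[C C0 [k hk]] /uniformly_polyP[D D0 [l hl]].
exists (C * D), (k + l)%N => i x; rewrite normcM exprD mulrACA.
by apply: ler_pM; rewrite ?normc_ge0.
Qed.

Lemma uniformly_poly_rapidM A B : uniformly_poly A -> uniformly_rapid B ->
  uniformly_rapid (fun i x => A i x * B i x).
Proof.
move=> /uniformly_polyP[C C0 [k hk]] hB l; have [D hD] := hB (k + l)%N.
exists (C * D) => i x; apply: (@le_trans _ _ (C * ((1 + `|x|) ^+ (k + l) * normc (B i x)))).
  have w0 : 0 <= (1 + `|x|) ^+ l * normc (B i x).
    by rewrite mulr_ge0 ?normc_ge0// exprn_ge0// one_normr_ge0.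
  have := ler_wpM2r w0 (hk i x).
  by rewrite normcM exprD mulrCA -!mulrA.
by rewrite ler_wpM2l.
Qed.

Definition poly_family F := forall n, derivs uniformly_poly n F.
Definition rapid_family F := forall n, derivs uniformly_rapid n F.

Lemma poly_familyM A B : poly_family A -> poly_family B ->
  poly_family (fun i x => A i x * B i x).
Proof.
move=> hA hB n; apply: (derivsM uniformly_polyD uniformly_polyM); [exact: hA|exact: hB].
Qed.

Lemma poly_rapidM A B : poly_family A -> rapid_family B ->
  rapid_family (fun i x => A i x * B i x).
Proof.
move=> hA hB n; apply: (derivsM uniformly_rapidD uniformly_poly_rapidM); [exact: hA|exact: hB].
Qed.

Lemma poly_family_intro A A' : uniformly_poly A ->
  (forall i x, is_cderive (A i) x (A' i x)) -> poly_family A' -> poly_family A.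
Proof.
by move=> A0 dA hA' [|n]; [split|exact: (derivs_intro A0 dA (hA' n))].
Qed.

Lemma rapid_derive A : rapid_family A -> rapid_family (fun i => cderiv (A i)).
Proof. by move=> hA n; have [_ []] := hA n.+1. Qed.

Lemma rapid_cderive A : rapid_family A -> forall i x, is_cderive (A i) x (cderiv (A i) x).
Proof. by move=> /(_ 1%N)[_ [dA _]] i x; exact: cderivableP. Qed.

Lemma rapid_decay A : rapid_family A -> uniformly_rapid A.
Proof. by move=> /(_ 0%N)[]. Qed.

Lemma poly_family_cst (c : I -> R[i]) (C : R) : (forall i, normc (c i) <= C) ->
  poly_family (fun i _ => c i).
Proof.
move=> cC; apply: (@poly_family_intro _ (fun _ _ => 0)).
- by exists C, 0%N => i x; rewrite expr0 mulr1.
- by move=> i x; exact: is_cderive_cst.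
- elim=> [|n ih].
    by split => //; exists 0, 0%N => i x; rewrite mul0r normc_real normr0.
  apply: derivs_intro ih; last by move=> i x; exact: is_cderive_cst.
  by exists 0, 0%N => i x; rewrite mul0r normc_real normr0.
Qed.

Lemma poly_family_mulX (s : R) : poly_family (fun=> fun x => 'i * (s * x)%:C).
Proof.
apply: (@poly_family_intro _ (fun=> fun=> 'i * s%:C)).
- exists `|s|, 1%N => i x; rewrite normcM normc_i mul1r normc_real normrM ler_wpM2l//.
  by rewrite expr1 lerDr.
- move=> i x.
  have sx : is_derive x 1 (fun y => s * y) s.
    apply: (is_derive1_eq (@is_derive1M _ (fun=> s) id x 0 1 _ _)).
    by rewrite mul0r add0r mulr1.
  apply: (is_cderive_eq (is_cderiveM (is_cderive_cst _ _) (is_cderive_real sx))).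
  by rewrite mul0r add0r.
- by apply: (@poly_family_cst _ (normc ('i * s%:C))).
Qed.

Lemma derivs_cderivn P n m F : (m <= n)%N -> derivs P n F ->
  P (fun i => cderivn m (F i)) /\
  ((m < n)%N -> forall i x, cderivable (cderivn m (F i)) x).
Proof.
elim: m n F => [|m ih] n F mn; first by case: n {mn} => [|n] [PF h]; split => //; case: h.
case: n mn => // n mn [PF [dF /(ih n _ mn)]]; rewrite ltnS /cderivn.
by under eq_fun do rewrite -iterSr; move=> [h1 h2]; split => // /h2 h i x; rewrite iterSr; exact: h.
Qed.

Lemma derivs_of_cderivn P n F : (forall m, P (fun i => cderivn m (F i))) ->
  (forall m i x, cderivable (cderivn m (F i)) x) -> derivs P n F.
Proof.
elim: n F => [|n ih] F PF dF; first by split => //; exact: (PF 0%N).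
split; first exact: (PF 0%N); split; first exact: (dF 0%N).
apply: ih => m.
  by have := PF m.+1; under eq_fun do rewrite /cderivn iterSr.
by move=> i x; have := dF m.+1 i x; rewrite /cderivn iterSr.
Qed.

End Families.

Lemma derivs_reindex (R : realType) (I J : Type) (F : I -> R -> R[i]) (k : J -> I) n :
  derivs (@uniformly_rapid R I) n F -> derivs (@uniformly_rapid R J) n (fun j => F (k j)).
Proof.
elim: n F => [|n ih] F [PF h].
  by split => // m; have [C hC] := PF m; exists C => j x; exact: hC.
split; first by move=> m; have [C hC] := PF m; exists C => j x; exact: hC.
by case: h => dF hF; split; [move=> j x; exact: dF|exact: (ih _ hF)].
Qed.

Section ExpiTaylor.
Variable R : realType.

Lemma normr_le_of_derive (h dh : R -> R) (k : nat) (y : R) :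
  (forall x : R, is_derive x 1 h (dh x)) -> h 0 = 0 ->
  (forall x, `|dh x| <= `|x| ^+ k) -> `|h y| <= `|y| ^+ k.+1.
Proof.
move=> hd h0 dhk; rewrite exprSr.
have key (a b : R) : a <= b -> (forall x, a <= x <= b -> `|x| <= `|y|) ->
    `|b - a| = `|y| -> `|h b - h a| <= `|y| ^+ k * `|y|.
  move=> ab aby e; have [c cab ->] := MVT_cc ab (fun x _ => hd x).
  rewrite normrM e ler_wpM2r// (le_trans (dhk c))//.
  by apply: lerXn2r; rewrite ?nnegrE//; exact: aby.
have [y0|/ltW y0] := leP 0 y.
  have := key 0 y y0; rewrite h0 !subr0; apply => // x /andP[x0 xy].
  by rewrite !ger0_norm// (le_trans x0).
have := key y 0 y0; rewrite h0 !sub0r !normrN; apply => // x /andP[yx x0].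
by rewrite !ler0_norm// lerN2.
Qed.

Let cosB1_le (y : R) : `|cos y - 1| <= `|y|.
Proof.
have hd (x : R) : is_derive x 1 (fun y => cos y - 1) (- sin x).
  by apply: (is_derive1_eq (@is_derive1B _ (@cos R) (fun=> 1) x _ 0 _ _)); rewrite subr0.
have := @normr_le_of_derive _ _ 0 y hd; rewrite cos0 subrr expr1; apply => // x.
by rewrite normrN expr0 sin_max.
Qed.

Let sin_le (y : R) : `|sin y| <= `|y|.
Proof.
have := @normr_le_of_derive _ _ 0 y (@is_derive_sin R); rewrite sin0 expr1; apply => // x.
by rewrite expr0 cos_max.
Qed.

Lemma normc_expiB1_le (y : R) : normc (expi y - 1) <= 2 * `|y|.
Proof.
apply: (le_trans (normc_le_Re_Im _)); rewrite !ReImE /= subr0.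
by have := cosB1_le y; have := sin_le y; lra.
Qed.

Lemma normc_expi_taylor2_le (y : R) : normc (expi y - 1 - 'i * y%:C) <= 2 * y ^+ 2.
Proof.
apply: (le_trans (normc_le_Re_Im _)); rewrite !ReImE /= !mul0r !mul1r !subr0 add0r.
have hc (x : R) : is_derive x 1 (fun y => cos y - 1) (- sin x).
  by apply: (is_derive1_eq (@is_derive1B _ (@cos R) (fun=> 1) x _ 0 _ _)); rewrite subr0.
have hs (x : R) : is_derive x 1 (fun y => sin y - y) (cos x - 1).
  exact: (@is_derive1B _ (@sin R) id x).
have := @normr_le_of_derive _ _ 1 y hc; rewrite cos0 subrr => /(_ erefl).
have := @normr_le_of_derive _ _ 1 y hs; rewrite sin0 subrr => /(_ erefl).
rewrite real_normK ?num_real// => h1 h2; rewrite mulr_natl mulr2n; apply: lerD.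
  by apply: h2 => x; rewrite normrN expr1; exact: sin_le.
by apply: h1 => x; rewrite expr1; exact: cosB1_le.
Qed.

End ExpiTaylor.

Section PhaseFamilies.
Variable R : realType.
Variable I : Type.
Variable f : R -> R.
Hypothesis f_smooth : smooth f.
Hypothesis f_growth : derivatives_poly_growth f.
Implicit Types (tau h : I -> R).

Let fd n (p : R) : is_derive p 1 (f^`(n)) ((f^`(n.+1)) p).
Proof. by apply/is_deriveE; split => //; exact: f_smooth. Qed.

Lemma poly_family_derive n : poly_family (fun (_ : I) (p : R) => ((f^`(n))%classic p)%:C).
Proof.
move=> m; elim: m n => [|m ih] n.
  split => //; have [C [k hk]] := f_growth n; exists C, k => _ p.
  by rewrite normc_real; exact: hk.
apply: (derivs_intro _ _ (ih n.+1)); last by move=> _ p; exact: is_cderive_real.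
have [C [k hk]] := f_growth n; exists C, k => _ p.
by rewrite normc_real; exact: hk.
Qed.

Let phase_derive h i (p : R) : is_cderive (fun p => expi (- (h i * f p))) p
  (('i * (- h i)%:C) * ((f^`(1))%classic p)%:C * expi (- (h i * f p))).
Proof.
have hd : is_derive p 1 (fun p => - (h i * f p)) (- h i * (f^`(1))%classic p).
  have := is_derive1M (is_derive_cst (- h i) p 1) (fd 0 p).
  by rewrite mul0r add0r; under eq_fun do rewrite /= mulNr.
by apply: (is_cderive_eq (is_cderive_expi hd)); rewrite rmorphM mulrA.
Qed.

Let coeff_family h (B : R) : (forall i, `|h i| <= B) ->
  poly_family (fun i p => ('i * (- h i)%:C) * ((f^`(1))%classic p)%:C).
Proof.
move=> hB; apply: poly_familyM (poly_family_derive 1).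
by apply: (@poly_family_cst _ _ _ B) => i; rewrite normcM normc_i mul1r normc_real normrN.
Qed.

(** The derivative is a polynomially bounded family times the family itself, so
    the bounds propagate by induction on the order. *)
Lemma phase_family h (B : R) : (forall i, `|h i| <= B) ->
  poly_family (fun i p => expi (- (h i * f p))).
Proof.
move=> hB; have E0 : uniformly_poly (fun i p => expi (- (h i * f p))).
  by exists 1, 0%N => i p; rewrite normc_expi mul1r.
elim=> [|n ih]; first by split.
apply: (derivs_intro E0 (phase_derive h)).
by apply: (derivsM (@uniformly_polyD _ _) (@uniformly_polyM _ _)) => //; exact: (coeff_family hB).
Qed.

Let minus_i_derive : poly_family (fun (_ : I) p => (- 'i) * ((f^`(1))%classic p)%:C).
Proof.
apply: poly_familyM (poly_family_derive 1).
by apply: (@poly_family_cst _ _ _ 1) => i; rewrite normcN normc_i.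
Qed.

Lemma phase_quotient_family h (B : R) : (forall i, `|h i| <= B) -> (forall i, h i != 0) ->
  poly_family (fun i p => ((h i)^-1)%:C * (expi (- (h i * f p)) - 1)).
Proof.
move=> hB h0; apply: (poly_family_intro _ _ (poly_familyM minus_i_derive (phase_family hB))).
  have [C [k hk]] := f_growth 0; exists (2 * C), k => i p.
  rewrite normcM normc_real normfV ler_pdivrMl ?normr_gt0//.
  apply: (le_trans (normc_expiB1_le _)); rewrite normrN normrM mulrCA ler_wpM2l//.
  by rewrite -mulrA ler_wpM2l//; exact: hk.
move=> i p.
apply: (is_cderive_eq (is_cderiveM (is_cderive_cst _ _)
  (is_cderiveD (phase_derive h i p) (is_cderive_cst _ _)))).
rewrite mul0r add0r addr0 !mulrA; congr (_ * _ * _).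
rewrite mulrAC -rmorphM /= mulrN mulVf//.
by rewrite rmorphN rmorph1 mulN1r.
Qed.

(** The second-order remainder of [exp (- i h f)] in [h], divided by [h ^+ 2]. Its
    derivative is [- i f'] times the quotient of [phase_quotient_family], which in
    turn has derivative [- i f' * exp (- i h f)]: negative powers of [h] cancel. *)
Lemma phase_remainder_family h (B : R) : (forall i, `|h i| <= B) -> (forall i, h i != 0) ->
  poly_family (fun i p => ((h i ^- 2))%:C *
    (expi (- (h i * f p)) - 1 + 'i * (h i * f p)%:C)).
Proof.
move=> hB h0.
apply: (poly_family_intro _ _ (poly_familyM minus_i_derive (phase_quotient_family hB h0))).
  have [C [k hk]] := f_growth 0; exists (2 * C ^+ 2), (k * 2)%N => i p.
  rewrite normcM normc_real normfV ler_pdivrMl ?normr_gt0 ?expf_neq0//.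
  have := normc_expi_taylor2_le (- (h i * f p)); rewrite rmorphN mulrN opprK => h1.
  apply: (le_trans h1); rewrite sqrrN exprMn mulrCA normrX real_normK ?num_real//.
  rewrite ler_wpM2l ?sqr_ge0// -mulrA ler_wpM2l// exprM -exprMn -[leLHS]real_normK ?num_real//.
  have C0 := le_trans (normr_ge0 _) (hk p).
  by apply: lerXn2r; rewrite ?nnegrE//; exact: hk.
move=> i p.
have fp := is_derive1M (is_derive_cst (h i) p 1) (fd 0 p).
apply: (is_cderive_eq (is_cderiveM (is_cderive_cst _ _)
  (is_cderiveD (is_cderiveD (phase_derive h i p) (is_cderive_cst _ _))
     (is_cderiveM (is_cderive_cst 'i _) (is_cderive_real fp))))).
have key (H z F E : R[i]) : H != 0 ->
    H ^- 2 * (z * - H * F * E + z * (H * F)) = - z * F * (H^-1 * (E - 1)).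
  by move=> H0; field.
rewrite !mul0r !add0r addr0 /=.
set E := expi _; set F := (f^`(1))%classic p.
have hC : (h i)%:C != 0 by rewrite fmorph_eq0.
rewrite rmorphN rmorphM fmorphV rmorphXn /= fmorphV.
exact: key.
Qed.

End PhaseFamilies.

Section SchwartzFamilies.
Variable R : realType.
Implicit Types (I : Type) (phi : R -> R[i]) (T : dist R).

Lemma rapid_schwartz_le I (F : I -> R -> R[i]) : rapid_family F ->
  forall k l : nat, exists C : R, forall i x, `|x| ^+ k * normc (cderivn l (F i) x) <= C.
Proof.
move=> hF k l; have [h _] := derivs_cderivn (leqnn l) (hF l).
have [C hC] := h k; exists C => i x; apply: le_trans (hC i x).
by rewrite ler_wpM2r ?normc_ge0// lerXn2r ?nnegrE ?one_normr_ge0// lerDr.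
Qed.

Lemma rapid_schwartz I (F : I -> R -> R[i]) i : rapid_family F -> schwartz (F i).
Proof.
move=> hF; split.
  move=> n x; have [_ h] := derivs_cderivn (leqnSn n) (hF n.+1).
  exact: h.
move=> k l; have [C hC] := rapid_schwartz_le hF k l; exists C => x; exact: hC.
Qed.

Lemma schwartz_rapid I phi : schwartz phi -> rapid_family (fun _ : I => phi).
Proof.
move=> [sm dec] n; apply: derivs_of_cderivn; last by move=> m _ x; exact: sm.
move=> m k; have [C hC] := dec k m; have [D hD] := dec 0%N m.
exists (2 ^+ k * (D + C)) => _ x; have := hC x; have := hD x.
rewrite expr0 mul1r; set N := normc _ => h1 h2.
have N0 : 0 <= N by exact: normc_ge0.
apply: (@le_trans _ _ (2 ^+ k * (1 + `|x| ^+ k) * N)); last first.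
  by rewrite -mulrA ler_wpM2l ?exprn_ge0// mulrDl mul1r lerD.
rewrite ler_wpM2r//; have [x1|/ltW x1] := leP `|x| 1.
  apply: (@le_trans _ _ (2 ^+ k)); last by rewrite ler_peMr ?exprn_ge0// lerDl exprn_ge0.
  by apply: lerXn2r; rewrite ?nnegrE ?one_normr_ge0//; lra.
apply: (@le_trans _ _ ((2 * `|x|) ^+ k)).
  apply: lerXn2r; rewrite ?nnegrE ?one_normr_ge0// ?mulr_ge0//; lra.
by rewrite exprMn ler_wpM2l ?exprn_ge0// lerDr.
Qed.

(** The finitely many seminorms that control [T] are bounded on the family. *)
Lemma tempered_rapid_bounded I (F : I -> R -> R[i]) T : tempered T -> rapid_family F ->
  exists C : R, forall i, normc (T (F i)) <= C.
Proof.
move=> [_ [C [m hT]]] hF.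
have /choice[B hB] : forall kl : nat * nat, exists B : R,
    forall i, schwartz_seminorm kl.1 kl.2 (F i) <= B.
  move=> [k l]; have [B hB] := rapid_schwartz_le hF k l; exists B => i /=.
  apply: ge_sup; last by move=> _ [x _ <-]; exact: hB.
  by exists (`|0 : R| ^+ k * normc (cderivn l (F i) 0)), 0.
exists (`|C| * \sum_(k < m.+1) \sum_(l < m.+1) B (k : nat, l : nat)) => i.
apply: (le_trans (hT _ (rapid_schwartz i hF))).
set S := \sum_(_ < _) _; have S0 : 0 <= S.
  apply: sumr_ge0 => k _; apply: sumr_ge0 => l _.
  have [_ dec] := rapid_schwartz i hF; have [D hD] := dec k l.
  apply: (@le_trans _ _ (`|0 : R| ^+ k * normc (cderivn l (F i) 0))).
    by rewrite mulr_ge0 ?exprn_ge0// normc_ge0.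
  by apply: ub_le_sup; [exists D => _ [x _ <-]; exact: hD|exists 0].
apply: (@le_trans _ _ (`|C| * S)); first by rewrite ler_wpM2r// ler_norm.
rewrite ler_wpM2l//; apply: ler_sum => k _; apply: ler_sum => l _; exact: (hB (_, _)).
Qed.

End SchwartzFamilies.

(** * The Fourier transform on bounded families *)

Section LineFTC.
Variable R : realType.
Local Notation mu := (@lebesgue_measure R).

Lemma Rintegral_derive_halfline (g dg : R -> R) (l : R) :
  (forall x : R, 0 <= x -> is_derive x 1 g (dg x)) ->
  mu.-integrable `[0, +oo[ (EFin \o dg) -> g n%:R @[n --> \oo] --> l ->
  \int[mu]_(x in `[0, +oo[) dg x = l - g 0.
Proof.
move=> gd gi gl; apply: (cvg_unique _ (cvg_Rintegral_halfline gi)) => //.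
have -> : (fun n : nat => \int[mu]_(x in `[0, n%:R]) dg x) = (fun n : nat => g n%:R - g 0).
  apply/funext => n; apply: Rintegral_derive => //.
    by move=> x /andP[x0 _]; exact: gd.
  by apply: integrableS gi => //; apply: subset_itvl.
by apply: cvgB => //; exact: cvg_cst.
Qed.

Lemma Rintegral_derive_line (g dg : R -> R) (l l' : R) :
  (forall x : R, is_derive x 1 g (dg x)) ->
  mu.-integrable setT (EFin \o dg) -> g n%:R @[n --> \oo] --> l ->
  g (- n%:R) @[n --> \oo] --> l' ->
  \int[mu]_x dg x = l - l'.
Proof.
move=> gd gi gl gl'.
have gi1 : mu.-integrable `[0, +oo[ (EFin \o dg) by exact: integrableS gi.
have [gi2 _] := integrable_opp (@measurableT _ _) gi.
have gi3 : mu.-integrable `[0, +oo[ (EFin \o (fun x => dg (- x))).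
  have TE : [set x : R | [set: R] (- x)] = setT by apply/seteqP; split.
  by rewrite TE in gi2; exact: integrableS gi2.
have [_ ->] := integrable_line gi1 gi3.
rewrite (Rintegral_derive_halfline (fun x _ => gd x) gi1 gl).
have gNd (x : R) : 0 <= x -> is_derive x 1 (fun x => - g (- x)) (dg (- x)).
  move=> _; have h := is_derive1_comp (gd (- x)) (is_deriveN (is_derive_id x 1)).
  by apply: (is_derive1_eq (is_deriveN h)); rewrite mulrN1 opprK.
rewrite (Rintegral_derive_halfline gNd gi3 (cvgN gl')).
by rewrite oppr0; ring.
Qed.

Lemma cintegral_derive_line (g dg : R -> R[i]) (C : R) :
  (forall x, is_cderive g x (dg x)) -> cintegrable setT dg ->
  (forall x, (1 + `|x|) * normc (g x) <= C) -> cintegral setT dg = 0.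
Proof.
move=> gd [i1 i2] gC.
have C0 : 0 <= C by apply: le_trans (gC 0); rewrite mulr_ge0 ?normc_ge0// one_normr_ge0.
have lim (s : R) (h : R -> R) : `|s| = 1 -> (forall x, `|h x| <= normc (g x)) ->
    h (s * n%:R) @[n --> \oo] --> 0.
  move=> s1 hg.
  have z : C * n.+1%:R^-1 @[n --> \oo] --> (0 : R).
    by rewrite -[0](mulr0 C); apply: cvgMr; exact: cvg_harmonic.
  apply/norm_cvg0P; apply: (squeeze_cvgr _ (cvg_cst 0) z); apply: nearW => n.
  rewrite normr_ge0 /=; apply: (le_trans (hg _)).
  rewrite ler_pdivlMr// mulrC; apply: le_trans (gC (s * n%:R)).
  by rewrite normrM s1 mul1r normr_nat nat1r.
have l1 (h : R -> R) : (forall x, `|h x| <= normc (g x)) -> h n%:R @[n --> \oo] --> 0.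
  by move=> /(lim 1 h (normr1 _)); under eq_fun do rewrite mul1r.
have l2 (h : R -> R) : (forall x, `|h x| <= normc (g x)) -> h (- n%:R) @[n --> \oo] --> 0.
  by move=> /(lim (- 1) h); rewrite normrN normr1 => /(_ erefl); under eq_fun do rewrite mulN1r.
have d1 (x : R) : is_derive x 1 (re_part g) (re_part dg x) by have [] := gd x.
have d2 (x : R) : is_derive x 1 (im_part g) (im_part dg x) by have [] := gd x.
have hRe x : `|re_part g x| <= normc (g x) by exact: normr_Re_le_normc.
have hIm x : `|im_part g x| <= normc (g x) by exact: normr_Im_le_normc.
by apply: complex_ext => /=;
  [rewrite (Rintegral_derive_line d1 i1 (l1 _ hRe) (l2 _ hRe))
  |rewrite (Rintegral_derive_line d2 i2 (l1 _ hIm) (l2 _ hIm))]; rewrite subrr.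
Qed.

End LineFTC.

Section FourierSign.
Variable R : realType.
Local Notation mu := (@lebesgue_measure R).
Local Notation lorentz := (fun x : R => (1 + x ^+ 2)^-1).
Variable s : R.
Hypothesis s1 : `|s| = 1.

(** The values [-1] and [1] of [s] give the Fourier transform and, up to a
    factor, its inverse. *)
Definition fourier_sign (phi : R -> R[i]) (p : R) : R[i] :=
  cintegral setT (fun x => phi x * expi (s * (x * p))).

Lemma cintegrable_expiM (A : set R) (g : R -> R[i]) (h : R -> R) : measurable A ->
  cintegrable A g -> measurable_fun A h -> cintegrable A (fun x => g x * expi (h x)).
Proof.
move=> mA gi mh; apply: (le_cintegrable mA _ (integrable_normc mA gi)).
  by apply: cmeasurableM; [exact: cintegrable_measurable|exact: cmeasurable_expi].
by move=> x _; rewrite normcM normc_expi mulr1.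
Qed.

Lemma measurable_phase (p : R) : measurable_fun setT (fun x : R => s * (x * p)).
Proof. by apply: measurable_funM => //; exact: measurable_funM. Qed.

Lemma is_derive_quadratic (g : R -> R) (p l C : R) :
  (forall h, `|g (p + h) - g p - h * l| <= C * h ^+ 2) -> is_derive p 1 g l.
Proof.
move=> hg.
have cv : h^-1 *: (g (h *: 1 + p) - g p) @[h --> 0^'] --> l.
  apply/cvgrPdist_le => e e0; have C1 : 0 < `|C| + 1 by rewrite ltr_wpDl.
  near=> h; have h0 : h != 0 by near: h; exact: nbhs_dnbhs_neq.
  rewrite /GRing.scale /= mulr1 [h + p]addrC.
  have -> : l - h^-1 * (g (p + h) - g p) = - (h^-1 * (g (p + h) - g p - h * l)).
    by field.
  rewrite normrN normrM normfV ler_pdivrMl ?normr_gt0//.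
  apply: (le_trans (hg h)).
  have he : (`|C| + 1) * `|h| <= e.
    rewrite mulrC -ler_pdivlMr//.
    by near: h; apply: dnbhs0_le; rewrite divr_gt0.
  rewrite -real_normK ?num_real// expr2 mulrA mulrC ler_wpM2l//.
  apply: le_trans he; rewrite ler_wpM2r//.
  by apply: (le_trans (ler_norm C)); rewrite lerDl.
split; first by apply/cvg_ex; exists l.
exact: (cvg_lim _ cv).
Unshelve. all: by end_near. Qed.

Variable I : Type.
Implicit Types A : I -> R -> R[i].

Lemma uniformly_rapid_lorentz A (k : nat) : uniformly_rapid A -> exists2 C : R, 0 <= C &
  forall i x, `|x| ^+ k * normc (A i x) <= C * lorentz x.
Proof.
move=> hA; have [C hC] := hA (k + 2)%N.
exists `|C| => // i x; have x2 : 0 < 1 + x ^+ 2 by rewrite ltr_wpDr ?sqr_ge0.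
rewrite ler_pdivlMr//; apply: (le_trans _ (ler_norm C)); apply: le_trans (hC i x).
rewrite mulrAC exprD; apply: ler_wpM2r; first exact: normc_ge0.
apply: ler_pM; rewrite ?exprn_ge0// ?(ltW x2)//.
  by apply: lerXn2r; rewrite ?nnegrE ?one_normr_ge0// lerDr.
by rewrite sqrrD expr1n real_normK ?num_real// mul1r lerD2r lerDl mulrn_wge0.
Qed.

Lemma rapid_cmeasurable A i : rapid_family A -> cmeasurable setT (A i).
Proof.
move=> hA; split; apply: continuous_measurable_fun => x;
  by have [] := is_cderive_continuous (rapid_cderive hA i x).
Qed.

Lemma rapid_cintegrable A i : rapid_family A -> cintegrable setT (A i).
Proof.
move=> hA; have [C C0 hC] := uniformly_rapid_lorentz 0 (rapid_decay hA).
apply: (le_cintegrable _ (rapid_cmeasurable i hA) (integrable_EFinZl C _ (@lorentz_integrable R))) => //.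
by move=> x _; have := hC i x; rewrite expr0 mul1r.
Qed.

Lemma rapid_osc_cintegrable A i p : rapid_family A ->
  cintegrable setT (fun x => A i x * expi (s * (x * p))).
Proof.
move=> hA; apply: cintegrable_expiM => //; first exact: rapid_cintegrable.
exact: measurable_phase.
Qed.

Lemma fourier_sign_bounded A : rapid_family A ->
  exists C : R, forall i p, normc (fourier_sign (A i) p) <= C.
Proof.
move=> hA; have [C C0 hC] := uniformly_rapid_lorentz 0 (rapid_decay hA).
exists (\int[mu]_x (C * lorentz x)) => i p; apply: normc_cintegral_le_trans => //.
- exact: rapid_osc_cintegrable.
- by apply: integrable_EFinZl => //; exact: lorentz_integrable.
- by move=> x _; rewrite normcM normc_expi mulr1; have := hC i x; rewrite expr0 mul1r.
Qed.

Lemma rapid_mulX A : rapid_family A -> rapid_family (fun i x => 'i * (s * x)%:C * A i x).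
Proof. by move=> hA; apply: poly_rapidM hA; exact: (@poly_family_mulX _ _ s). Qed.

(** The second-order Taylor remainder of the exponential is at most [h ^+ 2] times
    an integrable function, so the increment can be compared with the claimed
    derivative under the integral sign. *)
Lemma fourier_sign_is_cderive A : rapid_family A -> forall i p,
  is_cderive (fourier_sign (A i)) p (fourier_sign (fun x => 'i * (s * x)%:C * A i x) p).
Proof.
move=> hA i p; have [C C0 hC] := uniformly_rapid_lorentz 2 (rapid_decay hA).
have quad h : normc (fourier_sign (A i) (p + h) - fourier_sign (A i) p
    - h%:C * fourier_sign (fun x => 'i * (s * x)%:C * A i x) p)
    <= 2 * (\int[mu]_x (C * lorentz x)) * h ^+ 2.
  have iX := rapid_osc_cintegrable i p (rapid_mulX hA).
  have ip := rapid_osc_cintegrable i p hA; have iph := rapid_osc_cintegrable i (p + h) hA.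
  have iB : cintegrable setT (fun x => A i x * expi (s * (x * (p + h))) - A i x * expi (s * (x * p))).
    exact: (cintegrableD measurableT iph (cintegrableN measurableT ip)).
  have iZ := cintegrableZl h%:C measurableT iX.
  rewrite -cintegralZl// -(cintegralB measurableT iph ip) -(cintegralB measurableT iB iZ).
  have iL : mu.-integrable setT (EFin \o (fun x => C * lorentz x)).
    by apply: integrable_EFinZl => //; exact: lorentz_integrable.
  rewrite mulrAC -RintegralZl//.
  apply: normc_cintegral_le_trans => //.
  - exact: (cintegrableD measurableT iB (cintegrableN measurableT iZ)).
  - by apply: integrable_EFinZl.
  move=> x _.
  have -> : A i x * expi (s * (x * (p + h))) - A i x * expi (s * (x * p)) -
      h%:C * ('i * (s * x)%:C * A i x * expi (s * (x * p))) =
      A i x * expi (s * (x * p)) * (expi (s * x * h) - 1 - 'i * (s * x * h)%:C).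
    rewrite (_ : s * (x * (p + h)) = s * (x * p) + s * x * h); last by ring.
    rewrite expiD [(s * x * h)%:C]rmorphM /=; ring.
  rewrite normcM normcM normc_expi mulr1.
  have t2 := normc_expi_taylor2_le (s * x * h).
  apply: (le_trans (ler_wpM2l (normc_ge0 _) t2)).
  have -> : normc (A i x) * (2 * (s * x * h) ^+ 2) = 2 * h ^+ 2 * (`|x| ^+ 2 * normc (A i x)).
    rewrite !exprMn -(real_normK (num_real s)) s1 expr1n mul1r (real_normK (num_real x)); ring.
  by rewrite ler_wpM2l ?hC// mulr_ge0 ?sqr_ge0.
split; apply: is_derive_quadratic => h; apply: (le_trans _ (quad h)).
  apply: (le_trans _ (normr_Re_le_normc _)); rewrite !ReImE /= mul0r subr0//.
apply: (le_trans _ (normr_Im_le_normc _)); rewrite !ReImE /= mul0r addr0//.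
Qed.

(** Integration by parts; the boundary terms vanish by rapid decay. *)
Lemma fourier_sign_derive A : rapid_family A -> forall i p,
  normc (fourier_sign (fun x => cderiv (A i) x) p) = `|p| * normc (fourier_sign (A i) p).
Proof.
move=> hA i p.
have phd (x : R) : is_derive x 1 (fun x => s * (x * p)) (s * p).
  have h : is_derive x 1 (fun x => x * p) (1 * p + x * 0) by exact: (@is_derive1M _ id (fun=> p)).
  apply: (is_derive1_eq (@is_derive1M _ (fun=> s) _ x 0 _ _ h)).
  by rewrite mul0r add0r mulr0 addr0 mul1r.
have gd x : is_cderive (fun x => A i x * expi (s * (x * p))) x
    (cderiv (A i) x * expi (s * (x * p)) + 'i * (s * p)%:C * (A i x * expi (s * (x * p)))).
  apply: (is_cderive_eq (is_cderiveM (rapid_cderive hA i x) (is_cderive_expi (phd x)))).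
  by congr (_ + _); rewrite mulrCA.
have i0 := rapid_osc_cintegrable i p hA.
have i1 := rapid_osc_cintegrable i p (rapid_derive hA).
have i2 := cintegrableZl ('i * (s * p)%:C) measurableT i0.
have [C hC] := rapid_decay hA 1%N.
have := cintegral_derive_line gd (cintegrableD measurableT i1 i2).
move=> /(_ C) H; have {H} : cintegral setT (fun x => cderiv (A i) x * expi (s * (x * p)) +
    'i * (s * p)%:C * (A i x * expi (s * (x * p)))) = 0.
  by apply: H => x; rewrite normcM normc_expi mulr1; have := hC i x; rewrite expr1.
rewrite cintegralD// cintegralZl// => /eqP; rewrite addr_eq0 => /eqP e.
rewrite /fourier_sign e normcN !normcM normc_i normc_real mul1r normrM s1 mul1r//.
Qed.

(** Each factor [p] is absorbed as a derivative of the function. *)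
Lemma fourier_sign_rapid A : rapid_family A -> uniformly_rapid (fun i => fourier_sign (A i)).
Proof.
move=> hA k; elim: k A hA => [|k ih] A hA.
  have [C hC] := fourier_sign_bounded hA; exists C => i p; rewrite expr0 mul1r; exact: hC.
have [C hC] := ih A hA; have [D hD] := ih _ (rapid_derive hA).
exists (C + D) => i p; rewrite exprSr -mulrA mulrDl mul1r mulrDr; apply: lerD; first exact: hC.
by rewrite -fourier_sign_derive//; exact: hD.
Qed.

Lemma fourier_sign_family A : rapid_family A -> rapid_family (fun i => fourier_sign (A i)).
Proof.
move=> hA n; elim: n A hA => [|n ih] A hA; first by split => //; exact: fourier_sign_rapid.
apply: (derivs_intro (fourier_sign_rapid hA) (fourier_sign_is_cderive hA)).
by apply: ih; exact: rapid_mulX.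
Qed.

End FourierSign.

(** * Multiplication formula and Fourier inversion *)

Section Multiplication.
Variable R : realType.
Local Notation mu := (@lebesgue_measure R).

Lemma Rintegral_swap (G : measurableTypeR R * measurableTypeR R -> R) (a b : R -> R) :
  measurable_fun setT G ->
  mu.-integrable setT (EFin \o a) -> mu.-integrable setT (EFin \o b) ->
  (forall p, 0 <= a p) -> (forall x, 0 <= b x) ->
  (forall p x, `|G (p, x)| <= a p * b x) ->
  mu.-integrable setT (EFin \o (fun p => \int[mu]_x G (p, x))) /\
  \int[mu]_p (\int[mu]_x G (p, x)) = \int[mu]_x (\int[mu]_p G (p, x)).
Proof.
move=> mG ai bi a0 b0 Gab.
have mf : measurable_fun setT (EFin \o G) by exact/measurable_EFinP.
have sec1 p : mu.-integrable setT (EFin \o (fun x => G (p, x))).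
  apply: (@integrable_le _ _ _ (fun x => a p * b x)) => //.
    exact: (measurableT_comp mG (pair1_measurable _)).
  by apply: integrable_EFinZl.
have sec2 x : mu.-integrable setT (EFin \o (fun p => G (p, x))).
  apply: (@integrable_le _ _ _ (fun p => b x * a p)) => //.
    exact: (measurableT_comp mG (pair2_measurable _)).
    by apply: integrable_EFinZl.
  by move=> p _; rewrite mulrC.
have E1 : fubini_F mu (EFin \o G) = EFin \o (fun p => \int[mu]_x G (p, x)).
  apply/funext => p; rewrite /fubini_F /= /Rintegral fineK//.
  by apply: integrable_fin_num => //; exact: sec1.
have E2 : fubini_G mu (EFin \o G) = EFin \o (fun x => \int[mu]_p G (p, x)).
  apply/funext => x; rewrite /fubini_G /= /Rintegral fineK//.
  by apply: integrable_fin_num => //; exact: sec2.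
have Gi : (mu \x mu)%E.-integrable setT (EFin \o G).
  apply/integrable12ltyP => //=.
  apply: (@le_lt_trans _ _ (\int[mu]_p (a p * \int[mu]_x b x)%:E)%E); last first.
    have abi : mu.-integrable setT (EFin \o (fun p => a p * \int[mu]_x b x)).
      by under eq_fun do rewrite mulrC; exact: integrable_EFinZl.
    by rewrite -(fineK (integrable_fin_num _ abi))// ltry.
  apply: ge0_le_integral => //.
  - by move=> p _; apply: integral_ge0.
  - apply: (@measurable_fun_fubini_tonelli_F _ _ _ _ _ mu (fun z => `|(G z)%:E|%E)) => //.
    exact: measurableT_comp.
  - apply/measurable_EFinP; apply: measurable_funM => //.
    by move/integrableP : ai => [/measurable_EFinP].
  move=> p _; rewrite -RintegralZl//.
  rewrite /Rintegral fineK; last first.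
    by apply: integrable_fin_num => //; exact: integrable_EFinZl.
  apply: ge0_le_integral => //.
  - have /integrableP[/measurable_EFinP m _] := sec1 p.
    by apply/measurable_EFinP; exact: measurableT_comp m.
  - by have /integrableP[] := integrable_EFinZl (a p) (@measurableT _ _) bi.
  by move=> x _; rewrite lee_fin.
split; first by rewrite -E1; exact: integrable_fubini_F.
rewrite /Rintegral; congr fine.
have := Fubini Gi.
have -> : (fun p => \int[mu]_x (EFin \o G) (p, x))%E = fubini_F mu (EFin \o G) by [].
have -> : (fun x => \int[mu]_p (EFin \o G) (p, x))%E = fubini_G mu (EFin \o G) by [].
by rewrite E1 E2.
Qed.

(** Fubini's theorem for [a p * b x * expi (s * (x * p))]. *)
Lemma fourier_sign_multiplication (s : R) (a b : R -> R[i]) :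
  cintegrable setT a -> cintegrable setT b ->
  cintegrable setT (fun p => a p * fourier_sign s b p) /\
  cintegral setT (fun p => a p * fourier_sign s b p) =
  cintegral setT (fun x => b x * fourier_sign s a x).
Proof.
move=> ai bi.
pose F p x : R[i] := a p * (b x * expi (s * (x * p))).
pose G1 (z : measurableTypeR R * measurableTypeR R) := complex.Re (F z.1 z.2).
pose G2 (z : measurableTypeR R * measurableTypeR R) := complex.Im (F z.1 z.2).
have [ma1 ma2] := cintegrable_measurable ai; have [mb1 mb2] := cintegrable_measurable bi.
have mph : measurable_fun setT
    (fun z : measurableTypeR R * measurableTypeR R => s * (z.2 * z.1)).
  by apply: measurable_funM => //; apply: measurable_funM.
have c1 := measurableT_comp ma1 (@measurable_fst _ _ (measurableTypeR R) (measurableTypeR R)).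
have c2 := measurableT_comp ma2 (@measurable_fst _ _ (measurableTypeR R) (measurableTypeR R)).
have d1 := measurableT_comp mb1 (@measurable_snd _ _ (measurableTypeR R) (measurableTypeR R)).
have d2 := measurableT_comp mb2 (@measurable_snd _ _ (measurableTypeR R) (measurableTypeR R)).
have e1 := measurableT_comp (continuous_measurable_fun (@continuous_cos R)) mph.
have e2 := measurableT_comp (continuous_measurable_fun (@continuous_sin R)) mph.
have be1 := measurable_funB (measurable_funM d1 e1) (measurable_funM d2 e2).
have be2 := measurable_funD (measurable_funM d1 e2) (measurable_funM d2 e1).
have mG1 : measurable_fun setT G1.
  rewrite /G1 /F; under eq_fun do rewrite !ReImE.
  exact: (measurable_funB (measurable_funM c1 be1) (measurable_funM c2 be2)).
have mG2 : measurable_fun setT G2.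
  rewrite /G2 /F; under eq_fun do rewrite !ReImE.
  exact: (measurable_funD (measurable_funM c1 be2) (measurable_funM c2 be1)).
have nF p x : normc (F p x) = normc (a p) * normc (b x).
  by rewrite /F !normcM normc_expi mulr1.
have h1 p x : `|G1 (p, x)| <= normc (a p) * normc (b x).
  by rewrite -nF; exact: normr_Re_le_normc.
have h2 p x : `|G2 (p, x)| <= normc (a p) * normc (b x).
  by rewrite -nF; exact: normr_Im_le_normc.
have [I1 S1] := Rintegral_swap mG1 (integrable_normc measurableT ai)
  (integrable_normc measurableT bi) (fun p => normc_ge0 (a p)) (fun x => normc_ge0 (b x))
  h1.
have [I2 S2] := Rintegral_swap mG2 (integrable_normc measurableT ai)
  (integrable_normc measurableT bi) (fun p => normc_ge0 (a p)) (fun x => normc_ge0 (b x))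
  h2.
have E p : cintegral setT (F p) = a p * fourier_sign s b p.
  exact: (cintegralZl (a p) measurableT (cintegrable_expiM measurableT bi (measurable_phase s p))).
have E' x : cintegral setT (F ^~ x) = b x * fourier_sign s a x.
  rewrite -(cintegralZl (b x) measurableT (cintegrable_expiM measurableT ai (measurable_phase s x))).
  by apply: eq_cintegral => p _; rewrite /F mulrCA [x * p]mulrC.
have R1 : (fun p => \int[mu]_x G1 (p, x)) = re_part (fun p => a p * fourier_sign s b p).
  by apply/funext => p; rewrite /re_part -E.
have R2 : (fun p => \int[mu]_x G2 (p, x)) = im_part (fun p => a p * fourier_sign s b p).
  by apply/funext => p; rewrite /im_part -E.
split; first by split; [rewrite -R1|rewrite -R2].
apply: complex_ext => /=.
  by rewrite -R1 S1; apply: eq_Rintegral => x _; rewrite /re_part -E'.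
by rewrite -R2 S2; apply: eq_Rintegral => x _; rewrite /im_part -E'.
Qed.

End Multiplication.

Section PoissonKernel.
Variable R : realType.
Local Notation mu := (@lebesgue_measure R).
Local Notation lorentz := (fun x : R => (1 + x ^+ 2)^-1).

(** Convergence of the factor is asked only where [g] does not vanish, since the
    Poisson kernels diverge at their centre. *)
Lemma dominated_cvg_cintegral (g : R -> R[i]) (r_ : (R -> R)^nat) (r h : R -> R) :
  cmeasurable setT g -> (forall n, measurable_fun setT (r_ n)) -> measurable_fun setT r ->
  (forall x, g x != 0 -> r_ ^~ x @ \oo --> r x) -> mu.-integrable setT (EFin \o h) ->
  (forall n x, `|r_ n x| * normc (g x) <= h x) ->
  ccvg_to \oo (fun n => cintegral setT (fun x => (r_ n x)%:C * g x))
    (cintegral setT (fun x => (r x)%:C * g x)).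
Proof.
move=> [mg1 mg2] mr_ mr rr hi rg.
have key (k : R -> R) : measurable_fun setT k -> (forall x, `|k x| <= normc (g x)) ->
    \int[mu]_x (r_ n x * k x) @[n --> \oo] --> \int[mu]_x (r x * k x).
  move=> mk kg; apply: (@dominated_cvg_Rintegral _ setT _ _ h) => //.
  - by move=> n; exact: measurable_funM.
  - exact: measurable_funM.
  - move=> x _; have [gx0|gx0] := eqVneq (g x) 0; last by apply: cvgMl; exact: rr.
    have -> : k x = 0 by apply/eqP; rewrite -normr_le0 (le_trans (kg x))// gx0 normc_real normr0.
    by rewrite mulr0; under eq_fun do rewrite mulr0; exact: cvg_cst.
  - by move=> n x _; rewrite normrM (le_trans _ (rg n x))// ler_wpM2l.
split; rewrite /=.
  rewrite (_ : re_part (fun x => (r x)%:C * g x) = fun x => r x * re_part g x); last first.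
    by apply/funext => x; rewrite /re_part ReImE /= mul0r subr0.
  rewrite (_ : (fun n => \int[mu]_x re_part (fun x => (r_ n x)%:C * g x) x) =
      fun n => \int[mu]_x (r_ n x * re_part g x)).
    by apply: key => // x; exact: normr_Re_le_normc.
  apply/funext => n; apply: eq_Rintegral => x _.
  by rewrite /re_part ReImE /= mul0r subr0.
rewrite (_ : im_part (fun x => (r x)%:C * g x) = fun x => r x * im_part g x); last first.
  by apply/funext => x; rewrite /im_part !ReImE /= mul0r addr0.
rewrite (_ : (fun n => \int[mu]_x im_part (fun x => (r_ n x)%:C * g x) x) =
    fun n => \int[mu]_x (r_ n x * im_part g x)).
  by apply: key => // x; exact: normr_Im_le_normc.
apply/funext => n; apply: eq_Rintegral => x _.
by rewrite /im_part !ReImE /= mul0r addr0.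
Qed.

Lemma is_derive1Zl (k : R) (h : R -> R) (x l : R) : is_derive x 1 h l ->
  is_derive x 1 (fun y => k * h y) (k * l).
Proof.
move=> hl; apply: (is_derive1_eq (@is_derive1M _ (fun=> k) h x 0 l _ hl)).
by rewrite mul0r add0r.
Qed.

Lemma is_derive_mull (k x : R) : is_derive x 1 (fun y => k * y) k.
Proof. by apply: (is_derive1_eq (@is_derive1Zl k id x 1 _)); rewrite mulr1. Qed.

Lemma cvg_expR_nat (e : R) : 0 < e -> expR (- e * n%:R) @[n --> \oo] --> (0 : R).
Proof.
move=> e0; under eq_fun do rewrite expRM_natr.
by apply: cvg_expr; rewrite ger0_norm ?expR_ge0// expR_lt1 oppr_lt0.
Qed.

Lemma is_derive_expR_lin (e x : R) :
  is_derive x 1 (fun x => expR (- e * x)) (expR (- e * x) * - e).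
Proof.
exact: (is_derive1_comp (is_derive_expR (- e * x)) (is_derive_mull (- e) x)).
Qed.

Lemma continuous_expR_lin (e : R) : continuous (fun x : R => expR (- e * x)).
Proof.
move=> x; have [d _] := is_derive_expR_lin e x.
by apply: differentiable_continuous; exact/derivable1_diffP.
Qed.

Lemma integrable_expR_lin (e : R) : 0 < e ->
  mu.-integrable `[0, +oo[ (EFin \o (fun x => expR (- e * x))).
Proof.
move=> e0; have me : measurable_fun setT (fun x : R => expR (- e * x)).
  by apply: continuous_measurable_fun; exact: continuous_expR_lin.
apply: (proj1 (@integrable_halfline _ (fun x => expR (- e * x)) e^-1 me _ _)) => [x _|n].
  exact: expR_ge0.
have ci : mu.-integrable `[0, n%:R] (EFin \o (fun x : R => expR (- e * x))).
  apply: continuous_compact_integrable; first exact: segment_compact.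
  by apply: continuous_subspaceT; exact: continuous_expR_lin.
have d (x : R) : is_derive x 1 (fun x => - e^-1 * expR (- e * x)) (expR (- e * x)).
  apply: (is_derive1_eq (is_derive1Zl (- e^-1) (is_derive_expR_lin e x))).
  by rewrite mulrCA mulrNN mulVf ?mulr1// gt_eqF.
split => //; rewrite (Rintegral_derive (ler0n _ n) (fun x _ => d x) ci).
rewrite mulr0 expR0 mulr1 opprK gerDr mulNr oppr_le0.
by rewrite mulr_ge0 ?expR_ge0// invr_ge0 ltW.
Qed.

(** The Poisson kernel as the Fourier transform of [exp (- e |p|)]. *)
Lemma poisson_kernel (e z : R) : 0 < e ->
  cintegrable setT (fun p => (expR (- e * `|p|))%:C * expi (z * p)) /\
  cintegral setT (fun p => (expR (- e * `|p|))%:C * expi (z * p)) =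
    (2 * e / (e ^+ 2 + z ^+ 2))%:C.
Proof.
move=> e0; have hi := integrable_expR_lin e0.
have ez : 0 < e ^+ 2 + z ^+ 2 by rewrite ltr_wpDr ?sqr_ge0// exprn_gt0.
have mz (w : R) : measurable_fun setT (fun p : R => w * p) by exact: measurable_funM.
have half (w : R) : cintegrable `[0, +oo[ (fun p => (expR (- e * p))%:C * expi (w * p)).
  apply: cintegrable_expiM => //.
  split => /=; first exact: hi.
  exact: (@integrable0 _ _ _ mu `[0, +oo[).
have i1 : cintegrable `[0, +oo[ (fun p => (expR (- e * `|p|))%:C * expi (z * p)).
  apply: eq_cintegrable (half z) => // p; rewrite inE/= in_itv/= andbT => p0.
  by rewrite ger0_norm.
have i2 : cintegrable `[0, +oo[ (fun p => (expR (- e * `|- p|))%:C * expi (z * - p)).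
  apply: eq_cintegrable (half (- z)) => // p; rewrite inE/= in_itv/= andbT => p0.
  by rewrite normrN ger0_norm// mulrN !mulNr.
have [I E] := cintegral_line i1 i2; split => //; rewrite E => {E I}.
have C0 : \int[mu]_(p in `[0, +oo[) (expR (- e * p) * cos (z * p)) = e / (e ^+ 2 + z ^+ 2).
  have [/= hR _] := half z.
  pose c := (e ^+ 2 + z ^+ 2)^-1.
  pose g (p : R) := c * (expR (- e * p) * (z * sin (z * p) - e * cos (z * p))).
  have gd (x : R) : 0 <= x -> is_derive x 1 g (expR (- e * x) * cos (z * x)).
    move=> _.
    have ds := is_derive1Zl z (is_derive1_comp (is_derive_sin (z * x)) (is_derive_mull z x)).
    have dc := is_derive1Zl e (is_derive1_comp (is_derive_cos (z * x)) (is_derive_mull z x)).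
    apply: (is_derive1_eq (is_derive1Zl c
      (is_derive1M (is_derive_expR_lin e x) (is_derive1B ds dc)))).
    rewrite /c /=; move: (expR _) (cos _) (sin _) => E C S.
    by field; rewrite gt_eqF.
  have gi : mu.-integrable `[0, +oo[ (EFin \o (fun p => expR (- e * p) * cos (z * p))).
    apply: eq_integrable hR => // p _ /=.
    by rewrite /re_part ReImE /= mul0r subr0.
  have gl : g n%:R @[n --> \oo] --> 0.
    have z1 : `|c| * (`|z| + `|e|) * expR (- e * n%:R) @[n --> \oo] --> 0.
      by rewrite -[0](mulr0 (`|c| * (`|z| + `|e|))); apply: cvgMr; exact: cvg_expR_nat.
    apply/norm_cvg0P; apply: (squeeze_cvgr _ (cvg_cst 0) z1); apply: nearW => n.
    rewrite normr_ge0 /= /g !normrM (ger0_norm (expR_ge0 _)).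
    rewrite -mulrA [_ * expR _]mulrC !ler_wpM2l ?expR_ge0//.
    apply: (le_trans (ler_normB _ _)); rewrite !normrM; apply: lerD.
      by rewrite ler_piMr// sin_max.
    by rewrite ler_piMr// cos_max.
  rewrite (Rintegral_derive_halfline gd gi gl) /g !mulr0 expR0 sin0 cos0 /c.
  by move: (_ ^-1) => w; ring.
apply: complex_ext; rewrite !ReImE /=.
  transitivity (e / (e ^+ 2 + z ^+ 2) + e / (e ^+ 2 + z ^+ 2)); last by field; rewrite gt_eqF.
  congr (_ + _); rewrite -C0; apply: eq_Rintegral => p; rewrite inE/= in_itv/= andbT => p0.
    by rewrite /re_part ReImE /= ger0_norm//; ring.
  by rewrite /re_part ReImE /= normrN ger0_norm// mulrN cosN; ring.
rewrite -RintegralD//; [|by case: i1|by case: i2].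
have R0 : \int[mu]_(p in `[0, +oo[) (0 : R) = 0 by rewrite /Rintegral integral0.
rewrite -[RHS]R0; apply: eq_Rintegral => p _.
by rewrite /im_part !ReImE /= normrN mulrN sinN; ring.
Qed.

End PoissonKernel.

Section Inversion.
Variable R : realType.
Local Notation mu := (@lebesgue_measure R).
Local Notation lorentz := (fun x : R => (1 + x ^+ 2)^-1).
Local Notation poisson e := (fun z : R => 2 * e / (e ^+ 2 + z ^+ 2)).

Lemma poisson_denom_gt0 (e z : R) : 0 < e -> 0 < e ^+ 2 + z ^+ 2.
Proof. by move=> e0; rewrite ltr_wpDr ?sqr_ge0// exprn_gt0. Qed.

Lemma measurable_poisson (e x : R) : 0 < e ->
  measurable_fun setT (fun y : R => poisson e (y - x)).
Proof.
move=> e0; apply: continuous_measurable_fun => y.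
apply: cvgMr; apply: cvgV; first by rewrite gt_eqF// poisson_denom_gt0.
apply: cvgD; first exact: cvg_cst.
by apply: cvgM; (apply: cvgB; [exact: cvg_id|exact: cvg_cst]).
Qed.

Lemma lorentz_translate (x y : R) :
  (1 + (y - x) ^+ 2)^-1 <= 2 * (1 + x ^+ 2) * lorentz y.
Proof.
have h (z : R) : 0 < 1 + z ^+ 2 by rewrite ltr_wpDr ?sqr_ge0.
rewrite ler_pdivlMr// ler_pdivrMl//.
have := sqr_ge0 (y - x + x); have := sqr_ge0 (y - x - x).
have : 0 <= (y - x) ^+ 2 * x ^+ 2 by rewrite mulr_ge0 ?sqr_ge0.
have := sqr_ge0 (y - x); have := sqr_ge0 x; rewrite !expr2; nra.
Qed.

(** Against a bounded Lipschitz increment the Poisson kernels have a common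
    integrable majorant, uniformly in the width [e]. *)
Lemma poisson_le (e z m : R) : 0 < e <= 1 -> 0 <= m -> m <= `|z| -> m <= 1 ->
  poisson e z * m <= 4 * lorentz z.
Proof.
move=> /andP[e0 e1] m0 mz m1; have d := poisson_denom_gt0 z e0.
have h : 0 < 1 + z ^+ 2 by rewrite ltr_wpDr ?sqr_ge0.
rewrite ler_pdivlMr// [_ / _ * m]mulrAC [_ / _ * (1 + _)]mulrAC ler_pdivrMr//.
rewrite -(real_normK (num_real z)) in d h *; set w := `|z| in mz d h *.
have w0 : 0 <= w by exact: normr_ge0.
have em0 : 0 <= e * m by rewrite mulr_ge0// ltW.
have [w1|/ltW w1] := leP w 1.
  have h1 : e * m <= e * w by rewrite ler_wpM2l// ltW.
  have h2 : 1 + w ^+ 2 <= 2 by rewrite lerD2l expr2 mulr_ile1.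
  have h3 := ler_pM em0 (ltW h) h1 h2.
  by have := sqr_ge0 (e - w); have := sqr_ge0 e; have := sqr_ge0 w; lra.
have h1 : e * m <= 1 by rewrite mulr_ile1// ltW.
have h2 : 1 <= w ^+ 2 by rewrite expr2 -[leLHS]mulr1 ler_pM.
have h3 := ler_wpM2r (ltW h) h1.
by have := sqr_ge0 e; lra.
Qed.

Lemma integrable_poisson (e x : R) : 0 < e ->
  mu.-integrable setT (EFin \o (fun y : R => poisson e (y - x))).
Proof.
move=> e0; pose k := 2 * e * (1 + (e ^+ 2)^-1).
have e2 : 0 < e ^+ 2 by rewrite exprn_gt0.
have k0 : 0 <= k by rewrite !mulr_ge0 ?addr_ge0 ?invr_ge0// ltW.
apply: (@integrable_le _ _ _ (fun y => k * (2 * (1 + x ^+ 2)) * lorentz y)) => //.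
- exact: measurable_poisson.
- by apply: integrable_EFinZl => //; exact: lorentz_integrable.
move=> y _; have d := poisson_denom_gt0 (y - x) e0.
rewrite ger0_norm; last by rewrite !mulr_ge0 ?invr_ge0// ltW.
rewrite -[leRHS]mulrA; apply: (@le_trans _ _ (k * (1 + (y - x) ^+ 2)^-1)); last first.
  by rewrite ler_wpM2l// lorentz_translate.
rewrite /k -[leRHS]mulrA ler_wpM2l ?mulr_ge0 ?(ltW e0)//.
have h : 0 < 1 + (y - x) ^+ 2 by rewrite ltr_wpDr ?sqr_ge0.
rewrite ler_pdivlMr// ler_pdivrMl//.
rewrite (_ : _ * _ = 1 + (y - x) ^+ 2 + (e ^+ 2 + (y - x) ^+ 2 * (e ^+ 2)^-1)).
  rewrite lerDl; apply: addr_ge0; first exact: ltW.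
  by apply: mulr_ge0; [exact: sqr_ge0|rewrite invr_ge0 ltW].
by field; rewrite gt_eqF.
Qed.

Lemma Rintegral_poisson (e x : R) : 0 < e -> \int[mu]_y poisson e (y - x) = 2 * pi.
Proof.
move=> e0; pose g (y : R) := 2 * atan ((y - x) / e).
have gd (y : R) : is_derive y 1 g (poisson e (y - x)).
  have d0 : is_derive y 1 (fun y => (y - x) / e) e^-1.
    have h : is_derive y 1 (fun y => y - x) (1 - 0) by exact: (@is_derive1B _ id (fun=> x)).
    apply: (is_derive1_eq (@is_derive1M _ _ (fun=> e^-1) y _ 0 h _)).
    by rewrite subr0 mul1r mulr0 addr0.
  have d1 := @is_derive1_comp _ (@atan R) (fun y => (y - x) / e) y _ _ (is_derive1_atan _) d0.
  apply: (is_derive1_eq (is_derive1Zl 2 d1)).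
  rewrite (_ : 1 + _ ^+ 2 = (e ^+ 2 + (y - x) ^+ 2) / e ^+ 2); last by field; rewrite gt_eqF.
  by field; rewrite !gt_eqF ?poisson_denom_gt0.
have lim (w : R) : atan ((n%:R + w) / e) @[n --> \oo] --> pi / 2.
  have ei : 0 < e^-1 by rewrite invr_gt0.
  have h : atan ((r + w) / e) @[r --> +oo] --> pi / 2.
    have h0 : (r + w) / e @[r --> +oo] --> +oo by exact: (gt0_cvgMly ei (cvg_addrr w)).
    exact: (cvg_comp _ _ h0 (@cvgy_atan R)).
  have h1 : (n%:R : R) @[n --> \oo] --> +oo by exact: cvgr_idn.
  exact: (cvg_comp _ _ h1 h).
have -> : 2 * pi = 2 * (pi / 2) - 2 * - (pi / 2) :> R by move: pi => q; field.
apply: (Rintegral_derive_line gd (integrable_poisson x e0)).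
  by apply: cvgMr; exact: lim.
apply: cvgMr.
have -> : (fun n : nat => atan ((- n%:R - x) / e)) = (fun n => - atan ((n%:R + x) / e)).
  by apply/funext => n; rewrite -atanN -mulNr opprD.
by apply: cvgN; exact: lim.
Qed.

End Inversion.

Section FourierInversion.
Variable R : realType.
Local Notation mu := (@lebesgue_measure R).
Local Notation lorentz := (fun x : R => (1 + x ^+ 2)^-1).
Local Notation poisson e := (fun z : R => 2 * e / (e ^+ 2 + z ^+ 2)).

Lemma cintegral_real (h : R -> R) : mu.-integrable setT (EFin \o h) ->
  cintegrable setT (fun x => (h x)%:C) /\
  cintegral setT (fun x => (h x)%:C) = (\int[mu]_x h x)%:C.
Proof.
move=> hi; split; first by split; [exact: hi|exact: integrable0].
by apply: complex_ext => //=; rewrite /Rintegral integral0.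
Qed.

Lemma rapid_increment_le I (A : I -> R -> R[i]) : rapid_family A ->
  exists2 C : R, 0 <= C & forall i x y,
    normc (A i y - A i x) <= C * Num.min 1 `|y - x|.
Proof.
move=> hA; have [L hL] := rapid_decay (rapid_derive hA) 0%N.
have [B hB] := rapid_decay hA 0%N.
exists (`|2 * L| + `|B + B|); first exact: addr_ge0.
have dir i x y : x <= y -> normc (A i y - A i x) <= `|2 * L| * `|y - x|.
  move=> xy; have d := rapid_cderive hA i.
  have [c _ e1] := MVT_cc xy (fun z _ => proj1 (d z)).
  have [c' _ e2] := MVT_cc xy (fun z _ => proj2 (d z)).
  have n1 : `|re_part (A i) y - re_part (A i) x| <= L * `|y - x|.
    rewrite e1 normrM ler_wpM2r// (le_trans (normr_Re_le_normc _))//.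
    by have := hL i c; rewrite expr0 mul1r.
  have n2 : `|im_part (A i) y - im_part (A i) x| <= L * `|y - x|.
    rewrite e2 normrM ler_wpM2r// (le_trans (normr_Im_le_normc _))//.
    by have := hL i c'; rewrite expr0 mul1r.
  apply: (le_trans (normc_le_Re_Im _)); rewrite !ReImE.
  apply: (le_trans (lerD n1 n2)); rewrite -mulrDl (_ : L + L = 2 * L); last by ring.
  by rewrite ler_wpM2r// ler_norm.
move=> i x y.
have h1 : normc (A i y - A i x) <= `|2 * L| * `|y - x|.
  have [xy|/ltW yx] := leP x y; first exact: dir.
  by rewrite -normcN opprB distrC; exact: dir.
have h2 : normc (A i y - A i x) <= `|B + B|.
  apply: (le_trans (le_normcB _ _)); apply: le_trans (ler_norm _); apply: lerD.
    by have := hB i y; rewrite expr0 mul1r.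
  by have := hB i x; rewrite expr0 mul1r.
have [m1|m1] := leP 1 `|y - x|.
  by rewrite mulr1 (le_trans h2)// lerDr.
by rewrite mulrDl (le_trans h1)// lerDl mulr_ge0.
Qed.

Lemma cvg_poisson0 (z : R) : z != 0 -> poisson (n.+1%:R^-1 : R) z @[n --> \oo] --> (0 : R).
Proof.
move=> z0; have z2 : 0 < z ^+ 2 by rewrite exprn_even_gt0.
have lim : 2 / z ^+ 2 * n.+1%:R^-1 @[n --> \oo] --> (0 : R).
  by rewrite -[0](mulr0 (2 / z ^+ 2)); apply: cvgMr; exact: cvg_harmonic.
apply: (squeeze_cvgr _ (cvg_cst 0) lim); apply: nearW => n.
have e0 : 0 < n.+1%:R^-1 :> R by rewrite invr_gt0.
have d := poisson_denom_gt0 z e0.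
rewrite !mulr_ge0 ?invr_ge0 ?(ltW d) ?(ltW e0)//= [leRHS]mulrAC.
by rewrite ler_wpM2l ?mulr_ge0 ?(ltW e0)// lef_pV2 ?posrE// lerDr sqr_ge0.
Qed.

(** Damping the inner transform by [exp (- e |p|)] turns the double integral
    into the Poisson average of the function, which tends to its value. *)
Lemma fourier_inversion (s : R) I (A : I -> R -> R[i]) : `|s| = 1 -> rapid_family A ->
  forall i x, fourier_sign (- s) (fourier_sign s (A i)) x = (2 * pi)%:C * A i x.
Proof.
move=> s1 hA i x; set phi := A i; set psi := fourier_sign s phi.
have phii : cintegrable setT phi := rapid_cintegrable i hA.
have psii : cintegrable setT psi := rapid_cintegrable i (fourier_sign_family s1 hA).
pose e (n : nat) : R := n.+1%:R^-1.
have e0 n : 0 < e n by rewrite invr_gt0.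
have e1 n : e n <= 1 by rewrite invf_le1// ler1n.
have psixi : cintegrable setT (fun p => psi p * expi (- s * (p * x))).
  by apply: cintegrable_expiM => //; exact: measurable_phase.
pose L n := cintegral setT (fun p => (expR (- e n * `|p|))%:C * (psi p * expi (- s * (p * x)))).
have Lcvg : ccvg_to \oo L (fourier_sign (- s) psi x).
  have -> : fourier_sign (- s) psi x = cintegral setT
      (fun p => (1 : R)%:C * (psi p * expi (- s * (p * x)))).
    by apply: eq_cintegral => p _; rewrite mul1r.
  apply: (@dominated_cvg_cintegral _ _ _ (fun=> 1) (fun p => normc (psi p))) => //.
  - exact: cintegrable_measurable.
  - move=> n; apply: measurableT_comp => //.
    by apply: measurable_funM => //; exact: measurableT_comp.
  - move=> p _; rewrite -[1]expR0.
    apply: continuous_cvg; first exact: continuous_expR.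
    rewrite -[0](mul0r `|p|); apply: cvgMl; rewrite -[0]oppr0; apply: cvgN.
    exact: cvg_harmonic.
  - exact: integrable_normc.
  - move=> n p; rewrite normcM normc_expi mulr1 ler_piMl ?normc_ge0//.
    rewrite ger0_norm ?expR_ge0// -expR0 ler_expR mulNr oppr_le0 mulr_ge0//.
    exact: ltW.
pose a n p := (expR (- e n * `|p|))%:C * expi (- s * x * p).
have ai n : cintegrable setT (a n) := (poisson_kernel (- s * x) (e0 n)).1.
have s2 : s ^+ 2 = 1 by rewrite -(real_normK (num_real s)) s1 expr1n.
have Fa n y : fourier_sign s (a n) y = (poisson (e n) (y - x))%:C.
  transitivity (cintegral setT (fun p => (expR (- e n * `|p|))%:C * expi (s * (y - x) * p))).
    apply: eq_cintegral => p _; rewrite /a -mulrA -expiD; congr (_ * expi _); ring.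
  by rewrite (poisson_kernel _ (e0 n)).2 exprMn s2 mul1r.
have [pi_ LE] : (forall n, cintegrable setT (fun y => phi y * fourier_sign s (a n) y)) /\
    forall n, L n = cintegral setT (fun y => phi y * fourier_sign s (a n) y).
  split=> n; first by case: (fourier_sign_multiplication s phii (ai n)).
  have [_ <-] := fourier_sign_multiplication s (ai n) phii.
  by apply: eq_cintegral => p _; rewrite /a -mulrA [psi p * _]mulrC; congr (_ * (expi _ * _)); ring.
pose D n := cintegral setT (fun y => (poisson (e n) (y - x))%:C * (phi y - phi x)).
have DE n : L n = D n + (2 * pi)%:C * phi x.
  have [ri re] := cintegral_real (integrable_poisson x (e0 n)).
  have rxi := cintegrableZl (phi x) measurableT ri.
  have := cintegralZl (phi x) measurableT ri.
  rewrite re Rintegral_poisson// [_ * _%:C]mulrC => <-.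
  rewrite LE /D -cintegralD//; last first.
    apply: eq_cintegrable (cintegrableD measurableT (pi_ n) (cintegrableN measurableT rxi)) => //.
    by move=> y _ /=; rewrite Fa; ring.
  by apply: eq_cintegral => y _; rewrite Fa; ring.
have [C C0 hC] := rapid_increment_le hA.
have Dcvg : ccvg_to \oo D 0.
  have -> : 0 = cintegral setT (fun y => (0 : R)%:C * (phi y - phi x)).
    rewrite (_ : (fun y => _) = fun=> (0 : R)%:C); last by apply/funext => y; rewrite mul0r.
    by apply: complex_ext; rewrite /= /Rintegral integral0.
  apply: (@dominated_cvg_cintegral _ _ _ (fun=> 0)
    (fun y => C * 4 * (2 * (1 + x ^+ 2)) * lorentz y)) => //.
  - apply: cmeasurableD; first exact: cintegrable_measurable.
    exact: cmeasurable_cst.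
  - by move=> n; exact: measurable_poisson.
  - move=> y g0; apply: cvg_poisson0; apply: contraNneq g0 => /eqP.
    by rewrite subr_eq0 => /eqP ->; rewrite subrr.
  - by apply: integrable_EFinZl => //; exact: lorentz_integrable.
  move=> n y; have d := poisson_denom_gt0 (y - x) (e0 n).
  rewrite ger0_norm; last by rewrite !mulr_ge0 ?invr_ge0 ?(ltW d) ?(ltW (e0 n)).
  apply: (@le_trans _ _ (poisson (e n) (y - x) * (C * Num.min 1 `|y - x|))).
    by rewrite ler_wpM2l ?hC// !mulr_ge0 ?invr_ge0 ?(ltW d) ?(ltW (e0 n)).
  rewrite mulrCA -[C * 4 * _]mulrA -[leRHS]mulrA ler_wpM2l//.
  apply: (@le_trans _ _ (4 * lorentz (y - x))).
    have en : 0 < e n <= 1 by rewrite e0 e1.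
    apply: (poisson_le en).
    - by rewrite le_min ler01 normr_ge0.
    - by rewrite ge_min lexx orbT.
    - by rewrite ge_min lexx.
  by rewrite -[leRHS]mulrA ler_wpM2l//; exact: lorentz_translate.
have [L1 L2] := Lcvg; have [D1 D2] := Dcvg.
have E1 : complex.Re (L n) @[n --> \oo] --> 0 + complex.Re ((2 * pi)%:C * phi x).
  by under eq_fun do rewrite DE ReD; apply: cvgD; [exact: D1|exact: cvg_cst].
have E2 : complex.Im (L n) @[n --> \oo] --> 0 + complex.Im ((2 * pi)%:C * phi x).
  by under eq_fun do rewrite DE ImD; apply: cvgD; [exact: D2|exact: cvg_cst].
rewrite add0r in E1; rewrite add0r in E2.
by apply: complex_ext; [exact: (cvg_unique _ L1 E1)|exact: (cvg_unique _ L2 E2)].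
Qed.

End FourierInversion.

(** * Functions of two variables with equal partial derivatives *)

Section Baire.
Variable R : realType.
Implicit Types (P : set R) (E : (set R)^nat).

(** Baire's theorem: if no [E n] contained a portion of [P], one could choose
    nested intervals, the [n]-th missing [E n], around points of [P]; their common
    point would lie in [P] and in no [E n]. *)
Lemma closed_cover_interior P E : closed P -> (forall n, closed (E n)) ->
  P !=set0 -> (forall x, P x -> exists n, E n x) ->
  exists n x, P x /\ exists2 e : R, 0 < e & forall y, P y -> `|y - x| < e -> E n y.
Proof.
move=> cP cE [x0 Px0] PE; apply: contrapT => none.
pose S := {z : R * R | P z.1 /\ 0 < z.2}.
have step (n : nat) (z : S) : exists w : S,
    [/\ (sval w).2 <= (sval z).2 / 2,
        `|(sval w).1 - (sval z).1| <= (sval z).2 / 2 &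
        forall y, `|y - (sval w).1| <= (sval w).2 -> ~ E n y].
  case: z => [[x e] /= [Px e0]].
  have e20 : 0 < e / 2 by rewrite divr_gt0.
  have [y [Py yx nEy]] : exists y, [/\ P y, `|y - x| < e / 2 & ~ E n y].
    apply: contrapT => H; apply: none; exists n, x; split => //; exists (e / 2) => // y Py yx.
    by apply: contrapT => nEy; apply: H; exists y.
  have : nbhs y (~` E n) by apply: open_nbhs_nbhs; split => //; exact: closed_openC.
  move=> /nbhs_ballP[d /= d0 dE].
  have m0 : 0 < Num.min (d / 2) (e / 2) by rewrite lt_min !divr_gt0.
  exists (exist _ (y, Num.min (d / 2) (e / 2)) (conj Py m0)) => /=; split.
  - by rewrite ge_min lexx orbT.
  - exact: ltW.
  - move=> z; rewrite le_min => /andP[zy _]; apply: dE; rewrite /ball/= distrC.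
    by apply: le_lt_trans zy _; rewrite ltr_pdivrMr// ltr_pMr// ltr1n.
have /choice[F FP] : forall nz : nat * S, exists w : S,
    [/\ (sval w).2 <= (sval nz.2).2 / 2,
        `|(sval w).1 - (sval nz.2).1| <= (sval nz.2).2 / 2 &
        forall y, `|y - (sval w).1| <= (sval w).2 -> ~ E nz.1 y].
  by move=> [n z]; exact: step.
pose s := fix s n := if n is n'.+1 then F (n', s n') else
  exist _ (x0, 1) (conj Px0 ltr01) : S.
pose x n := (sval (s n)).1; pose e n := (sval (s n)).2.
have e0 n : 0 < e n by have [] := svalP (s n).
have Px n : P (x n) by have [] := svalP (s n).
have nest n : [/\ e n.+1 <= e n / 2, `|x n.+1 - x n| <= e n / 2 &
    forall y, `|y - x n.+1| <= e n.+1 -> ~ E n y] by exact: (FP (n, s n)).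
pose a n := x n - e n.
have incl m n : (m <= n)%N -> a m <= a n /\ x n + e n <= x m + e m.
  move=> /subnKC <-; elim: (n - m)%N => [|k [ih1 ih2]]; first by rewrite addn0.
  rewrite addnS; have [h1 + _] := nest (m + k)%N; rewrite ler_norml => /andP[h2 h3].
  by move: ih1 ih2; rewrite /a; split; lra.
have ub n m : a m <= x n + e n.
  have [mn|nm] := leqP m n; first by have [h _] := incl m n mn; rewrite (le_trans h)// /a; have := e0 n; lra.
  have [_ h] := incl n m (ltnW nm); rewrite (le_trans _ h)// /a.
  by have := e0 m; lra.
pose c := sup (range a).
have hs : has_sup (range a).
  by split; [exists (a 0%N), 0%N|exists (x 0%N + e 0%N) => _ [m _ <-]].
have cx n : `|c - x n| <= e n.
  rewrite ler_distl; apply/andP; split.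
    by rewrite -/(a n); apply: ub_le_sup; [case: hs|exists n].
  by apply: ge_sup; [case: hs|move=> _ [m _ <-]].
have e_le n : e n <= (1 / 2) ^+ n.
  elim: n => [|n ih]; first by rewrite expr0.
  by rewrite exprS; have [h _ _] := nest n; rewrite (le_trans h)//; lra.
have Pc : P c.
  apply: cP => U /nbhs_ballP[d /= d0 dU].
  have : \forall n \near \oo, `|(1 / 2 : R) ^+ n| < d.
    by apply: cvgr0_norm_lt => //; apply: cvg_expr; rewrite ger0_norm//; lra.
  move=> [N _ /(_ N (leqnn _))]; rewrite ger0_norm ?exprn_ge0// => Nd.
  exists (x N); split => //; apply: dU; rewrite /ball/=.
  by rewrite (le_lt_trans (cx N))// (le_lt_trans (e_le N)).
have [n Enc] := PE c Pc.
by have [_ _ /(_ c (cx n.+1))] := nest n.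
Qed.

End Baire.

(** [K s tau] has [D] as derivative in [s] and as derivative in [tau], the latter
    with a quadratic remainder that is uniform in [tau] but not in [s]. Although
    [D] need not be continuous in the two variables together, [K] is constant on
    the segment [s + tau = T]. *)
Section EqualPartials.
Variable R : realType.
Variables (K D : R -> R -> R) (T : R).
Hypothesis T_gt0 : 0 < T.
Hypothesis Kd : forall tau s : R, 0 <= s <= T -> forall eps : R, 0 < eps ->
  exists2 d : R, 0 < d & forall s', 0 <= s' <= T -> `|s' - s| < d ->
    `|K s' tau - K s tau - (s' - s) * D s tau| <= eps * `|s' - s|.
Hypothesis Dc : forall tau s : R, 0 <= s <= T -> forall eps : R, 0 < eps ->
  exists2 d : R, 0 < d & forall s', 0 <= s' <= T -> `|s' - s| < d ->
    `|D s' tau - D s tau| <= eps.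
Hypothesis K2 : forall s : R, 0 <= s <= T -> exists n : nat, forall tau h,
  `|tau| <= T + 1 -> `|h| <= 1 ->
  `|K s (tau + h) - K s tau - h * D s tau| <= n%:R * h ^+ 2.

Let Kc tau s : 0 <= s <= T -> forall eps : R, 0 < eps ->
  exists2 d : R, 0 < d & forall s', 0 <= s' <= T -> `|s' - s| < d ->
    `|K s' tau - K s tau| <= eps.
Proof.
move=> sT eps eps0; have [d1 d10 H1] := Kd tau sT ltr01.
pose m := 1 + `|D s tau|; have m0 : 0 < m by rewrite ltr_wpDr.
exists (Num.min d1 (eps / m)); first by rewrite lt_min d10 divr_gt0.
move=> s' s'T; rewrite lt_min => /andP[h1 h2].
have := H1 s' s'T h1; rewrite ltr_pdivlMr// in h2.
move=> h3; apply: le_trans (ltW h2).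
have : `|K s' tau - K s tau| <= `|K s' tau - K s tau - (s' - s) * D s tau| + `|s' - s| * `|D s tau|.
  by rewrite -normrM (le_trans _ (ler_normD _ _))// subrK.
by rewrite /m mulrDr mulr1; move: h3; rewrite mul1r; lra.
Qed.

(** The restriction to the antidiagonal of level [c], of formal derivative
    [D - D = 0]. *)
Let v c s := K s (c - s).

Let good s := exists2 e : R, 0 < e & forall s', 0 <= s' <= T -> `|s' - s| < e ->
  forall c, `|c - T| < 1 -> v c s' = v c s.

Let P : set R := [set s | 0 <= s <= T /\ ~ good s].

(** The points with quadratic remainders of constant [n]; they cover [[0, T]]. *)
Let En (n : nat) : set R := [set s | 0 <= s <= T /\ forall tau h,
  `|tau| <= T + 1 -> `|h| <= 1 ->
  `|K s (tau + h) - K s tau - h * D s tau| <= n%:R * h ^+ 2].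

Let outside_itv (s : R) : ~ (0 <= s <= T) ->
  exists2 e : R, 0 < e & forall s', `|s' - s| < e -> ~ (0 <= s' <= T).
Proof.
move=> /negP; rewrite negb_and -!ltNge => /orP[s0|sT].
  exists (- s); first by rewrite oppr_gt0.
  by move=> s'; rewrite ltr_distl => /andP[h3 h4] /andP[h1 h2]; lra.
exists (s - T); first by rewrite subr_gt0.
by move=> s'; rewrite ltr_distl => /andP[h3 h4] /andP[h1 h2]; lra.
Qed.

Let closed_of_compl (A : set R) :
  (forall s, ~ A s -> exists2 e : R, 0 < e & forall s', `|s' - s| < e -> ~ A s') ->
  closed A.
Proof.
move=> H; rewrite -[A]setCK; apply: open_closedC; rewrite openE => s /H[e e0 he].
by apply/nbhs_ballP; exists e => // s'; rewrite /ball/= distrC => /he.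
Qed.

Let closed_En n : closed (En n).
Proof.
apply: closed_of_compl => s nE.
have [sT|/outside_itv[e e0 h]] := pselect (0 <= s <= T); last first.
  by exists e => // s' /h + [].
have [tau [h [htau hh]]] : exists tau h, [/\ `|tau| <= T + 1, `|h| <= 1 &
    n%:R * h ^+ 2 < `|K s (tau + h) - K s tau - h * D s tau|].
  apply: contrapT => H; apply: nE; split => // tau h h1 h2.
  by rewrite leNgt; apply/negP => h3; apply: H; exists tau, h.
set g := `|_| => ng; pose eps := (g - n%:R * h ^+ 2) / 4.
have eps0 : 0 < eps by rewrite divr_gt0// subr_gt0.
have [d1 d10 H1] := Kc (tau + h) sT eps0.
have [d2 d20 H2] := Kc tau sT eps0.
have [d3 d30 H3] := Dc tau sT eps0.
exists (Num.min d1 (Num.min d2 d3)); first by rewrite !lt_min d10 d20.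
move=> s'; rewrite !lt_min => /and3P[l1 l2 l3] [s'T /(_ tau h htau hh) le].
have k1 := H1 s' s'T l1; have k2 := H2 s' s'T l2; have k3 := H3 s' s'T l3.
have k3' : `|h * (D s' tau - D s tau)| <= eps.
  by rewrite normrM (le_trans _ k3)// ler_piMl.
have : g <= n%:R * h ^+ 2 + eps + eps + eps.
  rewrite /g; set X' := K s' (tau + h) in k1 le *; set Y' := K s' tau in k2 le *.
  have -> : K s (tau + h) - K s tau - h * D s tau =
    (X' - Y' - h * D s' tau) - (X' - K s (tau + h)) + (Y' - K s tau) + h * (D s' tau - D s tau).
    by ring.
  apply: (le_trans (ler_normD _ _)); apply: lerD => //.
  apply: (le_trans (ler_normD _ _)); apply: lerD => //.
  by apply: (le_trans (ler_normB _ _)); apply: lerD.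
by rewrite /eps; lra.
Qed.

Let closed_P : closed P.
Proof.
apply: closed_of_compl => s nP.
have [sT|/outside_itv[e e0 h]] := pselect (0 <= s <= T); last first.
  by exists e => // s' /h + [].
have [e e0 h] : good s by apply: contrapT => ng; apply: nP.
exists e => // s' s'e [s'T]; apply; exists (e - `|s' - s|); first by rewrite subr_gt0.
move=> s'' s''T s''e c cT; rewrite (h s'')// ?(h s')//.
rewrite -(subrK s' s'') -addrA (le_lt_trans (ler_normD _ _))//.
by rewrite -ltrBrDr.
Qed.

(** Adding a multiple [k > 0] of the identity to [w] or to [- w] gives a locally
    nondecreasing function; then [k] tends to 0. *)
Let flat_eq (w : R -> R) (a b : R) : a <= b ->
  (forall s, a <= s <= b -> forall eps : R, 0 < eps ->
    exists2 d : R, 0 < d & forall s', a <= s' <= b -> `|s' - s| < d ->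
      `|w s' - w s| <= eps * `|s' - s|) -> w a = w b.
Proof.
move=> ab hw.
have half (u : R -> R) : (forall s, a <= s <= b -> forall eps : R, 0 < eps ->
    exists2 d : R, 0 < d & forall s', a <= s' <= b -> `|s' - s| < d ->
      `|u s' - u s| <= eps * `|s' - s|) -> u a <= u b.
  move=> hu; apply/ler_addgt0Pr => eps eps0.
  have m0 : 0 < b - a + 1 by rewrite ltr_wpDl// subr_ge0.
  pose k := eps / (b - a + 1); have k0 : 0 < k by rewrite divr_gt0.
  have := @locally_nondecreasing _ (fun s => u s + k * s) a b ab.
  have H : forall x, a <= x <= b -> exists2 e : R, 0 < e & forall y, a <= y <= b ->
      `|y - x| < e -> (x <= y -> u x + k * x <= u y + k * y) /\
        (y <= x -> u y + k * y <= u x + k * x).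
    move=> x xab; have [d d0 hd] := hu x xab k k0; exists d => // y yab yx.
    have := hd y yab yx; rewrite ler_norml => /andP[h1 h2]; split => xy.
      by move: h1; rewrite ger0_norm ?subr_ge0//; lra.
    by move: h2; rewrite ler0_norm ?subr_le0//; lra.
  move=> /(_ H) h; have : k * (b - a) <= eps.
    rewrite /k mulrAC ler_pdivrMr// ler_wpM2l ?(ltW eps0)//; lra.
  by move: h; lra.
apply/eqP; rewrite eq_le half//=.
rewrite -lerN2; apply: (half (fun s => - w s)) => s sab eps eps0.
by have [d d0 h] := hw s sab eps eps0; exists d => // s' s'ab /h; rewrite -opprD normrN; exact.
Qed.

(** For [y] close to [q] on the segment, [K q (c - q)] is close to [K y (c - q)],
    the value at [y] of the antidiagonal of level [c + (y - q)]. That antidiagonal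
    is constant between [y] and [s], so this value is [K s (c + (y - q) - s)],
    which is close to [K s (c - s)]. Each step varies one variable only. *)
Let component_end (q s : R) (c : R) : 0 <= q <= T -> 0 <= s <= T -> `|c - T| < 1 ->
  (forall l, 0 < l <= 1 -> good (q + l * (s - q))) -> v c q = v c s.
Proof.
move=> qT sT cT gl.
have seg l : 0 <= l <= 1 -> 0 <= q + l * (s - q) <= T.
  move=> /andP[l0 l1]; move/andP: qT => [q0 q1]; move/andP: sT => [s0 s1].
  have : 0 <= (1 - l) * q + l * s by rewrite addr_ge0 ?mulr_ge0// subr_ge0.
  have : (1 - l) * q + l * s <= (1 - l) * T + l * T.
    by apply: lerD; rewrite ler_wpM2l ?subr_ge0.
  by move=> h1 h2; apply/andP; split; lra.
have vconst l c' : 0 < l <= 1 -> `|c' - T| < 1 -> v c' (q + l * (s - q)) = v c' s.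
  move=> /andP[l0 l1] c'T.
  have := @flat_eq (fun k => v c' (q + k * (s - q))) l 1 l1.
  rewrite mul1r subrKC; apply => k /andP[lk k1] eps eps0.
  have k01 : 0 < k <= 1 by rewrite (lt_le_trans l0 lk).
  have [e e0 he] := gl k k01.
  have m0 : 0 < `|s - q| + 1 by rewrite ltr_wpDl.
  exists (e / (`|s - q| + 1)); first by rewrite divr_gt0.
  move=> k' /andP[lk' k'1]; rewrite ltr_pdivlMr// => h.
  rewrite he ?subrr ?normr0 ?mulr_ge0 ?(ltW eps0)//.
    by apply: seg; rewrite k'1 (le_trans (ltW l0) lk').
  have -> : q + k' * (s - q) - (q + k * (s - q)) = (k' - k) * (s - q) by ring.
  rewrite normrM; apply: le_lt_trans h.
  by rewrite ler_wpM2l// lerDl.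
have [n hn] := K2 sT.
apply/eqP; rewrite -subr_eq0 -normr_le0; apply/ler_addgt0Pr => eps eps0; rewrite add0r.
have eps20 : 0 < eps / 2 by rewrite divr_gt0.
have [d d0 hd] := Kc (c - q) qT eps20.
pose tau := c - s.
have tau_le : `|tau| <= T + 1.
  move: cT; rewrite ltr_distl => /andP[c1 c2]; move/andP: sT => [s0 s1].
  by rewrite /tau ler_norml; apply/andP; split; lra.
pose L := n%:R + `|D s tau| + 1.
have L0 : 0 < L by rewrite ltr_wpDl// addr_ge0.
pose gap := 1 - `|c - T|; have gap0 : 0 < gap by rewrite subr_gt0.
pose W := `|s - q| + 1; have W0 : 0 < W by rewrite ltr_wpDl.
(* small enough for all the bounds [h1] to [h4] below *)
pose l := Num.min 1 (Num.min (d / (2 * W)) (Num.min (eps / 2 / (L * W)) (Num.min (gap / (2 * W)) W^-1))).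
have l0 : 0 < l by rewrite !lt_min ltr01 !divr_gt0 ?mulr_gt0 ?invr_gt0.
have l1 : l <= 1 by rewrite ge_min lexx.
have lW (X : R) : l <= X / (2 * W) -> 0 < X -> `|l * (s - q)| < X.
  move=> h X0; rewrite normrM (gtr0_norm l0).
  apply: (@le_lt_trans _ _ (X / (2 * W) * W)).
    by apply: ler_pM => //; [exact: ltW|rewrite /W lerDl].
  rewrite invfM mulrA divfK ?gt_eqF//; lra.
have h1 : `|l * (s - q)| < d by apply: lW => //; rewrite !ge_min lexx !orbT.
have h2 : `|l * (s - q)| < gap by apply: lW => //; rewrite !ge_min lexx !orbT.
have h3 : `|l * (s - q)| <= 1.
  rewrite normrM (gtr0_norm l0); apply: (@le_trans _ _ (W^-1 * W)); last by rewrite mulVf// gt_eqF.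
  by apply: ler_pM => //; [exact: ltW|rewrite !ge_min lexx !orbT|rewrite /W lerDl].
have h4 : L * `|l * (s - q)| <= eps / 2.
  rewrite normrM (gtr0_norm l0) -ler_pdivlMl// [leRHS]mulrC.
  apply: (@le_trans _ _ (eps / 2 / (L * W) * W)).
    by apply: ler_pM => //; [exact: ltW|rewrite !ge_min lexx !orbT|rewrite /W lerDl].
  by rewrite invfM mulrA divfK ?gt_eqF.
pose h := l * (s - q); pose y := q + h.
have l01 : 0 < l <= 1 by rewrite l0.
have yT : 0 <= y <= T by apply: seg; rewrite l1 ltW.
have hy := hd y yT; rewrite /y addrAC subrr add0r in hy; have {}hy := hy h1.
have cy : `|c + h - T| < 1.
  rewrite addrAC (le_lt_trans (ler_normD _ _))// -ltrBrDl; exact: h2.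
have e1 : K y (c - q) = K s (tau + h).
  have := vconst l (c + h) l01 cy; rewrite /v -/h -/y /y.
  rewrite (_ : c + h - (q + h) = c - q); last by ring.
  by rewrite (_ : c + h - s = tau + h); last by rewrite /tau; ring.
have := hn tau h tau_le h3; rewrite -e1 => k1.
rewrite /v -/tau.
have k2 : `|h * D s tau| <= `|h| * `|D s tau| by rewrite normrM.
have k3 : n%:R * h ^+ 2 <= n%:R * `|h|.
  by rewrite ler_wpM2l// -real_normK ?num_real// expr2 ler_piMl.
have k4 : `|K q (c - q) - K s tau| <=
    `|K y (c - q) - K q (c - q)| + `|K y (c - q) - K s tau - h * D s tau| + `|h * D s tau|.
  have -> : K q (c - q) - K s tau = - (K y (c - q) - K q (c - q)) +
     (K y (c - q) - K s tau - h * D s tau) + h * D s tau by ring.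
  apply: (le_trans (ler_normD _ _)); rewrite lerD2r.
  by apply: (le_trans (ler_normD _ _)); rewrite normrN.
have hy' : `|K y (c - q) - K q (c - q)| <= eps / 2 by exact: hy.
have h5 : n%:R * `|h| + `|h| * `|D s tau| <= eps / 2.
  by apply: le_trans h4; rewrite /L -/h [X in _ + X]mulrC -mulrDl ler_wpM2r// lerDl.
rewrite (le_trans k4)//; move: k1 k2 k3 h5 hy'; clear; lra.
Qed.

Let between_closed (s s' : R) : closed [set l : R | 0 <= l <= 1 /\ P (s + l * (s' - s))].
Proof.
apply: closed_of_compl => l nl.
have [l01|nl01] := pselect (0 <= l <= 1); last first.
  have /negP := nl01; rewrite negb_and -!ltNge => /orP[h|h].
    exists (- l); first by rewrite oppr_gt0.
    by move=> k; rewrite ltr_distl => /andP[h3 h4] [/andP[h1 h2]]; lra.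
  exists (l - 1); first by rewrite subr_gt0.
  by move=> k; rewrite ltr_distl => /andP[h3 h4] [/andP[h1 h2]]; lra.
have nP : ~ P (s + l * (s' - s)) by move=> h; apply: nl.
have : nbhs (s + l * (s' - s)) (~` P) by apply: open_nbhs_nbhs; split => //; exact: closed_openC.
move=> /nbhs_ballP[e /= e0 eP].
have m0 : 0 < `|s' - s| + 1 by rewrite ltr_wpDl.
exists (e / (`|s' - s| + 1)); first by rewrite divr_gt0.
move=> k; rewrite ltr_pdivlMr// => h [_]; apply: eP; rewrite /ball/=.
have -> : s + l * (s' - s) - (s + k * (s' - s)) = - ((k - l) * (s' - s)) by ring.
by rewrite normrN normrM; apply: le_lt_trans h; rewrite ler_wpM2l// lerDl.
Qed.

(** If the closed set [P] of bad points is nonempty, by Baire's theorem some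
    portion of it lies in a single [En n]. There the remainders are uniformly
    quadratic, so [v c] has derivative zero relative to [P]; in a gap of [P] it is
    constant up to the endpoints. So [v c] is constant around the portion, whose
    points are therefore good. *)
Lemma P_empty : P = set0.
Proof.
apply: contrapT => /eqP/set0P P0.
have [n [x0 [Px0 [e0 e00 hP]]]] : exists n x, P x /\
    exists2 e : R, 0 < e & forall y, P y -> `|y - x| < e -> En n y.
  apply: closed_cover_interior => // x [xT _].
  by have [n hn] := K2 xT; exists n.
have [x0T +] := Px0; apply; exists e0 => // s1 s1T s1e c cT.
have zero (s : R) : 0 <= s <= T -> `|s - x0| < e0 -> forall eps : R, 0 < eps ->
    exists2 d : R, 0 < d & forall s', 0 <= s' <= T -> `|s' - x0| < e0 -> `|s' - s| < d ->
      `|v c s' - v c s| <= eps * `|s' - s|.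
  move=> sT se eps eps0; have [Ps|nPs] := pselect (P s); last first.
    have [e e_gt0 he] : good s by apply: contrapT => ng; apply: nPs.
    exists e => // s' s'T _ s's; rewrite he// subrr normr0 mulr_ge0// ltW//.
  pose tau := c - s.
  have tauT : `|tau| <= T + 1.
    move: cT; rewrite ltr_distl => /andP[c1' c2']; move/andP: sT => [s0' s1'].
    by rewrite /tau ler_norml; apply/andP; split; lra.
  have eps30 : 0 < eps / 3 by rewrite divr_gt0.
  have [d1 d10 H1] := Kd tau sT eps30.
  have [d2 d20 H2] := Dc tau sT eps30.
  have n10 : 0 < n%:R + 1 :> R by rewrite ltr_wpDl.
  pose d := Num.min 1 (Num.min d1 (Num.min d2 (eps / 3 / (n%:R + 1)))).
  have d0 : 0 < d by rewrite !lt_min ltr01 d10 d20 !divr_gt0.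
  have onP q : P q -> `|q - x0| < e0 -> `|q - s| < d ->
      `|v c q - v c s| <= eps * `|q - s|.
    move=> Pq qe; rewrite !lt_min => /and4P[l1 l2 l3 l4].
    have [qT hq] := hP q Pq qe.
    have h1 : `|s - q| <= 1 by rewrite distrC ltW.
    have k1 := hq tau (s - q) tauT h1.
    have k2 := H1 q qT l2; have k3 := H2 q qT l3.
    have k4 : `|(s - q) * (D q tau - D s tau)| <= eps / 3 * `|q - s|.
      by rewrite normrM distrC mulrC ler_wpM2r.
    have k5 : n%:R * (s - q) ^+ 2 <= eps / 3 * `|q - s|.
      rewrite -real_normK ?num_real// distrC expr2 mulrA ler_wpM2r//.
      apply: (@le_trans _ _ ((n%:R + 1) * `|q - s|)); first by rewrite ler_wpM2r// lerDl.
      by rewrite mulrC -ler_pdivlMr// ltW.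
    have -> : v c q - v c s = (K q (tau + (s - q)) - K q tau - (s - q) * D q tau) +
        (K q tau - K s tau - (q - s) * D s tau) + (s - q) * (D q tau - D s tau).
      by rewrite /v -/tau (_ : c - q = tau + (s - q)); [ring|rewrite /tau; ring].
    have -> : eps * `|q - s| = eps / 3 * `|q - s| + eps / 3 * `|q - s| + eps / 3 * `|q - s|.
      by field.
    apply: (le_trans (ler_normD _ _)); apply: lerD => //.
    apply: (le_trans (ler_normD _ _)); apply: lerD => //.
    exact: le_trans k1 k5.
  exists d => // s' s'T s'e s's.
  (* the last bad point on the way from [s] to [s'] *)
  pose A := [set l : R | 0 <= l <= 1 /\ P (s + l * (s' - s))].
  have A0' : A !=set0 by exists 0; split; [rewrite lexx ler01|rewrite mul0r addr0].
  have hA : has_sup A by split; [exact: A0'|exists 1 => l [/andP[]]].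
  pose l := sup A; have Al : A l.
    have cA : closed A by exact: between_closed.
    by apply: cA; apply: closure_sup; [exact: A0'|case: hA].
  have [/andP[l0 l1] Pl] := Al; set q := s + l * (s' - s) in Pl.
  have qT : 0 <= q <= T by case: Pl.
  have qs : q - s = l * (s' - s) by rewrite /q addrAC subrr add0r.
  have qs_le : `|q - s| <= `|s' - s| by rewrite qs normrM (ger0_norm l0) ler_piMl.
  have qe : `|q - x0| < e0.
    have -> : q - x0 = (1 - l) * (s - x0) + l * (s' - x0) by rewrite /q; ring.
    apply: (le_lt_trans (ler_normD _ _)); rewrite !normrM (ger0_norm l0) ger0_norm ?subr_ge0//.
    move: l0; rewrite le_eqVlt => /predU1P[<-|l0]; first by rewrite subr0 mul1r mul0r addr0.
    have : (1 - l) * `|s - x0| <= (1 - l) * e0 by rewrite ler_wpM2l ?subr_ge0// ltW.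
    have : l * `|s' - x0| < l * e0 by rewrite ltr_pM2l.
    by lra.
  have -> : v c s' = v c q.
    have [le1|ln1] := eqVneq l 1; first by rewrite /q le1 mul1r subrKC.
    have l1' : l < 1 by rewrite lt_neqAle ln1.
    apply: esym; apply: component_end => // k /andP[k0 k1].
    have ptE : q + k * (s' - q) = s + (l + k * (1 - l)) * (s' - s) by rewrite /q; ring.
    have kl : 0 < k * (1 - l) by rewrite mulr_gt0// subr_gt0.
    apply: contrapT => ng.
    have : A (l + k * (1 - l)).
      have kl1 : k * (1 - l) <= 1 - l by rewrite ler_piMl// subr_ge0.
      split; first by apply/andP; split; lra.
      rewrite -ptE; split => //.
      have -> : q + k * (s' - q) = (1 - k) * q + k * s' by ring.
      move/andP: qT => [q0 q1]; move/andP: s'T => [s0 s1'].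
      have k1' : 0 <= 1 - k by rewrite subr_ge0.
      have := ler_wpM2l k1' q1; have := ler_wpM2l (ltW k0) s1'.
      have := mulr_ge0 k1' q0; have := mulr_ge0 (ltW k0) s0.
      by move=> h1 h2 h3 h4; apply/andP; split; lra.
    by move=> /(sup_upper_bound hA); rewrite -/l; lra.
  apply: (le_trans (onP q Pl qe (le_lt_trans qs_le s's))).
  by rewrite ler_wpM2l// ltW.
move: s1T s1e => /andP[s10 s11] s1e; move: x0T => /andP[x00 x01].
have [xs|/ltW sx] := leP x0 s1.
  apply: esym; apply: flat_eq => // s /andP[h1 h2] eps eps0.
  have sT : 0 <= s <= T by apply/andP; split; lra.
  have se : `|s - x0| < e0 by move: s1e; rewrite !ger0_norm ?subr_ge0//; lra.
  have [d d0 hd] := zero s sT se eps eps0; exists d => // s' /andP[h3 h4] h5; apply: hd => //.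
    by apply/andP; split; lra.
  by move: s1e; rewrite !ger0_norm ?subr_ge0//; lra.
apply: flat_eq => // s /andP[h1 h2] eps eps0.
have sT : 0 <= s <= T by apply/andP; split; lra.
have se : `|s - x0| < e0 by move: s1e; rewrite !ler0_norm ?subr_le0//; lra.
have [d d0 hd] := zero s sT se eps eps0; exists d => // s' /andP[h3 h4] h5; apply: hd => //.
  by apply/andP; split; lra.
by move: s1e; rewrite !ler0_norm ?subr_le0//; lra.
Qed.

Lemma equal_partials_antidiagonal : K T 0 = K 0 T.
Proof.
have gd s : 0 <= s <= T -> good s.
  by move=> sT; apply: contrapT => ng; have : P s by []; rewrite P_empty.
have := @flat_eq (v T) 0 T (ltW T_gt0); rewrite /v subrr subr0 => h.
apply: esym; apply: h => s sT eps eps0; have [e e0 he] := gd s sT.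
exists e => // s' s'T s's.
by rewrite -!/(v T _) he ?subrr ?normr0 ?mulr_ge0 ?(ltW eps0)// ltr01.
Qed.

End EqualPartials.

(** * Representation of the solution *)

Section FourierPairs.
Variable R : realType.
Implicit Types (I : Type) (phi psi : R -> R[i]).

Lemma fourierE phi : fourier phi = fourier_sign (-1) phi.
Proof.
by apply/funext => p; apply: eq_cintegral => x _; rewrite mulN1r.
Qed.

Lemma inv_fourierE phi : inv_fourier phi = fun x => ((2 * pi)^-1)%:C * fourier_sign 1 phi x.
Proof.
apply/funext => x; rewrite /inv_fourier; congr (_ * _).
by apply: eq_cintegral => p _; rewrite mul1r [p * x]mulrC.
Qed.

Let normN1 : `|-1 : R| = 1. Proof. by rewrite normrN normr1. Qed.

Lemma fourier_family I (A : I -> R -> R[i]) : rapid_family A ->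
  rapid_family (fun i => fourier (A i)).
Proof.
move=> hA; have -> : (fun i => fourier (A i)) = fun i => fourier_sign (-1) (A i).
  by apply/funext => i; rewrite fourierE.
exact: (fourier_sign_family normN1 hA).
Qed.

Lemma inv_fourier_family I (A : I -> R -> R[i]) : rapid_family A ->
  rapid_family (fun i => inv_fourier (A i)).
Proof.
move=> hA.
have -> : (fun i => inv_fourier (A i)) =
    fun i x => ((2 * pi)^-1)%:C * fourier_sign 1 (A i) x.
  by apply/funext => i; rewrite inv_fourierE.
apply: (@poly_rapidM _ _ (fun _ _ => ((2 * pi)^-1)%:C)).
  exact: (@poly_family_cst _ _ _ (normc ((2 * pi)^-1)%:C)).
by apply: fourier_sign_family => //; rewrite normr1.
Qed.

Let twopi_neq0 : (2 * pi)%:C != 0 :> R[i].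
Proof. by rewrite fmorph_eq0 mulf_neq0 ?pnatr_eq0// gt_eqF// pi_gt0. Qed.

Lemma inv_fourierK phi : schwartz phi -> fourier (inv_fourier phi) = phi.
Proof.
move=> /(schwartz_rapid unit) hphi; apply/funext => x; rewrite fourierE inv_fourierE.
have hF := fourier_sign_family (normr1 R) hphi.
rewrite /fourier_sign; under eq_cintegral do rewrite -mulrA.
rewrite cintegralZl//; last exact: (rapid_osc_cintegrable (-1) tt x hF).
rewrite -/(fourier_sign (-1) _ x) (fourier_inversion (normr1 R) hphi tt).
by rewrite mulrA fmorphV mulVf// mul1r.
Qed.

Lemma fourierK phi : schwartz phi -> inv_fourier (fourier phi) = phi.
Proof.
move=> /(schwartz_rapid unit) hphi; apply/funext => x; rewrite fourierE inv_fourierE.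
rewrite (_ : fourier_sign 1 = fourier_sign (- (-1 : R))); last by rewrite opprK.
have /= -> := fourier_inversion normN1 hphi tt x.
by rewrite mulrA fmorphV mulVf// mul1r.
Qed.

Lemma fourier_lin I (A B : I -> R -> R[i]) (c : R[i]) i : rapid_family A -> rapid_family B ->
  fourier (fun p => c * A i p + B i p) = fun x => c * fourier (A i) x + fourier (B i) x.
Proof.
move=> hA hB; apply/funext => x; rewrite !fourierE.
have iA := rapid_osc_cintegrable (-1) i x hA; have iB := rapid_osc_cintegrable (-1) i x hB.
rewrite /fourier_sign -cintegralZl// -cintegralD//; last exact: cintegrableZl.
by apply: eq_cintegral => p _; rewrite mulrDl -mulrA.
Qed.

End FourierPairs.

Section Propagation.
Variable R : realType.
Variables (f : R -> R) (u0 : dist R) (u du : R -> dist R).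
Hypothesis f_smooth : smooth f.
Hypothesis f_growth : derivatives_poly_growth f.
Hypothesis u_C1 : C1_dist u du.
Hypothesis u_eq : forall t, 0 <= t ->
  dist_eq (fun phi => (0 +i* 1) * du t phi - fourier_multiplier f (u t) phi) (fun=> 0).
Variable phi : R -> R[i].
Hypothesis phi_schwartz : schwartz phi.

Let chi := inv_fourier phi.
Let X (tau : R) (p : R) : R[i] := expi (- (tau * f p)) * chi p.
Let Y (tau : R) (p : R) : R[i] := - 'i * (f p)%:C * X tau p.

Let chi_family I : rapid_family (fun _ : I => chi).
Proof. exact: (inv_fourier_family (schwartz_rapid I phi_schwartz)). Qed.

Let X_family I (tau : I -> R) (B : R) : (forall i, `|tau i| <= B) ->
  rapid_family (fun i => X (tau i)).
Proof.
by move=> hB; apply: poly_rapidM (chi_family I); exact: (phase_family f_smooth f_growth hB).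
Qed.

Let mi_family I : poly_family (fun (_ : I) (p : R) => - 'i * (f p)%:C).
Proof.
apply: (@poly_familyM _ _ (fun _ _ => - 'i)).
  by apply: (@poly_family_cst _ _ _ 1) => i; rewrite normcN normc_i.
exact: (poly_family_derive I f_smooth f_growth 0).
Qed.

Let X1 tau : rapid_family (fun _ : unit => X tau).
Proof. exact: (@X_family unit (fun=> tau) `|tau|). Qed.

Let Y1 tau : rapid_family (fun _ : unit => Y tau).
Proof. by apply: poly_rapidM (X1 tau); exact: mi_family. Qed.

Let u_tempered t : 0 <= t -> tempered (u t).
Proof. by move=> /u_C1[]. Qed.

Let fourier_schwartz (A : R -> R[i]) : rapid_family (fun _ : unit => A) ->
  schwartz (fourier A).
Proof. by move=> /fourier_family/(rapid_schwartz tt). Qed.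

Let u_lin t (c : R[i]) (A B : R -> R[i]) : 0 <= t ->
  rapid_family (fun _ : unit => A) -> rapid_family (fun _ : unit => B) ->
  u t (fourier (fun p => c * A p + B p)) = c * u t (fourier A) + u t (fourier B).
Proof.
move=> t0 hA hB; have [lin _] := u_tempered t0.
by rewrite (fourier_lin c tt hA hB) lin//; exact: fourier_schwartz.
Qed.

(** The equation turns the time derivative into multiplication by [- i f] on the
    Fourier side, which is also the derivative of [X] in its parameter. *)
Let du_X t tau : 0 <= t -> du t (fourier (X tau)) = u t (fourier (Y tau)).
Proof.
move=> t0; have sX := fourier_schwartz (X1 tau).
have := u_eq t0 sX; rewrite /fourier_multiplier /dist_inv_fourier /dist_mul /dist_fourier.
rewrite fourierK; last exact: (rapid_schwartz tt (X1 tau)).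
move=> /eqP; rewrite subr_eq0 => /eqP e.
have fX : rapid_family (fun _ : unit => (fun p => (f p)%:C * X tau p)).
  apply: poly_rapidM (X1 tau); exact: (poly_family_derive unit f_smooth f_growth 0).
have -> : Y tau = fun p => (- 'i - 1) * ((f p)%:C * X tau p) + (f p)%:C * X tau p.
  by apply/funext => p; rewrite /Y; ring.
rewrite u_lin// -e; set d := du _ _.
have ii : 'i * 'i = -1 :> R[i] by rewrite -expr2 sqr_i.
have -> : (0 +i* 1 : R[i]) = 'i by [].
have -> : (- 'i - 1) * ('i * d) + 'i * d = - ('i * 'i) * d by ring.
by rewrite ii opprK mul1r.
Qed.

Section Part.
(** [part] stands for the real or the imaginary part. *)
Variable part : R[i] -> R.
Hypothesis partB : forall z w, part (z - w) = part z - part w.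
Hypothesis partZ : forall (a : R) z, part (a%:C * z) = a * part z.
Hypothesis part_le : forall z, `|part z| <= normc z.
Hypothesis part_cvg : forall (T : Type) (F : set_system T) (h : T -> R[i]) l,
  ccvg_to F h l -> part (h x) @[x --> F] --> part l.

Let K s tau := part (u s (fourier (X tau))).
Let D s tau := part (u s (fourier (Y tau))).

Let K_derive tau s : 0 <= s -> forall eps : R, 0 < eps ->
  exists2 d : R, 0 < d & forall s', 0 <= s' -> `|s' - s| < d ->
    `|K s' tau - K s tau - (s' - s) * D s tau| <= eps * `|s' - s|.
Proof.
move=> s0 eps eps0; have [_ _ dK _] := u_C1 s0.
have /part_cvg := dK _ (fourier_schwartz (X1 tau)).
move=> /cvgrPdist_le /(_ eps eps0) /nbhs_ballP[d /= d0 hd].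
exists d => // s' s'0 s'd; have [->|s's] := eqVneq s' s.
  by rewrite !subrr mul0r subrr normr0 mulr0.
have := hd s'; rewrite /ball/= distrC => /(_ s'd s's s'0).
rewrite du_X// partZ partB -/(K s' tau) -/(K s tau) -/(D s tau) => h.
have ss : s' - s != 0 by rewrite subr_eq0.
have -> : K s' tau - K s tau - (s' - s) * D s tau =
    - ((D s tau - (s' - s)^-1 * (K s' tau - K s tau)) * (s' - s)) by field.
by rewrite normrN normrM ler_wpM2r.
Qed.

Let D_continuous tau s : 0 <= s -> forall eps : R, 0 < eps ->
  exists2 d : R, 0 < d & forall s', 0 <= s' -> `|s' - s| < d ->
    `|D s' tau - D s tau| <= eps.
Proof.
move=> s0 eps eps0; have [_ _ _ cd] := u_C1 s0.
have /part_cvg := cd _ (fourier_schwartz (X1 tau)).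
move=> /cvgrPdist_le /(_ eps eps0) /nbhs_ballP[d /= d0 hd].
exists d => // s' s'0 s'd.
by have := hd s'; rewrite /ball/= !du_X// distrC => /(_ s'd s'0); rewrite distrC.
Qed.

(** The remainder is [h ^+ 2] times the value of [u s] on a member of a bounded
    family, indexed by the [(tau, h)] with [h != 0]. *)
Let K_taylor2 (T s : R) : 0 <= s -> exists n : nat, forall tau h,
  `|tau| <= T + 1 -> `|h| <= 1 ->
  `|K s (tau + h) - K s tau - h * D s tau| <= n%:R * h ^+ 2.
Proof.
move=> s0.
pose I := {th : R * R | `|th.1| <= T + 1 /\ (th.2 != 0 /\ `|th.2| <= 1)}.
pose G (i : I) (p : R) : R[i] := ((sval i).2 ^- 2)%:C *
  (expi (- ((sval i).2 * f p)) - 1 + 'i * ((sval i).2 * f p)%:C) * X (sval i).1 p.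
have hG : rapid_family G.
  apply: poly_rapidM.
    apply: (phase_remainder_family f_smooth f_growth (h := fun i : I => (sval i).2) (B := 1)).
      by move=> i; have [_ []] := svalP i.
    by move=> i; have [_ []] := svalP i.
  by apply: (@X_family I (fun i => (sval i).1) (T + 1)) => i; have [] := svalP i.
have [C hC] := tempered_rapid_bounded (u_tempered s0) (fourier_family hG).
exists (Num.truncn `|C|).+1 => tau h htau hh.
have [->|h0] := eqVneq h 0.
  by rewrite addr0 mul0r subr0 subrr normr0 expr0n mulr0.
pose i : I := exist _ (tau, h) (conj htau (conj h0 hh)).
have Gi : rapid_family (fun _ : unit => G i) by move=> n; exact: (derivs_reindex (fun=> i) (hG n)).
have XE : X (tau + h) = fun p => (h ^+ 2)%:C * G i p + (h%:C * Y tau p + X tau p).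
  apply/funext => p; rewrite /X /Y /G /= mulrDl opprD expiD.
  have key (H F E E' c w : R[i]) : H != 0 ->
      E' * E * c = H ^+ 2 * (H ^- 2 * (E - 1 + w * (H * F)) * (E' * c)) +
        (H * (- w * F * (E' * c)) + E' * c).
    by move=> H0; field.
  rewrite (key h%:C (f p)%:C _ _ _ 'i) ?fmorph_eq0// /X.
  by rewrite !(rmorphM, rmorphXn, fmorphV).
have YX : rapid_family (fun _ : unit => (fun p => h%:C * Y tau p + X tau p)).
  move=> n; apply: (derivsD (@uniformly_rapidD _ _)); last exact: X1.
  apply: (derivsM (@uniformly_rapidD _ _) (@uniformly_poly_rapidM _ _)); last exact: Y1.
  exact: (@poly_family_cst _ _ _ (normc h%:C)).
have -> : K s (tau + h) - K s tau - h * D s tau = h ^+ 2 * part (u s (fourier (G i))).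
  rewrite /K XE u_lin// u_lin//.
  rewrite -partZ -partB -partZ -partB; congr part; ring.
rewrite normrM ger0_norm ?sqr_ge0// mulrC ler_wpM2r ?sqr_ge0//.
apply: (le_trans (part_le _)); apply: (le_trans (hC i)); apply: (le_trans (ler_norm C)).
exact/ltW/truncnS_gt.
Qed.

(** [K t 0] and [K 0 t] are the two sides: [X 0] is the inverse transform of [phi]. *)
Lemma part_propagation t : 0 <= t -> part (u t phi) = part (u 0 (fourier (X t))).
Proof.
move=> t0; have phiE : phi = fourier (X 0).
  rewrite (_ : X 0 = chi) ?inv_fourierK//.
  by apply/funext => p; rewrite /X mul0r oppr0 expi0 mul1r.
move: t0; rewrite le_eqVlt => /predU1P[<-|t0]; first by rewrite -phiE.
rewrite {1}phiE -/(K t 0) -/(K 0 t); apply: (@equal_partials_antidiagonal _ K D t) => //.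
- move=> tau s /andP[s0 _] eps /(K_derive tau s0)[d d0 hd].
  by exists d => // s' /andP[s'0 _]; exact: hd.
- move=> tau s /andP[s0 _] eps /(D_continuous tau s0)[d d0 hd].
  by exists d => // s' /andP[s'0 _]; exact: hd.
- by move=> s /andP[s0 _]; exact: K_taylor2.
Qed.

End Part.

Lemma solution_propagation t : 0 <= t ->
  u t phi = u 0 (fourier (fun p => expi (- (t * f p)) * inv_fourier phi p)).
Proof.
move=> t0; apply: complex_ext; apply: part_propagation => //.
- by move=> z w; rewrite !ReImE.
- by move=> a z; rewrite ReImE /= mul0r subr0.
- exact: normr_Re_le_normc.
- by move=> T F h l [].
- by move=> z w; rewrite !ReImE.
- by move=> a z; rewrite !ReImE /= mul0r addr0.
- exact: normr_Im_le_normc.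
- by move=> T F h l [].
Qed.

End Propagation.

Section Representation.
Variable R : realType.

(** After propagation back to time 0, the distribution [u0] acts by integration
    against the amplitude; the multiplication formula moves the Fourier transform
    from [phi] to [amplitude * exp (- i t f)]. *)
Lemma solution_represented (f : R -> R) (betap betam rho cp cm : R)
    (u0 : dist R) (mu alpha r : R) (ut : R -> R[i]) (M M' : R) (u : R -> dist R) :
  derivatives_poly_growth f -> condition_S f betap betam rho cp cm ->
  condition_C3 u0 mu alpha r ut M M' -> betam < alpha - mu -> r <= rho ->
  evolution_solution f u0 u ->
  forall t, 0 <= t -> represented_by (u t) (solution_fun f mu ut t).
Proof.
move=> f_growth f_S u0_C3 alpha_mu r_rho [du [u_C1 u_eq u_0]] t t0 phi sphi.
have f_smooth := S_smooth f_S.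
pose chi := inv_fourier phi.
pose X (p : R) : R[i] := expi (- (t * f p)) * chi p.
have hX : rapid_family (fun _ : unit => X).
  apply: poly_rapidM (inv_fourier_family (schwartz_rapid unit sphi)).
  exact: (phase_family f_smooth f_growth (h := fun=> t) (fun=> lexx _)).
pose a p := amplitude mu ut p * expi (- (t * f p)).
have ai : cintegrable setT a.
  have [h _] := solution_integrable f_S u0_C3 alpha_mu t 0.
  by apply: eq_cintegrable h => // p _; rewrite mul0r addr0.
have phii : cintegrable setT phi := rapid_cintegrable tt (schwartz_rapid unit sphi).
have solE x : solution_fun f mu ut t x = ((2 * pi)^-1)%:C * fourier_sign 1 a x.
  congr (_ * _); apply: eq_cintegral => p _.
  by rewrite expiD mulrA mul1r [p * x]mulrC.
have [I1 E] := fourier_sign_multiplication 1 ai phii.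
have [I2 _] := fourier_sign_multiplication 1 phii ai.
have prodE x : solution_fun f mu ut t x * phi x =
    ((2 * pi)^-1)%:C * (phi x * fourier_sign 1 a x).
  by rewrite solE mulrAC mulrA.
split.
  apply: (eq_cintegrable measurableT _ (cintegrableZl ((2 * pi)^-1)%:C measurableT I2)) => x _.
  by rewrite prodE.
rewrite (solution_propagation f_smooth f_growth u_C1 u_eq sphi t0).
rewrite u_0; last exact: (rapid_schwartz tt (fourier_family hX)).
have [_ E0] := C3_fourier u0_C3 (rapid_schwartz tt hX).
rewrite /dist_fourier in E0; rewrite -/chi -/X E0.
transitivity (((2 * pi)^-1)%:C * cintegral setT (fun p => a p * fourier_sign 1 phi p)).
  rewrite -(cintegralZl _ measurableT I1); apply: eq_cintegral => p _.
  by rewrite /X /chi inv_fourierE /a mulrA mulrCA.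
by rewrite E -(cintegralZl _ measurableT I2); apply: eq_cintegral => x _; rewrite prodE.
Qed.

End Representation.

Theorem theorem2p5 (R : realType) (f : R -> R) (betap betam rho cp cm : R)
    (u0 : dist R) (mu alpha r : R) (ut : R -> R[i]) (M M' : R)
    (u : R -> dist R)
    (f_growth : derivatives_poly_growth f)
    (f_S : condition_S f betap betam rho cp cm)
    (u0_tempered : tempered u0)
    (u0_C3 : condition_C3 u0 mu alpha r ut M M')
    (alpha_mu : betam < alpha - mu)
    (r_rho : r <= rho)
    (u_sol : evolution_solution f u0 u) :
  [/\ cvg ((f^`()) p @[p --> -oo]) /\ cvg ((f^`()) p @[p --> +oo]),
      [/\ 0 < min_f2 f (Jminus rho), 0 < min_f2 f (Jplus rho),
          0 < mtilde_minus f rho & 0 < mtilde_plus f rho],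
      forall t, 0 <= t -> represented_by (u t) (solution_fun f mu ut t),
      forall t x, cone f (t, x) ->
        normc (solution_fun f mu ut t x)
          <= c1 f mu ut rho * t `^ (- (mu / 2))
             + c2 mu alpha betam cm M M' * t `^ (- (1 / 2))
    & forall t x, cone_compl f (t, x) ->
        normc (solution_fun f mu ut t x)
          <= cc1 f mu ut rho * t `^ (- mu)
             + cc2 mu alpha betam cm M M' * t^-1].
Proof.
split.
- split; [exact: (slope_ninfty_cvg f_S)|exact: (slope_pinfty_cvg f_S)].
- have [mt1 mt2] := mtilde_gt0 f_S.
  split => //.
    by have [] := min_f2_Jminus f_S.
  by have [] := min_f2_Jplus f_S.
- exact: (solution_represented f_growth f_S u0_C3 alpha_mu r_rho u_sol).
- by move=> t x; exact: (solution_cone_le f_S u0_C3 alpha_mu r_rho).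
- by move=> t x; exact: (solution_cone_compl_le f_S u0_C3 alpha_mu r_rho).
Qed.
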